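(* Let $m\in\mathbb N^+$ and let $V\in C^\infty(\mathbb T^2;\mathbb R)$ be resonantly unstable with respect to $m$, i.e. $\langle V\rangle_m$ has at least one zero and every zero $x_0$ of $\langle V\rangle_m$ satisfies $\langle V\rangle_m'(x_0)\neq 0$. Then there exist $\epsilon(V)>0$ and $\delta_1,\delta_2>0$ such that for every $0<\epsilon<\epsilon(V)$ and every $s>1$ there exists $u_0\in\mathcal H^s(\mathbb T)$, $u_0\neq 0$, such that the solution $u$ of $$\partial_t u=(m+\epsilon V(t,x))\partial_x u+\tfrac{\epsilon}{2}\partial_x V(t,x)\,u,\qquad u(0,\cdot)=u_0,$$ satisfies $$\|u(t)\|_s\ge \delta_1 e^{\epsilon\delta_2 t}\|u_0\|_s\qquad\text{for all } t>0.$$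
   Context: $\mathbb T:=\mathbb R/2\pi\mathbb Z$. For $s\in\mathbb R$, $\mathcal H^s(\mathbb T)$ is the space of $u$ with $\|u\|_s^2:=\sum_{k\in\mathbb Z}\langle k\rangle^{2s}|u_k|^2<\infty$, where $\langle k\rangle=(1+k^2)^{1/2}$ and $u_k$ are the Fourier coefficients of $u$. For $V\in C^\infty(\mathbb T^2;\mathbb C)$ with Fourier expansion $V(t,x)=\sum_{k,\ell\in\mathbb Z}v_{k,\ell}e^{i(kx+\ell t)}$, the resonant average of $V$ with respect to $m\in\mathbb N^+$ is $\langle V\rangle_m(x):=\sum_{k\in\mathbb Z}v_{k,mk}e^{ikx}$. *)

(* Defs.v *)
From Stdlib Require Import Reals ZArith List.
From Coquelicot Require Import Coquelicot.
Open Scope R_scope.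

Definition expi (th : R) : C := (cos th, sin th).

Definition CRInt (f : R -> C) (a b : R) : C := @RInt C_R_CompleteNormedModule f a b.
Definition rscal (r : R) (z : C) : C := Cmult (RtoC r) z.

Definition periodic1 {T} (f : R -> T) : Prop := forall x, f (x + 2 * PI) = f x.
Definition periodic2 (V : R -> R -> R) : Prop :=
  forall t x, V (t + 2 * PI) x = V t x /\ V t (x + 2 * PI) = V t x.

Definition Dpart (b : bool) (f : R -> R -> R) : R -> R -> R :=
  if b then fun t x => Derive (fun s => f s x) t
  else fun t x => Derive (fun y => f t y) x.
Definition Diter (l : list bool) (f : R -> R -> R) : R -> R -> R :=
  fold_right Dpart f l.

Definition smooth2 (f : R -> R -> R) : Prop :=
  forall (l : list bool) (t x : R),
    ex_derive (fun s => Diter l f s x) t /\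
    ex_derive (fun y => Diter l f t y) x /\
    continuous (fun p : R * R => Diter l f (fst p) (snd p)) (t, x).

Definition smooth_T2 (V : R -> R -> R) : Prop := periodic2 V /\ smooth2 V.

Definition test_fun (phi : R -> R) : Prop :=
  periodic1 phi /\ forall (n : nat) (x : R), ex_derive (Derive_n phi n) x.

Definition fourier2 (V : R -> R -> R) (k l : Z) : C :=
  rscal (/ (4 * PI ^ 2))
    (CRInt (fun t => CRInt (fun x => rscal (V t x) (expi (- (IZR k * x + IZR l * t))))
                      0 (2 * PI)) 0 (2 * PI)).

Definition sumZ (f : Z -> C) (N : nat) : C :=
  @sum_n C_AbelianGroup (fun j => f (Z.of_nat j - Z.of_nat N)%Z) (2 * N).

Definition resavg_term (V : R -> R -> R) (m : nat) (x : R) (k : Z) : C :=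
  Cmult (fourier2 V k (Z.of_nat m * k)%Z) (expi (IZR k * x)).
Definition resavg (V : R -> R -> R) (m : nat) (x : R) : C :=
  (real (Lim_seq (fun N => fst (sumZ (resavg_term V m x) N))),
   real (Lim_seq (fun N => snd (sumZ (resavg_term V m x) N)))).
Definition resavg_deriv (V : R -> R -> R) (m : nat) (x : R) : C :=
  (Derive (fun y => fst (resavg V m y)) x, Derive (fun y => snd (resavg V m y)) x).

Definition resonantly_unstable (V : R -> R -> R) (m : nat) : Prop :=
  (exists x0, resavg V m x0 = 0%C) /\
  (forall x0, resavg V m x0 = 0%C -> resavg_deriv V m x0 <> 0%C).

Definition fc (u : R -> C) (k : Z) : C :=
  rscal (/ (2 * PI)) (CRInt (fun x => Cmult (u x) (expi (- (IZR k * x)))) 0 (2 * PI)).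

Definition Hs_weight (s : R) (k : Z) (u : R -> C) : R :=
  Rpower (1 + IZR k ^ 2) s * (Cmod (fc u k)) ^ 2.

Definition inHs (s : R) (u : R -> C) : Prop :=
  ex_series (fun n : nat => Hs_weight s (Z.of_nat n) u) /\
  ex_series (fun n : nat => Hs_weight s (- Z.of_nat (S n))%Z u).

Definition Hs_norm (s : R) (u : R -> C) : R :=
  sqrt (Series (fun n : nat => Hs_weight s (Z.of_nat n) u) +
        Series (fun n : nat => Hs_weight s (- Z.of_nat (S n))%Z u)).

(* Solution on t >= 0 of  d_t u = (m + eps V) d_x u + eps/2 (d_x V) u,
   u(0) = u0, in H^s: u(t) is a continuous periodic H^s function for t >= 0,
   the equation holds in the sense of distributions in x, classically in t
   (tested against every smooth periodic test function phi), the pairings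
   are right-continuous at t = 0 and u(0) = u0 as elements of H^s. *)
Definition pairing (w : R -> C) (phi : R -> R) : C :=
  CRInt (fun x => rscal (phi x) (w x)) 0 (2 * PI).

Definition is_solution (s : R) (m : nat) (eps : R) (V : R -> R -> R)
    (u0 : R -> C) (u : R -> R -> C) : Prop :=
  (forall t, 0 <= t ->
     periodic1 (u t) /\ (forall x, continuous (u t) x) /\ inHs s (u t)) /\
  (forall k, fc (u 0) k = fc u0 k) /\
  (forall phi, test_fun phi ->
     filterlim (fun t => pairing (u t) phi) (at_right 0)
               (locally (pairing (u 0) phi)) /\
     forall t, 0 < t ->
       @is_derive R_AbsRing C_R_NormedModule (fun tau => pairing (u tau) phi) t
         (pairing (u t) (fun x =>
            - Derive (fun y => (INR m + eps * V t y) * phi y) x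
            + eps / 2 * Derive (fun y => V t y) x * phi x))).

(* Main.v *)
(** Take [u0 = 1].  With [b = - (m + eps V)] and [psi] the flow of [y' = b(t,y)], the solution is
    [u(t,x) = (d/dx psi(t,.)^{-1}(x))^{1/2}], so that [u(t, psi(t,y)) = (psi_y(t,y))^{-1/2}].

    In the moving frame [z = psi + m t] the flow is [z' = - eps f(t,z)] with [f(t,z) = V(t, z - m t)],
    whose time average over a period is [<V>_m].  As [<V>_m] is periodic with simple zeros, it has a
    zero [x0] with positive derivative; averaging shows that the orbit of [x0] stays close to [x0] and
    that [psi_y(t,x0) <= exp (- eps (c t - B))].  Hence [sup u(t)] grows exponentially, and
    [sup |u| <= sum |u_k| <= C ||u||_s] for [s > 1], while [||u0||_s = 1] for every [s].

    A weak solution is unique because its pairing with a test function transported by the same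
    equation is constant; differentiating this pairing in time needs a bound on the solution that is
    uniform in time, which comes from the uniform boundedness principle on test functions. *)

Require Import Defs.
From Stdlib Require Import Reals ZArith List Lra Lia Classical ClassicalEpsilon FunctionalExtensionality.
From Coquelicot Require Import Coquelicot.
Open Scope R_scope.

(** * Joint regularity in the space variable *)

(* [RInt] types its result in a structure whose carrier is only convertible to [R]. *)
Ltac ringR := apply Rminus_diag_uniq; ring.
Ltac fieldR := apply Rminus_diag_uniq; field.

(** The operator is formally skew-symmetric, so the square root of the Jacobian in the solution
    keeps the L2 norm fixed: the growth is concentration of the solution at the attracting orbit,
    which the sup norm detects. The square root also halves the rate given by averaging. The
    averaging constants depend on [V] and [m] only, and the embedding constant does not depend on
    [s]; this is what lets [delta1] and [delta2] come before [eps] and [s]. The lower bound is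
    claimed for every weak solution, and such a solution carries no bound uniform in time, so the
    explicit one has to be shown to have the same Fourier coefficients as any other. Regularity is
    tracked as smoothness in space with joint continuity in time. This class is stable under
    products, composition, time integration, and passage to a flow and its inverse, and it is enough
    for both transport and duality. *)

Lemma exp_le_compat (x y : R) : x <= y -> exp x <= exp y.
Proof. intros [H | ->]; [now apply Rlt_le, exp_increasing | lra]. Qed.

Lemma is_derive_value (f : R -> R) (x l l' : R) :
  is_derive f x l -> l = l' -> is_derive f x l'.
Proof. now intros H <-. Qed.

Lemma is_derive_Rplus (f g : R -> R) (x l l' : R) :
  is_derive f x l -> is_derive g x l' -> is_derive (fun y => f y + g y) x (l + l').
Proof. intros; now apply (is_derive_plus (K := R_AbsRing) (V := R_NormedModule)). Qed.

Lemma is_derive_Rminus (f g : R -> R) (x l l' : R) :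
  is_derive f x l -> is_derive g x l' -> is_derive (fun y => f y - g y) x (l - l').
Proof. intros; now apply (is_derive_minus (K := R_AbsRing) (V := R_NormedModule)). Qed.

Lemma is_derive_Ropp (f : R -> R) (x l : R) : is_derive f x l -> is_derive (fun y => - f y) x (- l).
Proof. intros; now apply (is_derive_opp (K := R_AbsRing) (V := R_NormedModule)). Qed.

Lemma is_derive_Rconst (c x : R) : is_derive (fun _ : R => c) x 0.
Proof. apply (is_derive_const (K := R_AbsRing) (V := R_NormedModule)). Qed.

Lemma is_derive_Rid (x : R) : is_derive (fun y : R => y) x 1.
Proof. apply (is_derive_id (K := R_AbsRing)). Qed.

Lemma continuous_Rplus (U : UniformSpace) (f g : U -> R) (u : U) :
  continuous f u -> continuous g u -> continuous (fun v => f v + g v) u.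
Proof. intros; now apply (continuous_plus (K := R_AbsRing) (V := R_NormedModule)). Qed.

Lemma continuous_Rmult (U : UniformSpace) (f g : U -> R) (u : U) :
  continuous f u -> continuous g u -> continuous (fun v => f v * g v) u.
Proof. intros; now apply (continuous_mult (K := R_AbsRing)). Qed.

Lemma continuous_Ropp (U : UniformSpace) (f : U -> R) (u : U) :
  continuous f u -> continuous (fun v => - f v) u.
Proof. intros; now apply (continuous_opp (K := R_AbsRing) (V := R_NormedModule)). Qed.

Lemma continuous_Rminus (U : UniformSpace) (f g : U -> R) (u : U) :
  continuous f u -> continuous g u -> continuous (fun v => f v - g v) u.
Proof. intros; apply continuous_Rplus; auto using continuous_Ropp. Qed.

Lemma is_derive_continuous (f : R -> R) (x l : R) : is_derive f x l -> continuous f x.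
Proof. intros H; apply (ex_derive_continuous f); now exists l. Qed.

Lemma ex_RInt_cont (f : R -> R) (a b : R) : (forall x, continuous f x) -> ex_RInt f a b.
Proof. intros H; apply (ex_RInt_continuous (V := R_CompleteNormedModule)); auto. Qed.

Lemma is_derive_RInt_cont (f : R -> R) (a x : R) :
  (forall y, continuous f y) -> is_derive (fun y => RInt f a y) x (f x).
Proof.
  intros H; apply (is_derive_RInt (V := R_NormedModule) f _ a); [ | apply H].
  apply filter_forall; intros y; apply (RInt_correct (V := R_CompleteNormedModule)).
  now apply ex_RInt_cont.
Qed.

Lemma abs_RInt_le_const_abs (f : R -> R) (a b M : R) :
  ex_RInt f a b -> (forall x, Rmin a b <= x <= Rmax a b -> Rabs (f x) <= M) ->
  Rabs (RInt f a b) <= Rabs (b - a) * M.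
Proof.
  intros Hf HM.
  apply (norm_RInt_le_const_abs (V := R_NormedModule) f a b); [exact HM | ].
  now apply (RInt_correct (V := R_CompleteNormedModule)).
Qed.

Lemma ex_RInt_Rscal (f : R -> R) (c a b : R) : ex_RInt f a b -> ex_RInt (fun x => c * f x) a b.
Proof. intros; now apply (ex_RInt_scal (V := R_NormedModule)). Qed.

Lemma RInt_Rconst (c a b : R) : RInt (fun _ => c) a b = (b - a) * c.
Proof. apply (RInt_const (V := R_CompleteNormedModule)). Qed.

Lemma RInt_Rminus (f g : R -> R) (a b : R) :
  ex_RInt f a b -> ex_RInt g a b ->
  RInt (fun x => f x - g x) a b = RInt f a b - RInt g a b.
Proof. intros; now apply (RInt_minus (V := R_CompleteNormedModule)). Qed.

Lemma RInt_Rplus (f g : R -> R) (a b : R) :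
  ex_RInt f a b -> ex_RInt g a b ->
  RInt (fun x => f x + g x) a b = RInt f a b + RInt g a b.
Proof. intros; now apply (RInt_plus (V := R_CompleteNormedModule)). Qed.

Lemma RInt_Rscal (f : R -> R) (c a b : R) :
  ex_RInt f a b -> RInt (fun x => c * f x) a b = c * RInt f a b.
Proof. intros; now apply (RInt_scal (V := R_CompleteNormedModule)). Qed.

Lemma RInt_RChasles (f : R -> R) (a b c : R) :
  (forall x, continuous f x) -> RInt f a b + RInt f b c = RInt f a c.
Proof.
  intros H. apply (RInt_Chasles (V := R_CompleteNormedModule)); now apply ex_RInt_cont.
Qed.

Lemma RInt_FTC (f df : R -> R) (a b : R) :
  (forall x, is_derive f x (df x)) -> (forall x, continuous df x) ->
  RInt df a b = f b - f a.
Proof.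
  intros Hd Hc. apply (is_RInt_unique (V := R_CompleteNormedModule)).
  apply (is_RInt_derive (V := R_CompleteNormedModule) f df); auto.
Qed.

Lemma RInt_same (f : R -> R) (a : R) : RInt f a a = 0.
Proof. apply (RInt_point (V := R_CompleteNormedModule)). Qed.

Lemma RInt_eq (f g : R -> R) (a b : R) :
  (forall x, f x = g x) -> RInt f a b = RInt g a b.
Proof. intros H; apply RInt_ext; auto. Qed.

(** Joint continuity along the compact segment gives one radius in the parameter that serves all
    integration points. The parameter space is arbitrary because [cont2_primitive] takes a pair as
    parameter. *)
Lemma continuous_RInt_parameter (U : UniformSpace) (F : U -> R -> R) (a b : R) (u : U) :
  (forall v s, continuous (fun q : U * R => F (fst q) (snd q)) (v, s)) ->
  continuous (fun v => RInt (F v) a b) u.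
Proof.
  intros HF.
  assert (Hs : forall v s, continuous (F v) s).
  { intros v s. apply (continuous_comp_2 (fun _ : R => v) (fun s => s) F).
    apply continuous_const. apply continuous_id. apply HF. }
  apply filterlim_locally; intros eps.
  set (e := eps / (4 * (Rabs (b - a) + 1))).
  assert (Hba := Rabs_pos (b - a)).
  assert (He : 0 < e).
  { apply Rdiv_lt_0_compat. apply cond_pos. lra. }
  assert (Hd : forall s, exists d : posreal, forall v s', ball u d v -> Rabs (s' - s) < d ->
             Rabs (F v s' - F u s) < e).
  { intros s. destruct (proj1 (filterlim_locally _ _) (HF u s) (mkposreal e He)) as [d Hd].
    exists d; intros v s' Hv Hs'. apply (Hd (v, s')). split; assumption. }
  set (delta := fun s => proj1_sig (constructive_indefinite_description _ (Hd s))).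
  destruct (compactness_value_1d (Rmin a b) (Rmax a b) delta) as [d Hdd].
  exists d; intros v Hv.
  assert (Hle : Rabs (RInt (F v) a b - RInt (F u) a b) <= Rabs (b - a) * (2 * e)).
  { rewrite <- RInt_Rminus by (apply ex_RInt_cont; auto).
    apply abs_RInt_le_const_abs.
    - apply (ex_RInt_minus (V := R_NormedModule)); apply ex_RInt_cont; auto.
    (* [compactness_value_1d] provides the gauge point [r] only under a double negation, hence the
       argument by contradiction; [F v s] and [F u s] are both compared with [F u r]. *)
    - intros s Hsab. apply Rnot_lt_le; intros Hlt. apply (Hdd s Hsab).
      intros (r & Hr & Hrs & Hdr). apply (Rlt_not_le _ _ Hlt).
      assert (HH := proj2_sig (constructive_indefinite_description _ (Hd r))). cbv beta in HH.
      change (proj1_sig (constructive_indefinite_description _ (Hd r))) with (delta r) in HH.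
      assert (H1 := HH v s (ball_le _ _ _ Hdr _ Hv) Hrs).
      assert (H2 := HH u s (ball_center _ _) Hrs).
      replace (F v s - F u s) with ((F v s - F u r) - (F u s - F u r)) by ring.
      eapply Rle_trans; [apply Rabs_triang | ]. rewrite Rabs_Ropp; lra. }
  apply (Rle_lt_trans _ _ _ Hle).
  unfold e. assert (0 < eps) by apply cond_pos.
  replace (Rabs (b - a) * (2 * (eps / (4 * (Rabs (b - a) + 1)))))
    with (eps / 2 * (Rabs (b - a) / (Rabs (b - a) + 1))) by (field; lra).
  assert (Rabs (b - a) / (Rabs (b - a) + 1) <= 1).
  { apply Rmult_le_reg_r with (Rabs (b - a) + 1); [lra | ]. field_simplify; lra. }
  nra.
Qed.

Definition cont2 (f : R -> R -> R) : Prop :=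
  forall t x, continuous (fun p : R * R => f (fst p) (snd p)) (t, x).

Lemma cont2_continuous_comp (U : UniformSpace) (F : R -> R -> R) (f g : U -> R) (u : U) :
  cont2 F -> continuous f u -> continuous g u -> continuous (fun v => F (f v) (g v)) u.
Proof. intros HF Hf Hg. now apply (continuous_comp_2 f g F). Qed.

Lemma cont2_x (F : R -> R -> R) (t x : R) : cont2 F -> continuous (F t) x.
Proof.
  intros HF. apply (cont2_continuous_comp _ F (fun _ => t) (fun y => y)); auto.
  apply continuous_const. apply continuous_id.
Qed.

Lemma cont2_t (F : R -> R -> R) (t x : R) : cont2 F -> continuous (fun s => F s x) t.
Proof.
  intros HF. apply (cont2_continuous_comp _ F (fun s => s) (fun _ => x)); auto.
  apply continuous_id. apply continuous_const.
Qed.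

Lemma cont2_comp (F g h : R -> R -> R) :
  cont2 F -> cont2 g -> cont2 h -> cont2 (fun t x => F (g t x) (h t x)).
Proof.
  intros HF Hg Hh t x.
  apply (cont2_continuous_comp _ F (fun p => g (fst p) (snd p)) (fun p => h (fst p) (snd p)));
    auto.
Qed.

Lemma cont2_proj1 : cont2 (fun t _ => t).
Proof. intros t x. apply (continuous_fst (U := R_UniformSpace) (V := R_UniformSpace)). Qed.

Lemma cont2_proj2 : cont2 (fun _ x => x).
Proof. intros t x. apply (continuous_snd (U := R_UniformSpace) (V := R_UniformSpace)). Qed.

Lemma cont2_1t (f : R -> R) : (forall t, continuous f t) -> cont2 (fun t _ => f t).
Proof.
  intros Hf t x. apply (continuous_comp (fun p : R * R => fst p) f).
  apply cont2_proj1. apply Hf.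
Qed.

Lemma cont2_1x (f : R -> R) : (forall t, continuous f t) -> cont2 (fun _ x => f x).
Proof.
  intros Hf t x. apply (continuous_comp (fun p : R * R => snd p) f).
  apply cont2_proj2. apply Hf.
Qed.

Lemma cont2_plus (f g : R -> R -> R) : cont2 f -> cont2 g -> cont2 (fun t x => f t x + g t x).
Proof. intros Hf Hg t x. now apply continuous_Rplus. Qed.

Lemma cont2_mult (f g : R -> R -> R) : cont2 f -> cont2 g -> cont2 (fun t x => f t x * g t x).
Proof. intros Hf Hg t x. now apply continuous_Rmult. Qed.

Lemma cont2_const (c : R) : cont2 (fun _ _ => c).
Proof. intros t x. apply continuous_const. Qed.

Lemma cont2_swap (f : R -> R -> R) : cont2 f -> cont2 (fun t x => f x t).
Proof. intros Hf. apply cont2_comp; auto using cont2_proj1, cont2_proj2. Qed.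

Lemma cont2_ext (f g : R -> R -> R) : (forall t x, f t x = g t x) -> cont2 f -> cont2 g.
Proof.
  intros H Hf t x. apply (continuous_ext (fun p : R * R => f (fst p) (snd p))); auto.
Qed.

Lemma cont2_continuity_2d_pt (f : R -> R -> R) (t x : R) : cont2 f -> continuity_2d_pt f t x.
Proof. intros Hf. apply continuity_2d_pt_filterlim. apply Hf. Qed.

Lemma cont2_RInt_x (f : R -> R -> R) (a b : R) :
  cont2 f -> forall t, continuous (fun t => RInt (fun x => f t x) a b) t.
Proof.
  intros Hf t. apply (continuous_RInt_parameter R_UniformSpace f). intros v s. apply Hf.
Qed.

Lemma cont2_primitive (f : R -> R -> R) :
  cont2 f -> cont2 (fun t x => RInt (fun s => f s x) 0 t).
Proof.
  intros Hf.
  (* The substitution [s = t * r] moves the variable endpoint into the integrand, leaving a fixed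
     interval and the pair [(t, x)] as parameter. *)
  apply (cont2_ext (fun t x => RInt (fun r => t * f (t * r) x) 0 1)).
  { intros t x.
    assert (H := RInt_comp_lin (V := R_CompleteNormedModule) (fun s => f s x) t 0 0 1).
    rewrite Rmult_0_r, Rmult_1_r, !Rplus_0_r in H. rewrite <- H.
    - apply RInt_eq. intros r. unfold scal; simpl; unfold mult; simpl. now rewrite Rplus_0_r.
    - apply ex_RInt_cont. intros s. now apply cont2_t. }
  intros t x.
  apply (continuous_RInt_parameter _ (fun (p : R * R) r => fst p * f (fst p * r) (snd p))).
  intros p r.
  assert (H1 : continuous (fun q : R * R * R => fst (fst q)) (p, r)).
  { apply (continuous_comp (fun q : R * R * R => fst q) (fun p : R * R => fst p)).
    apply continuous_fst. destruct p; apply cont2_proj1. }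
  assert (H2 : continuous (fun q : R * R * R => snd (fst q)) (p, r)).
  { apply (continuous_comp (fun q : R * R * R => fst q) (fun p : R * R => snd p)).
    apply continuous_fst. destruct p; apply cont2_proj2. }
  apply continuous_Rmult; auto.
  apply (cont2_continuous_comp _ f (fun q : R * R * R => fst (fst q) * snd q)); auto.
  apply continuous_Rmult; auto. apply continuous_snd.
Qed.

Lemma is_derive_RInt_parameter (f fx : R -> R -> R) (a b x : R) :
  cont2 f -> cont2 fx -> (forall t x, is_derive (f t) x (fx t x)) ->
  is_derive (fun y => RInt (fun t => f t y) a b) x (RInt (fun t => fx t x) a b).
Proof.
  intros Hf Hfx Hd.
  rewrite (RInt_eq (fun t => fx t x) (fun t => Derive (fun y => f t y) x) a b)
    by (intros t; symmetry; now apply is_derive_unique).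
  apply (is_derive_RInt_param (fun y t => f t y)).
  - apply filter_forall; intros y t _. now exists (fx t y).
  - intros t _. apply (cont2_continuity_2d_pt (fun u v => Derive (fun z => f v z) u)).
    apply (cont2_ext (fun u v => fx v u)).
    + intros u v. symmetry. now apply is_derive_unique.
    + now apply cont2_swap.
  - apply filter_forall; intros y. apply ex_RInt_cont. intros t. now apply cont2_t.
Qed.

(* Fubini: both sides have the same derivative in the upper bound of the [t]-integral. *)
Lemma RInt_RInt_swap (f : R -> R -> R) (a b c d : R) :
  cont2 f ->
  RInt (fun t => RInt (fun x => f t x) a b) c d = RInt (fun x => RInt (fun t => f t x) c d) a b.
Proof.
  intros Hf.
  set (g := fun s => RInt (fun t => RInt (fun x => f t x) a b) c s
                     - RInt (fun x => RInt (fun t => f t x) c s) a b).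
  assert (Hg : forall s, is_derive g s 0).
  { intros s. unfold g.
    eapply is_derive_value.
    - apply is_derive_Rminus.
      + apply (is_derive_RInt_cont (fun t => RInt (fun x => f t x) a b)).
        now apply cont2_RInt_x.
      + apply (is_derive_RInt_parameter (fun x s => RInt (fun t => f t x) c s) (fun x s => f s x)).
        * apply cont2_ext with (fun x s =>
            RInt (fun t => f t x) 0 s + - RInt (fun t => f t x) 0 c).
          { intros x s'.
            rewrite <- (RInt_RChasles (fun t => f t x) 0 c s') by (intros; now apply cont2_t).
            ring. }
          apply cont2_plus.
          { apply (cont2_swap _ (cont2_primitive f Hf)). }
          apply cont2_ext with (fun x s => -1 * RInt (fun t => f t x) 0 c).
          { intros; ring. }
          apply cont2_mult. apply cont2_const.
          apply (cont2_1t (fun x => RInt (fun t => f t x) 0 c)).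
          apply (cont2_RInt_x (fun x t => f t x)). now apply cont2_swap.
        * now apply cont2_swap.
        * intros x s'. apply (is_derive_RInt_cont (fun t => f t x)).
          intros; now apply cont2_t.
    - unfold minus, plus, opp; simpl. ring. }
  assert (Hcd : g c = g d).
  { destruct (Rtotal_order c d) as [H | [H | H]].
    - apply (eq_is_derive g); auto.
    - now rewrite H.
    - symmetry; apply (eq_is_derive g); auto. }
  unfold g in Hcd. rewrite RInt_same in Hcd.
  rewrite (RInt_eq _ (fun _ => 0)) in Hcd by (intros x; apply RInt_same).
  rewrite !RInt_Rconst in Hcd.
  lra.
Qed.

(* Regularity is only asked in the second variable; in [t], just joint continuity. *)
Fixpoint Cx (n : nat) (f : R -> R -> R) : Prop :=
  match n with
  | O => cont2 f
  | S n => cont2 f /\ exists fx, (forall t x, is_derive (f t) x (fx t x)) /\ Cx n fx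
  end.

Definition Cinf (f : R -> R -> R) : Prop := forall n, Cx n f.

Lemma Cx_cont (n : nat) (f : R -> R -> R) : Cx n f -> cont2 f.
Proof. destruct n; simpl; tauto. Qed.

Lemma Cx_pred (n : nat) : forall f, Cx (S n) f -> Cx n f.
Proof.
  induction n as [ | n IH]; intros f H.
  - exact (proj1 H).
  - destruct H as (H & fx & Hd & Hx). split; auto. exists fx. split; auto.
Qed.

Lemma Cx_ext (n : nat) (f g : R -> R -> R) : (forall t x, f t x = g t x) -> Cx n f -> Cx n g.
Proof.
  intros H Hf. replace g with f; auto.
  apply functional_extensionality; intros t; apply functional_extensionality; auto.
Qed.

Lemma Cx_plus (n : nat) : forall f g, Cx n f -> Cx n g -> Cx n (fun t x => f t x + g t x).
Proof.
  induction n as [ | n IH]; simpl; intros f g.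
  - apply cont2_plus.
  - intros (Hf & fx & Hfd & Hfx) (Hg & gx & Hgd & Hgx). split.
    + now apply cont2_plus.
    + exists (fun t x => fx t x + gx t x). split; auto. intros t x.
      now apply is_derive_Rplus.
Qed.

Lemma Cx_mult (n : nat) : forall f g, Cx n f -> Cx n g -> Cx n (fun t x => f t x * g t x).
Proof.
  induction n as [ | n IH]; intros f g Hf Hg.
  - now apply cont2_mult.
  - assert (Hf' := Cx_pred _ _ Hf). assert (Hg' := Cx_pred _ _ Hg).
    destruct Hf as (Hf & fx & Hfd & Hfx). destruct Hg as (Hg & gx & Hgd & Hgx). split.
    + now apply cont2_mult.
    + exists (fun t x => fx t x * g t x + f t x * gx t x). split.
      * intros t x. apply (is_derive_mult (f t) (g t)); auto. intros; apply Rmult_comm.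
      * apply Cx_plus; apply IH; auto.
Qed.

Lemma Cx_fun_t (g : R -> R) (n : nat) : (forall t, continuous g t) -> Cx n (fun t _ => g t).
Proof.
  assert (Hz : forall k, Cx k (fun _ _ => 0)).
  { induction k as [ | k IH].
    - apply cont2_const.
    - split. apply cont2_const. exists (fun _ _ => 0). split; auto.
      intros t x. apply is_derive_Rconst. }
  intros Hg. destruct n; simpl.
  - now apply cont2_1t.
  - split. now apply cont2_1t. exists (fun _ _ => 0). split; auto.
    intros t x. apply is_derive_Rconst.
Qed.

Lemma Cx_const (c : R) (n : nat) : Cx n (fun _ _ => c).
Proof. apply (Cx_fun_t (fun _ => c)). intros; apply continuous_const. Qed.

Lemma Cx_id (n : nat) : Cx n (fun _ x => x).
Proof.
  destruct n; simpl.
  - apply cont2_proj2.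
  - split. apply cont2_proj2. exists (fun _ _ => 1). split.
    + intros t x. apply is_derive_Rid.
    + apply Cx_const.
Qed.

Lemma Cx_opp (n : nat) (f : R -> R -> R) : Cx n f -> Cx n (fun t x => - f t x).
Proof.
  intros H. apply (Cx_ext n (fun t x => -1 * f t x)). intros; ring.
  apply Cx_mult; auto using Cx_const.
Qed.

Lemma Cx_minus (n : nat) (f g : R -> R -> R) : Cx n f -> Cx n g -> Cx n (fun t x => f t x - g t x).
Proof. intros. apply Cx_plus; auto using Cx_opp. Qed.

Lemma Cx_comp (n : nat) : forall f g, Cx n f -> Cx n g -> Cx n (fun t x => f t (g t x)).
Proof.
  induction n as [ | n IH]; intros f g Hf Hg.
  - apply (cont2_comp f (fun t _ => t) g); auto using cont2_proj1.
  - assert (Hg' := Cx_pred _ _ Hg).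
    destruct Hf as (Hf & fx & Hfd & Hfx). destruct Hg as (Hg & gx & Hgd & Hgx). split.
    + apply (cont2_comp f (fun t _ => t) g); auto using cont2_proj1.
    + exists (fun t x => gx t x * fx t (g t x)). split.
      * intros t x. now apply (is_derive_comp (f t) (g t)).
      * apply Cx_mult; auto.
Qed.

Lemma Cx_freeze (n : nat) (T : R) : forall f, Cx n f -> Cx n (fun _ x => f T x).
Proof.
  induction n as [ | n IH]; intros f Hf.
  - apply (cont2_1x (f T)). intros; now apply cont2_x.
  - destruct Hf as (Hf & fx & Hfd & Hfx). split.
    + apply (cont2_1x (f T)). intros; now apply cont2_x.
    + exists (fun _ x => fx T x). split; auto.
Qed.

Lemma Cx_exp (n : nat) (g : R -> R -> R) : Cx n g -> Cx n (fun t x => exp (g t x)).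
Proof.
  intros Hg. apply (Cx_comp n (fun _ x => exp x)); auto. clear Hg.
  induction n as [ | n IH].
  - apply (cont2_1x exp). intros x. apply (is_derive_continuous exp x (exp x)), is_derive_exp.
  - split.
    + apply (cont2_1x exp). intros x. apply (is_derive_continuous exp x (exp x)), is_derive_exp.
    + exists (fun _ x => exp x). split; auto. intros; apply is_derive_exp.
Qed.

Lemma Cx_sin_cos (n : nat) : Cx n (fun _ x => sin x) /\ Cx n (fun _ x => cos x).
Proof.
  assert (Hs : cont2 (fun _ x => sin x)).
  { apply (cont2_1x sin). intros x. apply (is_derive_continuous sin x (cos x)), is_derive_sin. }
  assert (Hc : cont2 (fun _ x => cos x)).
  { apply (cont2_1x cos). intros x. apply (is_derive_continuous cos x (- sin x)), is_derive_cos. }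
  induction n as [ | n [IHs IHc]]; [now split | ].
  split; split; auto.
  - exists (fun _ x => cos x). split; auto. intros; apply is_derive_sin.
  - exists (fun _ x => - sin x). split. intros; apply is_derive_cos. now apply Cx_opp.
Qed.

Lemma Cx_primitive (n : nat) : forall f, Cx n f -> Cx n (fun t x => RInt (fun s => f s x) 0 t).
Proof.
  induction n as [ | n IH]; intros f Hf.
  - now apply cont2_primitive.
  - destruct Hf as (Hf & fx & Hfd & Hfx). split.
    + now apply cont2_primitive.
    + exists (fun t x => RInt (fun s => fx s x) 0 t). split; auto.
      intros t x. apply is_derive_RInt_parameter; eauto using Cx_cont.
Qed.

Lemma Cinf_cont (f : R -> R -> R) : Cinf f -> cont2 f.
Proof. intros H. exact (H O). Qed.

Lemma Cinf_derive (f : R -> R -> R) (t x : R) : Cinf f -> is_derive (f t) x (Derive (f t) x).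
Proof.
  intros H. destruct (H 1%nat) as (_ & fx & Hd & _).
  apply Derive_correct. now exists (fx t x).
Qed.

Lemma Cinf_Derive (f : R -> R -> R) : Cinf f -> Cinf (fun t x => Derive (f t) x).
Proof.
  intros H n. destruct (H (S n)) as (_ & fx & Hd & Hx).
  apply (Cx_ext n fx); auto. intros t x. symmetry. now apply is_derive_unique.
Qed.

Lemma Cinf_Derive_n (f : R -> R -> R) (n : nat) : Cinf f -> Cinf (fun t x => Derive_n (f t) n x).
Proof.
  intros H. induction n as [ | n IH]; simpl; auto. now apply Cinf_Derive in IH.
Qed.

(** Total differentiability follows from two partial derivatives of which one, here [Ft], is
    continuous. *)
Lemma is_derive_along (F Ft Fx : R -> R -> R) (c : R -> R) (t dc : R) :
  cont2 Ft ->
  (forall t x, is_derive (fun s => F s x) t (Ft t x)) ->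
  (forall t x, is_derive (F t) x (Fx t x)) ->
  is_derive c t dc ->
  is_derive (fun s => F s (c s)) t (Ft t (c t) + Fx t (c t) * dc).
Proof.
  intros HFt Ht Hx Hc. apply is_derive_Reals.
  replace (Ft t (c t) + Fx t (c t) * dc) with (Ft t (c t) * 1 + Fx t (c t) * dc) by ring.
  apply (derivable_pt_lim_comp_2d F (fun s => s) c).
  - apply filterdiff_differentiable_pt_lim.
    apply (is_derive_filterdiff F t (c t) Ft); auto.
    now apply filter_forall.
  - apply derivable_pt_lim_id.
  - now apply is_derive_Reals.
Qed.

(** Mixed derivatives are exchanged through an integral: [w] is the time integral of [p], one
    differentiates under it in space, and then in the endpoint. *)
Lemma is_derive_swap (w p wx px : R -> R -> R) (t x : R) :
  cont2 p -> cont2 px ->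
  (forall t x, is_derive (fun s => w s x) t (p t x)) ->
  (forall t x, is_derive (w t) x (wx t x)) ->
  (forall t x, is_derive (p t) x (px t x)) ->
  is_derive (fun s => wx s x) t (px t x).
Proof.
  intros Hp Hpx Hwt Hwx Hpd.
  assert (Hw : forall s y, w s y = w 0 y + RInt (fun r => p r y) 0 s).
  { intros s y.
    rewrite (RInt_FTC (fun r => w r y)); auto. ring. intros; now apply cont2_t. }
  assert (Hx : forall s, wx s x = wx 0 x + RInt (fun r => px r x) 0 s).
  { intros s.
    rewrite <- (is_derive_unique _ _ _ (Hwx s x)). apply is_derive_unique.
    apply (is_derive_ext (fun y => w 0 y + RInt (fun r => p r y) 0 s)); [now intros; rewrite <- Hw | ].
    apply is_derive_Rplus; auto.
    now apply is_derive_RInt_parameter. }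
  apply (is_derive_ext (fun s => wx 0 x + RInt (fun r => px r x) 0 s)); [now intros; rewrite <- Hx | ].
  eapply is_derive_value.
  - apply is_derive_Rplus.
    + apply is_derive_Rconst.
    + apply (is_derive_RInt_cont (fun r => px r x)). intros; now apply cont2_t.
  - unfold plus, zero; simpl. ring.
Qed.

(** * Ordinary differential equations *)

(** Absolute values stand on both sides because the endpoints may come in either order: the
    differential equation is solved backward in time as well. *)
Lemma abs_RInt_le_abs (f g : R -> R) (a b : R) :
  (forall x, continuous f x) -> (forall x, continuous g x) -> (forall x, Rabs (f x) <= g x) ->
  Rabs (RInt f a b) <= Rabs (RInt g a b).
Proof.
  intros Hf Hg H.
  assert (Hab : forall a b, a <= b -> Rabs (RInt f a b) <= Rabs (RInt g a b)).
  { intros c d Hcd. eapply Rle_trans; [ | apply Rle_abs].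
    eapply Rle_trans; [apply abs_RInt_le; auto using ex_RInt_cont | ].
    apply RInt_le; auto using ex_RInt_cont.
    apply ex_RInt_cont. intros x. apply (continuous_comp f Rabs); auto.
    apply continuous_Rabs. }
  destruct (Rle_dec a b) as [Hle | Hle]; auto.
  rewrite <- (opp_RInt_swap (V := R_CompleteNormedModule) f) by auto using ex_RInt_cont.
  rewrite <- (opp_RInt_swap (V := R_CompleteNormedModule) g) by auto using ex_RInt_cont.
  unfold opp; simpl. rewrite !Rabs_Ropp. apply Hab. lra.
Qed.

Lemma Lipschitz_continuous (f : R -> R) (M x : R) :
  (forall s t, Rabs (f t - f s) <= M * Rabs (t - s)) -> continuous f x.
Proof.
  intros H. apply filterlim_locally; intros eps.
  assert (HM : 0 < Rabs M + 1) by (assert (H0 := Rabs_pos M); lra).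
  exists (mkposreal (eps / (Rabs M + 1)) (Rdiv_lt_0_compat _ _ (cond_pos eps) HM)).
  intros y Hy. change (Rabs (f y - f x) < eps). change (Rabs (y - x) < eps / (Rabs M + 1)) in Hy.
  apply Rle_lt_trans with ((Rabs M + 1) * Rabs (y - x)).
  - eapply Rle_trans; [apply H | ]. apply Rmult_le_compat_r. apply Rabs_pos.
    assert (H1 := Rle_abs M). lra.
  - apply Rmult_lt_reg_r with (/ (Rabs M + 1)). now apply Rinv_0_lt_compat.
    replace ((Rabs M + 1) * Rabs (y - x) * / (Rabs M + 1)) with (Rabs (y - x)) by (field; lra).
    exact Hy.
Qed.

(** The increments are controlled only from index [k] on because in [smooth_limit] the derivative of
    order [k] is controlled only for [n >= k]. *)
Lemma geometric_limit (a : nat -> R) (c : R) (k : nat) :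
  0 <= c -> (forall n, (k <= n)%nat -> Rabs (a (S n) - a n) <= c * (/ 2) ^ n) ->
  ex_finite_lim_seq a /\
  forall n, (k <= n)%nat -> Rabs (real (Lim_seq a) - a n) <= 2 * c * (/ 2) ^ n.
Proof.
  intros Hc Ha.
  (* The factor [1 - (/ 2) ^ j] is the exact partial geometric sum, which makes the induction
     close. *)
  assert (Hfar : forall j n, (k <= n)%nat ->
    Rabs (a (n + j)%nat - a n) <= 2 * c * (/ 2) ^ n * (1 - (/ 2) ^ j)).
  { induction j as [ | j IH]; intros n Hn.
    - rewrite Nat.add_0_r, Rminus_diag, Rabs_R0. simpl. lra.
    - replace (a (n + S j)%nat - a n) with ((a (S (n + j)) - a (n + j)%nat) + (a (n + j)%nat - a n))
        by (rewrite Nat.add_succ_r; ring).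
      eapply Rle_trans; [apply Rabs_triang | ].
      eapply Rle_trans; [apply Rplus_le_compat; [apply Ha; lia | now apply IH] | ].
      rewrite pow_add. simpl. apply Req_le. field. }
  assert (Hfar2 : forall j n, (k <= n)%nat -> Rabs (a (n + j)%nat - a n) <= 2 * c * (/ 2) ^ n).
  { intros j n Hn. eapply Rle_trans; [now apply Hfar | ].
    assert (H1 : 0 <= 2 * c * (/ 2) ^ n) by (apply Rmult_le_pos; [lra | apply pow_le; lra]).
    assert (H2 : 0 <= (/ 2) ^ j) by (apply pow_le; lra). nra. }
  assert (Hpow : is_lim_seq (fun n => 4 * c * (/ 2) ^ n) 0).
  { replace (Finite 0) with (Rbar_mult (4 * c) 0) by (simpl; f_equal; ring).
    apply is_lim_seq_scal_l. apply is_lim_seq_geom. rewrite Rabs_right; lra. }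
  assert (Hex : ex_finite_lim_seq a).
  { apply ex_lim_seq_cauchy_corr. intros eps.
    destruct (proj2 (is_lim_seq_spec _ _) Hpow eps) as [N0 HN].
    set (N := Nat.max N0 k). exists N. intros n m Hn Hm.
    replace n with (N + (n - N))%nat by lia. replace m with (N + (m - N))%nat by lia.
    replace (a (N + (n - N))%nat - a (N + (m - N))%nat)
      with ((a (N + (n - N))%nat - a N) - (a (N + (m - N))%nat - a N)) by ring.
    eapply Rle_lt_trans; [apply Rabs_triang | ]. rewrite Rabs_Ropp.
    eapply Rle_lt_trans; [apply Rplus_le_compat; apply Hfar2; unfold N; lia | ].
    assert (HN1 : (N0 <= N)%nat) by (unfold N; lia).
    specialize (HN N HN1). rewrite Rminus_0_r in HN.
    assert (HN' := Rle_abs (4 * c * (/ 2) ^ N)). lra. }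
  split; auto. intros n Hn.
  assert (Hl : is_lim_seq a (Finite (real (Lim_seq a)))) by now apply Lim_seq_correct'.
  assert (H1 : is_lim_seq (fun j => Rabs (a (n + j)%nat - a n)) (Rabs (real (Lim_seq a) - a n))).
  { apply (is_lim_seq_abs _ (Finite (real (Lim_seq a) - a n))). apply is_lim_seq_minus'.
    - apply (is_lim_seq_ext (fun j => a (j + n)%nat)). intros j; now rewrite Nat.add_comm.
      now apply (is_lim_seq_incr_n a).
    - apply is_lim_seq_const. }
  apply (is_lim_seq_le _ _ (Finite (Rabs (real (Lim_seq a) - a n))) (Finite (2 * c * (/ 2) ^ n))
          (fun j => Hfar2 j n Hn) H1).
  apply is_lim_seq_const.
Qed.

Fixpoint picard (b : R -> R -> R) (y0 : R) (n : nat) : R -> R :=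
  match n with
  | O => fun _ => y0
  | S n => fun t => y0 + RInt (fun s => b s (picard b y0 n s)) 0 t
  end.

Lemma primitive_Lipschitz (f : R -> R) (M : R) :
  (forall x, continuous f x) -> (forall x, Rabs (f x) <= M) ->
  forall s t, Rabs (RInt f 0 t - RInt f 0 s) <= M * Rabs (t - s).
Proof.
  intros Hf HM s t.
  rewrite <- (RInt_RChasles f 0 s t) by auto.
  rewrite Rplus_minus_l.
  rewrite Rmult_comm. apply abs_RInt_le_const_abs; auto using ex_RInt_cont.
Qed.

Lemma picard_Lipschitz (b : R -> R -> R) (M y0 : R) (n : nat) :
  cont2 b -> (forall t x, Rabs (b t x) <= M) ->
  forall s t, Rabs (picard b y0 n t - picard b y0 n s) <= M * Rabs (t - s).
Proof.
  intros Hb HM. assert (HM0 : 0 <= M).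
  { eapply Rle_trans; [apply Rabs_pos | apply (HM 0 0)]. }
  induction n as [ | n IH]; intros s t; simpl.
  - rewrite Rminus_diag, Rabs_R0. apply Rmult_le_pos; auto. apply Rabs_pos.
  - replace (y0 + RInt (fun s0 => b s0 (picard b y0 n s0)) 0 t
             - (y0 + RInt (fun s0 => b s0 (picard b y0 n s0)) 0 s))
      with (RInt (fun s0 => b s0 (picard b y0 n s0)) 0 t
            - RInt (fun s0 => b s0 (picard b y0 n s0)) 0 s) by ringR.
    apply primitive_Lipschitz; auto. intros x.
    apply (cont2_continuous_comp _ b (fun s => s)); auto. apply continuous_id.
    now apply (Lipschitz_continuous _ M).
Qed.

(** A Bielecki weight, symmetric in time. With rate [2 * L], an integral operator of Lipschitz
    constant [L] contracts by [1 / 2] in the norm weighted by it, so the iterates converge on the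
    whole line with no restriction on the length of time. *)
Definition picard_weight (L t : R) : R := exp (2 * L * t) + exp (- (2 * L * t)).

Lemma RInt_picard_weight (L t : R) : 0 < L ->
  2 * L * Rabs (RInt (picard_weight L) 0 t) <= picard_weight L t.
Proof.
  intros HL.
  rewrite (RInt_FTC (fun t => (exp (2 * L * t) - exp (- (2 * L * t))) / (2 * L))); cycle 1.
  { intros x. unfold picard_weight. auto_derive; auto. field. lra. }
  { intros x. apply (ex_derive_continuous (picard_weight L)). unfold picard_weight. auto_derive; auto. }
  unfold picard_weight.
  rewrite Rmult_0_r, Ropp_0, Rminus_diag.
  replace ((exp (2 * L * t) - exp (- (2 * L * t))) / (2 * L) - 0 / (2 * L))
    with ((exp (2 * L * t) - exp (- (2 * L * t))) / (2 * L)) by (field; lra).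
  rewrite Rabs_div, (Rabs_right (2 * L)) by lra.
  replace (2 * L * (Rabs (exp (2 * L * t) - exp (- (2 * L * t))) / (2 * L)))
    with (Rabs (exp (2 * L * t) - exp (- (2 * L * t)))) by (field; lra).
  assert (H1 := exp_pos (2 * L * t)). assert (H2 := exp_pos (- (2 * L * t))).
  apply Rabs_le; lra.
Qed.

Lemma picard_weight_continuous (L t : R) : continuous (picard_weight L) t.
Proof. apply (ex_derive_continuous (picard_weight L)). unfold picard_weight. auto_derive; auto. Qed.

Lemma picard_weight_ge (L t : R) : 0 < L -> 2 * L * Rabs t <= picard_weight L t.
Proof.
  intros HL. unfold picard_weight.
  assert (H1 := exp_pos (2 * L * t)). assert (H2 := exp_pos (- (2 * L * t))).
  assert (H3 := exp_ineq1_le (2 * L * t)). assert (H4 := exp_ineq1_le (- (2 * L * t))).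
  unfold Rabs; destruct (Rcase_abs t); nra.
Qed.

Lemma picard_step (b : R -> R -> R) (M L y0 : R) (n : nat) (t : R) :
  0 < L -> cont2 b -> (forall t x, Rabs (b t x) <= M) ->
  (forall t x y, Rabs (b t x - b t y) <= L * Rabs (x - y)) ->
  Rabs (picard b y0 (S n) t - picard b y0 n t) <= M / (2 * L) * (/ 2) ^ n * picard_weight L t.
Proof.
  intros HL Hb HM HLip.
  assert (HM0 : 0 <= M).
  { eapply Rle_trans; [apply Rabs_pos | apply (HM 0 0)]. }
  assert (Hc : forall n s, continuous (fun s => b s (picard b y0 n s)) s).
  { intros k s. apply (cont2_continuous_comp _ b (fun s => s)); auto. apply continuous_id.
    apply (Lipschitz_continuous _ M). now apply picard_Lipschitz. }
  revert t. induction n as [ | n IH]; intros t.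
  - replace (picard b y0 1 t - picard b y0 0 t) with (RInt (fun s => b s y0) 0 t) by (simpl; ringR).
    apply Rle_trans with (Rabs (t - 0) * M).
    + apply abs_RInt_le_const_abs; auto. apply ex_RInt_cont. intros; now apply cont2_t.
    + rewrite Rminus_0_r. simpl. assert (H := picard_weight_ge L t HL).
      replace (Rabs t * M) with (M / (2 * L) * (2 * L * Rabs t)) by (field; lra).
      rewrite Rmult_1_r. apply Rmult_le_compat_l; auto.
      apply Rmult_le_pos; auto. apply Rlt_le, Rinv_0_lt_compat; lra.
  - replace (picard b y0 (S (S n)) t - picard b y0 (S n) t)
      with (RInt (fun s => b s (picard b y0 (S n) s)) 0 t - RInt (fun s => b s (picard b y0 n s)) 0 t)
      by (simpl; ringR).
    rewrite <- RInt_Rminus by (apply ex_RInt_cont; apply Hc).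
    set (k := M / (2 * L) * (/ 2) ^ n) in *.
    assert (Hk : 0 <= k).
    { unfold k. apply Rmult_le_pos. apply Rmult_le_pos; auto.
      apply Rlt_le, Rinv_0_lt_compat; lra. apply pow_le; lra. }
    apply Rle_trans with (Rabs (RInt (fun s => L * k * picard_weight L s) 0 t)).
    + apply abs_RInt_le_abs.
      * intros x. apply continuous_Rminus; apply Hc.
      * intros x. apply continuous_Rmult. apply continuous_const. apply picard_weight_continuous.
      * intros s. eapply Rle_trans; [apply HLip | ]. rewrite Rmult_assoc.
        apply Rmult_le_compat_l; [lra | apply IH].
    + rewrite RInt_Rscal by (apply ex_RInt_cont; apply picard_weight_continuous).
      rewrite Rabs_mult, (Rabs_right (L * k)) by (apply Rle_ge, Rmult_le_pos; lra).
      assert (H := RInt_picard_weight L t HL).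
      replace (M / (2 * L) * (/ 2) ^ S n) with (k / 2) by (unfold k; simpl; field; lra).
      replace (L * k * Rabs (RInt (picard_weight L) 0 t))
        with (k / 2 * (2 * L * Rabs (RInt (picard_weight L) 0 t))) by fieldR.
      apply Rmult_le_compat_l; lra.
Qed.

Lemma picard_lindelof (b : R -> R -> R) (M L y0 : R) :
  0 < L -> cont2 b -> (forall t x, Rabs (b t x) <= M) ->
  (forall t x y, Rabs (b t x - b t y) <= L * Rabs (x - y)) ->
  exists y : R -> R, y 0 = y0 /\ forall t, is_derive y t (b t (y t)).
Proof.
  intros HL Hb HM HLip.
  assert (HM0 : 0 <= M).
  { eapply Rle_trans; [apply Rabs_pos | apply (HM 0 0)]. }
  set (p := picard b y0). set (K := M / (2 * L)).
  assert (HK : 0 <= K).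
  { apply Rmult_le_pos; auto. apply Rlt_le, Rinv_0_lt_compat; lra. }
  assert (HW : forall t, 0 <= picard_weight L t).
  { intros t. apply Rplus_le_le_0_compat; apply Rlt_le, exp_pos. }
  assert (Hstep : forall n t, Rabs (p (S n) t - p n t) <= K * (/ 2) ^ n * picard_weight L t).
  { intros n t. now apply picard_step. }
  assert (Hpow : forall c, is_lim_seq (fun n => c * (/ 2) ^ n) 0).
  { intros c. replace (Finite 0) with (Rbar_mult c 0) by (simpl; f_equal; ring).
    apply is_lim_seq_scal_l. apply is_lim_seq_geom. rewrite Rabs_right; lra. }
  assert (Hgeo : forall t, ex_finite_lim_seq (fun n => p n t) /\ forall n, (0 <= n)%nat ->
    Rabs (real (Lim_seq (fun n => p n t)) - p n t) <= 2 * (K * picard_weight L t) * (/ 2) ^ n).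
  { intros t. apply geometric_limit.
    - now apply Rmult_le_pos.
    - intros n _. eapply Rle_trans; [apply Hstep | ]. apply Req_le. ring. }
  set (y := fun t => real (Lim_seq (fun n => p n t))).
  assert (Hy : forall t, is_lim_seq (fun n => p n t) (y t)).
  { intros t. apply Lim_seq_correct'. apply Hgeo. }
  assert (Hylip : forall s t, Rabs (y t - y s) <= M * Rabs (t - s)).
  { intros s t.
    assert (H1 : is_lim_seq (fun n => Rabs (p n t - p n s)) (Rabs (y t - y s))).
    { apply (is_lim_seq_abs _ (Finite (y t - y s))). now apply is_lim_seq_minus'. }
    apply (is_lim_seq_le _ _ (Finite (Rabs (y t - y s))) (Finite (M * Rabs (t - s)))
            (fun n => picard_Lipschitz b M y0 n Hb HM s t) H1).
    apply is_lim_seq_const. }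
  assert (Hyn : forall n t, Rabs (y t - p n t) <= 2 * K * (/ 2) ^ n * picard_weight L t).
  { intros n t. eapply Rle_trans; [apply (proj2 (Hgeo t) n); lia | ]. apply Req_le. ring. }
  assert (Hyc : forall s, continuous (fun s => b s (y s)) s).
  { intros s. apply (cont2_continuous_comp _ b (fun s => s)); auto. apply continuous_id.
    now apply (Lipschitz_continuous _ M). }
  assert (Hpc : forall n s, continuous (fun s => b s (p n s)) s).
  { intros k s. apply (cont2_continuous_comp _ b (fun s => s)); auto. apply continuous_id.
    apply (Lipschitz_continuous _ M). now apply picard_Lipschitz. }
  (* The defect [D] of the limit is at most its distance to the iterate [S n] plus the integrated
     Lipschitz error made at the iterate [n]; both decay like [(/ 2) ^ n]. *)
  assert (Hint : forall t, y t = y0 + RInt (fun s => b s (y s)) 0 t).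
  { intros t. apply Rminus_diag_uniq.
    set (D := y t - (y0 + RInt (fun s => b s (y s)) 0 t)).
    assert (HD : forall n, Rabs D <= 2 * K * picard_weight L t * (/ 2) ^ n).
    { intros n.
      replace D with ((y t - p (S n) t)
        + RInt (fun s => b s (p n s) - b s (y s)) 0 t).
      2:{ rewrite RInt_Rminus by (apply ex_RInt_cont; auto). unfold D, p; simpl. ringR. }
      eapply Rle_trans; [apply Rabs_triang | ].
      apply Rle_trans with (2 * K * (/ 2) ^ S n * picard_weight L t
        + Rabs (RInt (fun s => L * (2 * K * (/ 2) ^ n) * picard_weight L s) 0 t)).
      - apply Rplus_le_compat; auto.
        apply abs_RInt_le_abs.
        + intros x. apply continuous_Rminus; auto.
        + intros x. apply continuous_Rmult. apply continuous_const. apply picard_weight_continuous.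
        + intros s. eapply Rle_trans; [apply HLip | ]. rewrite Rmult_assoc.
          apply Rmult_le_compat_l; [lra | ]. rewrite Rabs_minus_sym. apply Hyn.
      - rewrite RInt_Rscal by (apply ex_RInt_cont; apply picard_weight_continuous).
        assert (H0 : 0 <= K * (/ 2) ^ n) by (apply Rmult_le_pos; [lra | apply pow_le; lra]).
        rewrite Rabs_mult, (Rabs_right (L * _)) by (apply Rle_ge; nra).
        assert (H := RInt_picard_weight L t HL). simpl. nra. }
    destruct (Req_dec D 0) as [ | Hne]; auto. exfalso.
    apply Rabs_pos_lt in Hne.
    destruct (proj2 (is_lim_seq_spec _ _) (Hpow (2 * K * picard_weight L t)) (mkposreal _ Hne)) as [N HN].
    specialize (HN N (Nat.le_refl _)). simpl in HN. rewrite Rminus_0_r in HN.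
    assert (H1 := HD N). assert (H2 := Rle_abs (2 * K * picard_weight L t * (/ 2) ^ N)). lra. }
  exists y. split.
  - rewrite Hint, RInt_same. ringR.
  - intros t. apply (is_derive_ext (fun t => y0 + RInt (fun s => b s (y s)) 0 t)).
    { intros; now rewrite <- Hint. }
    eapply is_derive_value.
    + apply is_derive_Rplus.
      * apply is_derive_Rconst.
      * apply (is_derive_RInt_cont (fun s => b s (y s))). auto.
    + unfold plus, zero; simpl; ringR.
Qed.

Lemma derive_nonneg_le (f df : R -> R) (a b : R) :
  a <= b -> (forall x, is_derive f x (df x)) -> (forall x, a <= x <= b -> 0 <= df x) -> f a <= f b.
Proof.
  intros Hab Hd Hp.
  destruct (MVT_gen f a b df) as (c & Hc & HE); auto.
  - intros x _. apply continuity_pt_filterlim. now apply (is_derive_continuous f x (df x)).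
  - rewrite Rmin_left, Rmax_right in Hc by auto.
    assert (0 <= df c * (b - a)) by (apply Rmult_le_pos; [auto | lra]). lra.
Qed.

(* Gronwall for [d^2]: both [d^2 e^{2Lt}] and [- d^2 e^{-2Lt}] are nondecreasing. *)
Lemma gronwall_two_sided (d dd : R -> R) (L t : R) :
  0 <= L -> (forall t, is_derive d t (dd t)) -> (forall t, Rabs (dd t) <= L * Rabs (d t)) ->
  Rabs (d 0) <= exp (L * Rabs t) * Rabs (d t) /\ Rabs (d t) <= exp (L * Rabs t) * Rabs (d 0).
Proof.
  intros HL Hd Hdd.
  assert (Hprod : forall s, - (L * (d s * d s)) <= d s * dd s <= L * (d s * d s)).
  { intros s. apply Rabs_le_between. rewrite Rabs_mult.
    replace (d s * d s) with (Rabs (d s) * Rabs (d s)).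
    - assert (H := Hdd s). assert (H0 := Rabs_pos (d s)). nra.
    - rewrite <- Rabs_mult. apply Rabs_right. apply Rle_ge, Rle_0_sqr. }
  assert (Hup : forall a b, a <= b -> d a * d a * exp (2 * L * a) <= d b * d b * exp (2 * L * b)).
  { intros a b Hab.
    apply (derive_nonneg_le (fun s => d s * d s * exp (2 * L * s))
             (fun s => (2 * (d s * dd s) + 2 * L * (d s * d s)) * exp (2 * L * s))); auto.
    - intros s. assert (Hs := Hd s). auto_derive; [repeat split; now exists (dd s) | ].
      apply is_derive_unique in Hs. change (Derive (fun x => d x) s = dd s) in Hs. rewrite Hs. ring.
    - intros s _. apply Rmult_le_pos. destruct (Hprod s); lra. apply Rlt_le, exp_pos. }
  assert (Hdown : forall a b, a <= b -> d b * d b * exp (- (2 * L * b)) <= d a * d a * exp (- (2 * L * a))).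
  { intros a b Hab. apply Ropp_le_cancel.
    apply (derive_nonneg_le (fun s => - (d s * d s * exp (- (2 * L * s))))
             (fun s => (- 2 * (d s * dd s) + 2 * L * (d s * d s)) * exp (- (2 * L * s)))); auto.
    - intros s. assert (Hs := Hd s). auto_derive; [repeat split; now exists (dd s) | ].
      apply is_derive_unique in Hs. change (Derive (fun x => d x) s = dd s) in Hs. rewrite Hs. ring.
    - intros s _. apply Rmult_le_pos. destruct (Hprod s); lra. apply Rlt_le, exp_pos. }
  assert (Hsq : forall x y, x * x <= y * y * exp (2 * L * Rabs t) -> Rabs x <= exp (L * Rabs t) * Rabs y).
  { intros x y H. apply Rsqr_incr_0_var.
    - rewrite Rsqr_mult, <- !Rsqr_abs. unfold Rsqr.
      rewrite <- exp_plus. replace (L * Rabs t + L * Rabs t) with (2 * L * Rabs t) by ringR. lra.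
    - apply Rmult_le_pos. apply Rlt_le, exp_pos. apply Rabs_pos. }
  assert (Hexp : forall a, exp (- a) * exp a = 1).
  { intros a. rewrite <- exp_plus, Rplus_opp_l. apply exp_0. }
  destruct (Rle_dec 0 t) as [Ht | Ht].
  - rewrite (Rabs_right t) in * by lra.
    assert (H1 := Hup 0 t Ht). assert (H2 := Hdown 0 t Ht).
    rewrite Rmult_0_r, exp_0, Rmult_1_r in H1. rewrite Rmult_0_r, Ropp_0, exp_0, Rmult_1_r in H2.
    split; apply Hsq; auto.
    assert (H3 := exp_pos (2 * L * t)). assert (H4 := Hexp (2 * L * t)).
    apply Rmult_le_compat_r with (r := exp (2 * L * t)) in H2; [ | lra].
    rewrite Rmult_assoc, H4 in H2. lra.
  - assert (Ht' : t <= 0) by lra. rewrite (Rabs_left1 t) in * by lra.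
    assert (H1 := Hup t 0 Ht'). assert (H2 := Hdown t 0 Ht').
    rewrite Rmult_0_r, exp_0, Rmult_1_r in H1. rewrite Rmult_0_r, Ropp_0, exp_0, Rmult_1_r in H2.
    replace (2 * L * - t) with (- (2 * L * t)) in Hsq by ringR.
    split; apply Hsq; auto.
    assert (H3 := exp_pos (- (2 * L * t))). assert (H4 := Hexp (2 * L * t)).
    apply Rmult_le_compat_r with (r := exp (- (2 * L * t))) in H1; [ | lra].
    rewrite Rmult_assoc, (Rmult_comm (exp (2 * L * t))), H4 in H1. lra.
Qed.

(** * The flow and its inverse *)

Lemma periodic1_Z {T} (f : R -> T) (x : R) (k : Z) : periodic1 f -> f (x + IZR k * (2 * PI)) = f x.
Proof.
  intros Hf.
  assert (Hn : forall (n : nat) y, f (y + INR n * (2 * PI)) = f y).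
  { induction n as [ | n IH]; intros y.
    - f_equal; simpl; ring.
    - rewrite S_INR. replace (y + (INR n + 1) * (2 * PI)) with (y + INR n * (2 * PI) + 2 * PI) by ring.
      rewrite Hf. apply IH. }
  destruct (Z.le_gt_cases 0 k) as [Hk | Hk].
  - rewrite <- (Hn (Z.to_nat k) x), INR_IZR_INZ, Z2Nat.id; auto.
  - rewrite <- (Hn (Z.to_nat (- k)) (x + IZR k * (2 * PI))), INR_IZR_INZ, Z2Nat.id by lia.
    rewrite opp_IZR. f_equal; ring.
Qed.

Lemma reduce_mod_2PI (x : R) : exists k : Z, 0 <= x + IZR k * (2 * PI) <= 2 * PI.
Proof.
  assert (HP := PI_RGT_0).
  exists (- Int_part (x / (2 * PI)))%Z. rewrite opp_IZR.
  destruct (base_Int_part (x / (2 * PI))) as [H1 H2].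
  set (q := IZR (Int_part (x / (2 * PI)))) in *.
  assert (Hx : x = x / (2 * PI) * (2 * PI)) by (field; lra).
  split; nra.
Qed.

(** Every point is joined to the corner [(a, c)] by [n] short steps along a segment, and by uniform
    continuity each step changes [f] by less than 1. *)
Lemma cont2_bounded_rectangle (f : R -> R -> R) (a b c d : R) :
  cont2 f -> exists M, forall t x, a <= t <= b -> c <= x <= d -> Rabs (f t x) <= M.
Proof.
  intros Hf.
  destruct (uniform_continuity_2d f a b c d) with (eps := mkposreal 1 Rlt_0_1) as [dl Hd].
  { intros; now apply cont2_continuity_2d_pt. }
  assert (Hdl := cond_pos dl).
  assert (Hn : forall n : nat, forall t x, a <= t <= b -> c <= x <= d ->
     t - a <= INR n * (dl / 2) -> x - c <= INR n * (dl / 2) -> Rabs (f t x) <= Rabs (f a c) + INR n).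
  { induction n as [ | n IH]; intros t x Ht Hx Hta Hxc.
    - simpl in *. replace t with a by lra. replace x with c by lra. lra.
    - assert (H0 := pos_INR n).
      (* Contracting toward the corner by [n / (n + 1)] uses up exactly one of the [n + 1] steps. *)
      rewrite S_INR in *. set (r := INR n / (INR n + 1)).
      assert (Hr : 0 <= r <= 1).
      { unfold r. split. apply Rmult_le_pos; auto. apply Rlt_le, Rinv_0_lt_compat; lra.
        apply Rmult_le_reg_r with (INR n + 1); [lra | ]. field_simplify; lra. }
      assert (Hr' : r * (INR n + 1) = INR n) by (unfold r; field; lra).
      assert (H1 : Rabs (f (a + r * (t - a)) (c + r * (x - c))) <= Rabs (f a c) + INR n).
      { apply IH; nra. }
      assert (H2 : Rabs (f t x - f (a + r * (t - a)) (c + r * (x - c))) < 1).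
      { assert (Hlt : (1 - r) * (INR n + 1) = 1) by lra.
        apply (Hd (a + r * (t - a)) (c + r * (x - c)) t x); try nra.
        - apply Rabs_def1; nra.
        - apply Rabs_def1; nra. }
      assert (H3 := Rabs_triang_inv (f t x) (f (a + r * (t - a)) (c + r * (x - c)))). lra. }
  destruct (INR_unbounded (Rmax (b - a) (d - c) / (dl / 2))) as [N HN].
  exists (Rabs (f a c) + INR N). intros t x Ht Hx.
  assert (HNd : Rmax (b - a) (d - c) <= INR N * (dl / 2)).
  { apply Rlt_le. apply Rmult_lt_reg_r with (/ (dl / 2)). apply Rinv_0_lt_compat; lra.
    rewrite Rmult_assoc, Rinv_r, Rmult_1_r by lra. exact HN. }
  assert (H1 := Rmax_l (b - a) (d - c)). assert (H2 := Rmax_r (b - a) (d - c)).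
  apply Hn; auto; lra.
Qed.

Lemma periodic2_bounded (f : R -> R -> R) :
  cont2 f -> periodic2 f -> exists M, forall t x, Rabs (f t x) <= M.
Proof.
  intros Hf Hp.
  destruct (cont2_bounded_rectangle f 0 (2 * PI) 0 (2 * PI) Hf) as [M HM].
  exists M. intros t x.
  destruct (reduce_mod_2PI t) as [k Hk]. destruct (reduce_mod_2PI x) as [l Hl].
  rewrite <- (periodic1_Z (fun x => f t x) x l) by (intros y; apply Hp).
  rewrite <- (periodic1_Z (fun t => f t (x + IZR l * (2 * PI))) t k) by (intros y; apply Hp).
  now apply HM.
Qed.

Lemma Derive_periodic (f : R -> R) : periodic1 f -> periodic1 (Derive f).
Proof.
  intros H x. transitivity (Derive (fun y => f (y + 2 * PI)) x).
  - symmetry. apply (Derive_n_comp_trans f 1 x (2 * PI)).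
  - now apply Derive_ext.
Qed.

Lemma periodic2_Derive (f : R -> R -> R) : periodic2 f -> periodic2 (fun t x => Derive (f t) x).
Proof.
  intros H t x. split.
  - apply Derive_ext. intros y. apply H.
  - apply (Derive_periodic (f t)). intros y. apply H.
Qed.

Lemma Lipschitz_of_Derive (f df : R -> R) (L : R) :
  (forall x, is_derive f x (df x)) -> (forall x, Rabs (df x) <= L) ->
  forall x y, Rabs (f x - f y) <= L * Rabs (x - y).
Proof.
  intros Hd HL x y.
  destruct (MVT_gen f y x df) as (c & _ & Hc); auto.
  - intros z _. apply continuity_pt_filterlim. now apply (is_derive_continuous f z (df z)).
  - rewrite Hc, Rabs_mult. apply Rmult_le_compat_r; auto. apply Rabs_pos.
Qed.

Lemma ode_gap (b : R -> R -> R) :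
  Cinf b -> periodic2 b ->
  exists L, 0 < L /\ forall y z : R -> R,
    (forall t, is_derive y t (b t (y t))) -> (forall t, is_derive z t (b t (z t))) ->
    forall t, Rabs (y 0 - z 0) <= exp (L * Rabs t) * Rabs (y t - z t) /\
              Rabs (y t - z t) <= exp (L * Rabs t) * Rabs (y 0 - z 0).
Proof.
  intros Hb Hp.
  destruct (periodic2_bounded (fun t x => Derive (b t) x)) as [L HL].
  { apply Cinf_cont. now apply Cinf_Derive. }
  { now apply periodic2_Derive. }
  assert (HL0 : 0 <= L) by (eapply Rle_trans; [apply Rabs_pos | apply (HL 0 0)]).
  exists (L + 1). split; [lra | ]. intros y z Hy Hz t.
  apply (gronwall_two_sided (fun s => y s - z s) (fun s => b s (y s) - b s (z s))); [lra | | ].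
  - intros s. now apply is_derive_Rminus.
  - intros s. eapply Rle_trans.
    + apply (Lipschitz_of_Derive (b s) (Derive (b s)) L); auto.
      intros x. now apply Cinf_derive.
    + apply Rmult_le_compat_r. apply Rabs_pos. lra.
Qed.

Definition is_flow (b psi : R -> R -> R) : Prop :=
  (forall y, psi 0 y = y) /\ (forall t y, is_derive (fun s => psi s y) t (b t (psi t y))).

Lemma flow_exists (b : R -> R -> R) : Cinf b -> periodic2 b -> exists psi, is_flow b psi.
Proof.
  intros Hb Hp.
  destruct (periodic2_bounded b) as [M HM]; auto using Cinf_cont.
  destruct (periodic2_bounded (fun t x => Derive (b t) x)) as [L HL].
  { apply Cinf_cont. now apply Cinf_Derive. }
  { now apply periodic2_Derive. }
  assert (HL0 : 0 <= L) by (eapply Rle_trans; [apply Rabs_pos | apply (HL 0 0)]).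
  assert (H : forall y0, exists y : R -> R, y 0 = y0 /\ forall t, is_derive y t (b t (y t))).
  { intros y0. apply (picard_lindelof b M (L + 1)); auto using Cinf_cont. lra.
    intros t x y. eapply Rle_trans.
    - apply (Lipschitz_of_Derive (b t) (Derive (b t)) L); auto. intros; now apply Cinf_derive.
    - apply Rmult_le_compat_r. apply Rabs_pos. lra. }
  exists (fun t y0 => proj1_sig (constructive_indefinite_description _ (H y0)) t).
  split.
  - intros y. exact (proj1 (proj2_sig (constructive_indefinite_description _ (H y)))).
  - intros t y. exact (proj2 (proj2_sig (constructive_indefinite_description _ (H y))) t).
Qed.

(** The first inequality gives injectivity and the continuity of the inverse flow, the second the
    continuity of the flow. *)
Lemma flow_gap (b psi : R -> R -> R) :
  Cinf b -> periodic2 b -> is_flow b psi ->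
  exists L, 0 < L /\ forall t y z,
    Rabs (y - z) <= exp (L * Rabs t) * Rabs (psi t y - psi t z) /\
    Rabs (psi t y - psi t z) <= exp (L * Rabs t) * Rabs (y - z).
Proof.
  intros Hb Hp [H0 Hd]. destruct (ode_gap b Hb Hp) as (L & HL & H).
  exists L. split; auto. intros t y z.
  specialize (H (fun s => psi s y) (fun s => psi s z) (fun t => Hd t y) (fun t => Hd t z) t).
  cbv beta in H. now rewrite !H0 in H.
Qed.

Lemma flow_inj (b psi : R -> R -> R) (t y z : R) :
  Cinf b -> periodic2 b -> is_flow b psi -> psi t y = psi t z -> y = z.
Proof.
  intros Hb Hp Hf E. destruct (flow_gap b psi Hb Hp Hf) as (L & _ & H).
  destruct (H t y z) as [H1 _]. rewrite E, Rminus_diag, Rabs_R0, Rmult_0_r in H1.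
  apply Rminus_diag_uniq. destruct (Req_dec (y - z) 0) as [ | Hn]; auto.
  apply Rabs_pos_lt in Hn. lra.
Qed.

(** By periodicity of [b], a translated orbit is again an orbit, and orbits that agree at time 0
    coincide. *)
Lemma flow_shift (b psi : R -> R -> R) (t y : R) :
  Cinf b -> periodic2 b -> is_flow b psi -> psi t (y + 2 * PI) = psi t y + 2 * PI.
Proof.
  intros Hb Hp [H0 Hd]. destruct (ode_gap b Hb Hp) as (L & _ & H).
  destruct (H (fun s => psi s (y + 2 * PI)) (fun s => psi s y + 2 * PI)) with (t := t) as [_ H1].
  - intros s; apply Hd.
  - intros s. destruct (Hp s (psi s y)) as [_ ->].
    eapply is_derive_value.
    + apply is_derive_Rplus.
      * apply Hd.
      * apply is_derive_Rconst.
    + apply Rplus_0_r.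
  - cbv beta in H1. rewrite !H0, Rminus_diag, Rabs_R0, Rmult_0_r in H1.
    apply Rminus_diag_uniq. destruct (Req_dec (psi t (y + 2 * PI) - (psi t y + 2 * PI)) 0) as [ | Hn]; auto.
    apply Rabs_pos_lt in Hn. lra.
Qed.

Lemma flow_t_Lipschitz (b psi : R -> R -> R) :
  Cinf b -> periodic2 b -> is_flow b psi ->
  exists M, forall s t y, Rabs (psi t y - psi s y) <= M * Rabs (t - s).
Proof.
  intros Hb Hp [H0 Hd].
  destruct (periodic2_bounded b) as [M HM]; auto using Cinf_cont.
  exists M. intros s t y.
  apply (Lipschitz_of_Derive (fun s => psi s y) (fun s => b s (psi s y))); auto.
Qed.

Lemma continuous_of_modulus (f : R * R -> R) (p : R * R) (g : R * R -> R) :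
  continuous g p -> g p = 0 -> (forall q, Rabs (f q - f p) <= g q) -> continuous f p.
Proof.
  intros Hg H0 H. apply filterlim_locally; intros eps.
  assert (He := proj1 (filterlim_locally _ _) Hg eps). rewrite H0 in He.
  revert He. apply filter_imp. intros q Hq. change (Rabs (f q - f p) < eps).
  eapply Rle_lt_trans; [apply H | ]. change (Rabs (g q - 0) < eps) in Hq.
  rewrite Rminus_0_r in Hq. eapply Rle_lt_trans; [apply Rle_abs | exact Hq].
Qed.

Lemma flow_cont2 (b psi : R -> R -> R) :
  Cinf b -> periodic2 b -> is_flow b psi -> cont2 psi.
Proof.
  intros Hb Hp Hf t y.
  destruct (flow_gap b psi Hb Hp Hf) as (L & HL & HG).
  destruct (flow_t_Lipschitz b psi Hb Hp Hf) as (M & HM).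
  apply (continuous_of_modulus (fun p => psi (fst p) (snd p)) (t, y)
    (fun p => exp (L * Rabs (fst p)) * Rabs (snd p - y) + M * Rabs (fst p - t))).
  - assert (H1 : continuous (fun p : R * R => fst p) (t, y)) by apply cont2_proj1.
    assert (H2 : continuous (fun p : R * R => snd p) (t, y)) by apply cont2_proj2.
    apply continuous_Rplus; apply continuous_Rmult.
    + apply (continuous_comp (fun p : R * R => L * Rabs (fst p)) exp).
      * apply continuous_Rmult. apply continuous_const.
        apply (continuous_comp (fun p : R * R => fst p) Rabs); auto using continuous_Rabs.
      * apply (ex_derive_continuous exp). auto_derive; auto.
    + apply (continuous_comp (fun p : R * R => snd p - y) Rabs); auto using continuous_Rabs.
      apply continuous_Rminus; auto. apply continuous_const.
    + apply continuous_const.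
    + apply (continuous_comp (fun p : R * R => fst p - t) Rabs); auto using continuous_Rabs.
      apply continuous_Rminus; auto. apply continuous_const.
  - simpl. rewrite !Rminus_diag, Rabs_R0. ring.
  - intros [s z]; simpl.
    replace (psi s z - psi t y) with ((psi s z - psi s y) + (psi s y - psi t y)) by ring.
    eapply Rle_trans; [apply Rabs_triang | ]. apply Rplus_le_compat; auto. apply HG.
Qed.

(** The logarithm of [psi_y], read off from the linearised equation. Keeping the logarithm makes
    positivity automatic and the square root a division by 2. *)
Definition log_jac (b psi : R -> R -> R) (t y : R) : R :=
  RInt (fun s => Derive (b s) (psi s y)) 0 t.

Lemma continuous_Rdiv (U : UniformSpace) (f g : U -> R) (u : U) :
  continuous f u -> continuous g u -> g u <> 0 -> continuous (fun v => f v / g v) u.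
Proof.
  intros Hf Hg H. apply continuous_Rmult; auto.
  apply (continuous_comp g Rinv); auto. apply continuous_Rinv; auto.
Qed.

(* The gap [d] between two orbits solves [d' = Q d], where [Q] is a difference quotient of [b]. *)
Lemma flow_is_derive (b psi : R -> R -> R) (t y : R) :
  Cinf b -> periodic2 b -> is_flow b psi -> is_derive (psi t) y (exp (log_jac b psi t y)).
Proof.
  intros Hb Hp Hf.
  destruct (flow_gap b psi Hb Hp Hf) as (L & HL & HG).
  assert (Hb' := Cinf_Derive _ Hb). assert (Hp' := periodic2_Derive _ Hp).
  assert (Hb'' := Cinf_Derive _ Hb'). assert (Hp'' := periodic2_Derive _ Hp').
  assert (Hpsi := flow_cont2 b psi Hb Hp Hf).
  destruct (periodic2_bounded _ (Cinf_cont _ Hb'') Hp'') as [M HM]. cbv beta in HM.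
  assert (HM0 : 0 <= M) by (eapply Rle_trans; [apply Rabs_pos | apply (HM 0 0)]).
  destruct Hf as [H0 Hd].
  assert (Hcb : forall s, continuous (fun s => Derive (b s) (psi s y)) s).
  { intros s. apply (cont2_continuous_comp _ (fun s x => Derive (b s) x) (fun s => s)).
    now apply Cinf_cont. apply continuous_id. now apply cont2_t. }
  (* The gap is exactly [(z - y) * exp q], with [q] the time integral of the difference quotient;
     the derivative of the flow then only needs continuity of [exp] at [log_jac]. *)
  assert (Hq : forall z, z <> y -> exists q,
    psi t z - psi t y = (z - y) * exp q /\
    Rabs (q - log_jac b psi t y) <= Rabs t * (M * (exp (L * Rabs t) * Rabs (z - y)))).
  { intros z Hz.
    assert (Hne : forall s, psi s z - psi s y <> 0).
    { intros s E. destruct (HG s z y) as [H _]. rewrite E, Rabs_R0, Rmult_0_r in H.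
      assert (H1 := Rabs_pos_lt (z - y)). lra. }
    set (Q := fun s => (b s (psi s z) - b s (psi s y)) / (psi s z - psi s y)).
    assert (HQc : forall s, continuous Q s).
    { intros s. apply continuous_Rdiv; auto.
      - apply continuous_Rminus; apply (cont2_continuous_comp _ b (fun s => s));
          auto using continuous_id, Cinf_cont, cont2_t.
      - apply continuous_Rminus; now apply cont2_t. }
    exists (RInt Q 0 t). split.
    (* The gap divided by its expected exponential is constant in time. *)
    - set (E := fun s => (psi s z - psi s y) * exp (- RInt Q 0 s)).
      assert (HE : forall s, is_derive E s 0).
      { intros s. unfold E.
        eapply is_derive_value.
        - apply (is_derive_mult (fun s => psi s z - psi s y) (fun s => exp (- RInt Q 0 s))).
          + apply is_derive_Rminus; apply Hd.
          + apply (is_derive_comp exp (fun s => - RInt Q 0 s)). apply is_derive_exp.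
            apply is_derive_Ropp.
            now apply is_derive_RInt_cont.
          + intros; apply Rmult_comm.
        - unfold plus, mult, minus, plus, opp, scal; simpl. unfold mult; simpl.
          unfold Q at 2. field. apply Hne. }
      assert (HEt : E t = E 0).
      { destruct (Rtotal_order 0 t) as [H | [H | H]].
        - symmetry. apply (eq_is_derive E); auto.
        - now rewrite H.
        - apply (eq_is_derive E); auto. }
      unfold E in HEt. rewrite RInt_same in HEt.
      rewrite Ropp_0, exp_0, Rmult_1_r, !H0 in HEt. rewrite <- HEt, Rmult_assoc, <- exp_plus.
      rewrite Rplus_opp_l, exp_0. ring.
    - unfold log_jac. rewrite <- RInt_Rminus by (apply ex_RInt_cont; auto).
      replace (Rabs t) with (Rabs (t - 0)) at 1 by (f_equal; ring).
      apply abs_RInt_le_const_abs.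
      { apply ex_RInt_cont. intros s. apply continuous_Rminus; auto. }
      intros s Hs.
      (* The quotient is [b_x] at a point between the two orbits, so it differs from [b_x] on the
         orbit of [y] by at most [M] times the gap. *)
      destruct (MVT_gen (b s) (psi s y) (psi s z) (Derive (b s))) as (c & Hc1 & Hc2).
      { intros; now apply Cinf_derive. }
      { intros x _. apply continuity_pt_filterlim.
        apply (is_derive_continuous (b s) x (Derive (b s) x)). now apply Cinf_derive. }
      replace (Q s) with (Derive (b s) c).
      2:{ unfold Q. rewrite Hc2. field. apply Hne. }
      eapply Rle_trans.
      { apply (Lipschitz_of_Derive (Derive (b s)) (fun x => Derive (fun y => Derive (b s) y) x) M); auto.
        intros x. apply (Cinf_derive (fun s x => Derive (b s) x)); auto. }
      apply Rmult_le_compat_l; auto.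
      apply Rle_trans with (Rabs (psi s z - psi s y)).
      { revert Hc1. unfold Rmin, Rmax, Rabs.
        destruct (Rle_dec (psi s y) (psi s z)); destruct (Rcase_abs (c - psi s y));
          destruct (Rcase_abs (psi s z - psi s y)); lra. }
      eapply Rle_trans; [apply HG | ].
      apply Rmult_le_compat_r. apply Rabs_pos.
      apply exp_le_compat. apply Rmult_le_compat_l; [lra | ].
      revert Hs. unfold Rmin, Rmax, Rabs.
      destruct (Rle_dec 0 t); destruct (Rcase_abs s); destruct (Rcase_abs t); lra. }
  apply is_derive_Reals. intros eps Heps.
  set (J := log_jac b psi t y).
  assert (Hexp : continuous exp J).
  { apply (ex_derive_continuous exp). auto_derive; auto. }
  destruct (proj1 (filterlim_locally _ _) Hexp (mkposreal eps Heps)) as [dl Hdl].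
  set (C := Rabs t * (M * exp (L * Rabs t))).
  assert (HC : 0 <= C).
  { apply Rmult_le_pos. apply Rabs_pos. apply Rmult_le_pos; auto. apply Rlt_le, exp_pos. }
  exists (mkposreal (dl / (C + 1)) (Rdiv_lt_0_compat _ _ (cond_pos dl) (Rle_lt_0_plus_1 _ HC))).
  intros h Hh Hhd. simpl in Hhd.
  destruct (Hq (y + h)) as (q & Hq1 & Hq2).
  { intros E. apply Hh. lra. }
  replace (y + h - y) with h in Hq1, Hq2 by ring.
  rewrite Hq1. replace (h * exp q / h) with (exp q) by (field; auto).
  apply (Hdl q). change (Rabs (q - J) < dl).
  apply Rle_lt_trans with (C * Rabs h). { unfold C, J in *. lra. }
  assert (H1 : Rabs h * (C + 1) < dl).
  { apply Rmult_lt_reg_r with (/ (C + 1)). apply Rinv_0_lt_compat; lra.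
    rewrite Rmult_assoc, Rinv_r, Rmult_1_r by lra. exact Hhd. }
  assert (H2 := Rabs_pos_lt h Hh). lra.
Qed.

Lemma log_jac_Cx (b psi : R -> R -> R) (n : nat) : Cinf b -> Cx n psi -> Cx n (log_jac b psi).
Proof.
  intros Hb Hpsi. apply (Cx_primitive n (fun s y => Derive (b s) (psi s y))).
  apply (Cx_comp n (fun s x => Derive (b s) x)); auto. now apply Cinf_Derive.
Qed.

(** Bootstrap: [psi_y] is the exponential of a time integral of [b_x] composed with [psi], so it is
    as regular as [psi] itself, and each pass gains one derivative. *)
Lemma flow_Cinf (b psi : R -> R -> R) :
  Cinf b -> periodic2 b -> is_flow b psi -> Cinf psi.
Proof.
  intros Hb Hp Hf n. assert (Hc := flow_cont2 b psi Hb Hp Hf).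
  induction n as [ | n IH]; auto. split; auto.
  exists (fun t y => exp (log_jac b psi t y)). split.
  - intros; now apply flow_is_derive.
  - apply Cx_exp. now apply log_jac_Cx.
Qed.

Lemma log_jac_Cinf (b psi : R -> R -> R) :
  Cinf b -> periodic2 b -> is_flow b psi -> Cinf (log_jac b psi).
Proof. intros Hb Hp Hf n. apply log_jac_Cx; auto. now apply (flow_Cinf b psi). Qed.

Lemma log_jac_0 (b psi : R -> R -> R) (y : R) : log_jac b psi 0 y = 0.
Proof. apply RInt_same. Qed.

Lemma log_jac_periodic (b psi : R -> R -> R) (t y : R) :
  Cinf b -> periodic2 b -> is_flow b psi -> log_jac b psi t (y + 2 * PI) = log_jac b psi t y.
Proof.
  intros Hb Hp Hf. apply RInt_eq. intros s.
  rewrite (flow_shift b psi s y) by auto. now apply periodic2_Derive.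
Qed.

Lemma log_jac_is_derive_t (b psi : R -> R -> R) (t y : R) :
  Cinf b -> periodic2 b -> is_flow b psi ->
  is_derive (fun s => log_jac b psi s y) t (Derive (b t) (psi t y)).
Proof.
  intros Hb Hp Hf. apply (is_derive_RInt_cont (fun s => Derive (b s) (psi s y))).
  intros s. apply (cont2_continuous_comp _ (fun s x => Derive (b s) x) (fun s => s)).
  apply Cinf_cont. now apply Cinf_Derive. apply continuous_id.
  apply cont2_t. now apply (flow_cont2 b).
Qed.

(** The differentiation half of the implicit function theorem: the branch [y] is given and known to
    be continuous, so only its derivative has to be found. *)
Lemma implicit_is_derive (H : R -> R -> R) (y : R -> R) (s l1 l2 : R) :
  differentiable_pt_lim H s (y s) l1 l2 -> l2 <> 0 -> continuous y s ->
  (forall r, H r (y r) = H s (y s)) -> is_derive y s (- l1 / l2).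
Proof.
  intros HH Hl2 Hy HE. apply is_derive_Reals. intros eps Heps.
  assert (Ha := Rabs_pos_lt l2 Hl2).
  (* [C] will bound the slope of the branch: [|Y| <= C * |h|]. *)
  set (C := 2 * (Rabs l1 + Rabs l2) / Rabs l2).
  assert (HC : 0 <= C).
  { assert (H1 := Rabs_pos l1). apply Rmult_le_pos; [lra | ]. apply Rlt_le, Rinv_0_lt_compat; lra. }
  (* The first entry lets the part of the error proportional to [|Y|] be absorbed by [|l2| * |Y|];
     the second makes the remaining error at most [eps / 2] after division by [l2 * h]. *)
  set (eta := Rmin (Rabs l2 / 2) (eps * Rabs l2 / (2 * (1 + C)))).
  assert (Heta : 0 < eta).
  { apply Rmin_glb_lt. lra. apply Rdiv_lt_0_compat; nra. }
  assert (He1 : eta <= Rabs l2 / 2) by apply Rmin_l.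
  assert (He2 : eta * (1 + C) <= eps * Rabs l2 / 2).
  { assert (H1 : eta <= eps * Rabs l2 / (2 * (1 + C))) by apply Rmin_r.
    apply Rmult_le_compat_r with (r := 1 + C) in H1; [ | lra].
    replace (eps * Rabs l2 / (2 * (1 + C)) * (1 + C)) with (eps * Rabs l2 / 2) in H1 by (field; lra).
    exact H1. }
  destruct (HH (mkposreal eta Heta)) as [d1 Hd1].
  destruct (proj1 (filterlim_locally _ _) Hy d1) as [d2 Hd2].
  assert (Hd : 0 < Rmin d1 d2) by (apply Rmin_glb_lt; apply cond_pos).
  exists (mkposreal _ Hd). intros h Hh Hhd. simpl in Hhd.
  assert (Hh1 : Rabs h < d1) by (eapply Rlt_le_trans; [exact Hhd | apply Rmin_l]).
  assert (Hh2 : Rabs h < d2) by (eapply Rlt_le_trans; [exact Hhd | apply Rmin_r]).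
  specialize (Hd1 (s + h) (y (s + h))).
  assert (Hsh : s + h - s = h) by ring.
  rewrite Hsh in Hd1. specialize (Hd1 Hh1).
  assert (HY : Rabs (y (s + h) - y s) < d1).
  { apply (Hd2 (s + h)). change (Rabs (s + h - s) < d2). now rewrite Hsh. }
  specialize (Hd1 HY). rewrite HE in Hd1. simpl in Hd1.
  set (Y := y (s + h) - y s) in *.
  replace (H s (y s) - H s (y s) - (l1 * h + l2 * Y)) with (- (l1 * h + l2 * Y)) in Hd1 by ring.
  rewrite Rabs_Ropp in Hd1.
  assert (Hhp := Rabs_pos_lt h Hh). assert (HYp := Rabs_pos Y).
  assert (Hm : Rabs (l1 * h + l2 * Y) <= eta * (Rabs h + Rabs Y)).
  { eapply Rle_trans; [exact Hd1 | ]. apply Rmult_le_compat_l; [lra | ].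
    apply Rmax_lub; lra. }
  assert (HYC : Rabs Y <= C * Rabs h).
  { assert (H1 : Rabs (l2 * Y) <= Rabs (l1 * h + l2 * Y) + Rabs (l1 * h)).
    { replace (l2 * Y) with ((l1 * h + l2 * Y) - l1 * h) at 1 by ring.
      eapply Rle_trans; [apply Rabs_triang | ]. rewrite Rabs_Ropp. lra. }
    rewrite !Rabs_mult in H1.
    apply Rmult_le_reg_l with (Rabs l2); auto.
    replace (Rabs l2 * (C * Rabs h)) with (2 * (Rabs l1 + Rabs l2) * Rabs h) by (unfold C; field; lra).
    nra. }
  assert (Hfin : Rabs (l1 * h + l2 * Y) <= eps / 2 * (Rabs l2 * Rabs h)).
  { eapply Rle_trans; [exact Hm | ]. apply Rle_trans with (eta * (1 + C) * Rabs h); nra. }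
  replace (Y / h - - l1 / l2) with ((l1 * h + l2 * Y) / (l2 * h)) by (field; auto).
  rewrite Rabs_div, Rabs_mult by (apply Rmult_integral_contrapositive; auto).
  apply Rmult_lt_reg_r with (Rabs l2 * Rabs h). nra.
  unfold Rdiv. rewrite Rmult_assoc, Rinv_l, Rmult_1_r by nra. nra.
Qed.

Definition is_inverse_flow (psi phi : R -> R -> R) : Prop := forall t x, psi t (phi t x) = x.

Lemma inverse_flow_exists (b psi : R -> R -> R) :
  Cinf b -> periodic2 b -> is_flow b psi -> exists phi, is_inverse_flow psi phi.
Proof.
  intros Hb Hp Hf.
  destruct (flow_t_Lipschitz b psi Hb Hp Hf) as (M & HM).
  assert (H : forall t x, exists y, psi t y = x).
  { intros t x. set (r := M * Rabs t).
    assert (Hr : forall y, y - r <= psi t y <= y + r).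
    { intros y. assert (H := HM 0 t y). rewrite (proj1 Hf), Rminus_0_r in H. fold r in H.
      apply Rabs_le_between in H. lra. }
    destruct (IVT_gen (psi t) (x - r) (x + r) x) as (y & _ & Hy).
    - intros y. apply continuity_pt_filterlim.
      apply (cont2_x psi t y). now apply (flow_cont2 b).
    - assert (H1 := Hr (x - r)). assert (H2 := Hr (x + r)).
      unfold Rmin, Rmax. destruct (Rle_dec (psi t (x - r)) (psi t (x + r))); lra.
    - now exists y. }
  exists (fun t x => proj1_sig (constructive_indefinite_description _ (H t x))).
  intros t x. exact (proj2_sig (constructive_indefinite_description _ (H t x))).
Qed.

Lemma inverse_flow_left (b psi phi : R -> R -> R) (t y : R) :
  Cinf b -> periodic2 b -> is_flow b psi -> is_inverse_flow psi phi -> phi t (psi t y) = y.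
Proof. intros Hb Hp Hf Hi. now apply (flow_inj b psi t). Qed.

Lemma inverse_flow_0 (b psi phi : R -> R -> R) (x : R) :
  is_flow b psi -> is_inverse_flow psi phi -> phi 0 x = x.
Proof. intros [H0 _] Hi. rewrite <- (H0 (phi 0 x)). apply Hi. Qed.

Lemma inverse_flow_shift (b psi phi : R -> R -> R) (t x : R) :
  Cinf b -> periodic2 b -> is_flow b psi -> is_inverse_flow psi phi ->
  phi t (x + 2 * PI) = phi t x + 2 * PI.
Proof.
  intros Hb Hp Hf Hi. apply (flow_inj b psi t); auto.
  rewrite (flow_shift b psi) by auto. now rewrite !Hi.
Qed.

(** The lower bound of [flow_gap] at [phi s z] and [phi t x] gives a modulus that involves only the
    continuous map [psi] at the fixed point [phi t x] and vanishes at [(t, x)]. *)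
Lemma inverse_flow_cont2 (b psi phi : R -> R -> R) :
  Cinf b -> periodic2 b -> is_flow b psi -> is_inverse_flow psi phi -> cont2 phi.
Proof.
  intros Hb Hp Hf Hi t x.
  destruct (flow_gap b psi Hb Hp Hf) as (L & HL & HG).
  assert (Hpsi := flow_cont2 b psi Hb Hp Hf).
  apply (continuous_of_modulus (fun p => phi (fst p) (snd p)) (t, x)
    (fun p => exp (L * Rabs (fst p)) * Rabs (snd p - psi (fst p) (phi t x)))).
  - assert (H1 : continuous (fun p : R * R => fst p) (t, x)) by apply cont2_proj1.
    assert (H2 : continuous (fun p : R * R => snd p) (t, x)) by apply cont2_proj2.
    apply continuous_Rmult.
    + apply (continuous_comp (fun p : R * R => L * Rabs (fst p)) exp).
      * apply continuous_Rmult. apply continuous_const.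
        apply (continuous_comp (fun p : R * R => fst p) Rabs); auto using continuous_Rabs.
      * apply (ex_derive_continuous exp). auto_derive; auto.
    + apply (continuous_comp (fun p : R * R => snd p - psi (fst p) (phi t x)) Rabs); auto using continuous_Rabs.
      apply continuous_Rminus; auto.
      apply (cont2_continuous_comp _ psi (fun p : R * R => fst p)); auto. apply continuous_const.
  - simpl. rewrite Hi, Rminus_diag, Rabs_R0. ring.
  - intros [s z]; simpl. destruct (HG s (phi s z) (phi t x)) as [H _]. now rewrite Hi in H.
Qed.

Lemma flow_differentiable (b psi : R -> R -> R) (t y : R) :
  Cinf b -> periodic2 b -> is_flow b psi ->
  differentiable_pt_lim psi t y (b t (psi t y)) (exp (log_jac b psi t y)).
Proof.
  intros Hb Hp Hf. apply filterdiff_differentiable_pt_lim.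
  apply (is_derive_filterdiff psi t y (fun t y => b t (psi t y))).
  - apply filter_forall. intros [s z]. apply Hf.
  - now apply flow_is_derive.
  - apply (cont2_comp b (fun t _ => t) psi); auto using Cinf_cont, cont2_proj1.
    now apply (flow_cont2 b).
Qed.

Lemma inverse_flow_is_derive_x (b psi phi : R -> R -> R) (t x : R) :
  Cinf b -> periodic2 b -> is_flow b psi -> is_inverse_flow psi phi ->
  is_derive (phi t) x (exp (- log_jac b psi t (phi t x))).
Proof.
  intros Hb Hp Hf Hi.
  assert (Hc := inverse_flow_cont2 b psi phi Hb Hp Hf Hi).
  eapply is_derive_value.
  - apply (implicit_is_derive (fun r y => psi t y - r) (phi t) x (-1) (exp (log_jac b psi t (phi t x)))).
    + apply filterdiff_differentiable_pt_lim.
      apply (is_derive_filterdiff (fun r y => psi t y - r) x (phi t x) (fun _ _ => -1)).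
      * apply filter_forall. intros [r y]. simpl. eapply is_derive_value.
        { apply is_derive_Rminus.
          apply is_derive_Rconst.
          apply is_derive_Rid. }
        unfold minus, plus, opp, zero, one; simpl. ring.
      * eapply is_derive_value.
        { apply is_derive_Rminus.
          now apply (flow_is_derive b). apply is_derive_Rconst. }
        unfold minus, plus, opp, zero; simpl. ring.
      * apply continuous_const.
    + apply Rgt_not_eq, exp_pos.
    + now apply cont2_x.
    + intros r. rewrite !Hi. ring.
  - rewrite exp_Ropp. field. apply Rgt_not_eq, exp_pos.
Qed.

Lemma inverse_flow_is_derive_t (b psi phi : R -> R -> R) (t x : R) :
  Cinf b -> periodic2 b -> is_flow b psi -> is_inverse_flow psi phi ->
  is_derive (fun s => phi s x) t (- b t x * exp (- log_jac b psi t (phi t x))).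
Proof.
  intros Hb Hp Hf Hi.
  assert (Hc := inverse_flow_cont2 b psi phi Hb Hp Hf Hi).
  eapply is_derive_value.
  - apply (implicit_is_derive psi (fun s => phi s x) t (b t (psi t (phi t x))) (exp (log_jac b psi t (phi t x)))).
    + now apply flow_differentiable.
    + apply Rgt_not_eq, exp_pos.
    + now apply cont2_t.
    + intros r. now rewrite !Hi.
  - rewrite Hi, exp_Ropp. field. apply Rgt_not_eq, exp_pos.
Qed.

Lemma inverse_flow_Cinf (b psi phi : R -> R -> R) :
  Cinf b -> periodic2 b -> is_flow b psi -> is_inverse_flow psi phi -> Cinf phi.
Proof.
  intros Hb Hp Hf Hi n. assert (Hc := inverse_flow_cont2 b psi phi Hb Hp Hf Hi).
  induction n as [ | n IH]; auto. split; auto.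
  exists (fun t x => exp (- log_jac b psi t (phi t x))). split.
  - intros; now apply inverse_flow_is_derive_x.
  - apply Cx_exp, Cx_opp. apply (Cx_comp n (log_jac b psi)); auto. now apply log_jac_Cinf.
Qed.

(** * Transport along the flow *)

Lemma RInt_period (F : R -> R) (c : R) :
  (forall x, continuous F x) -> periodic1 F -> RInt F c (c + 2 * PI) = RInt F 0 (2 * PI).
Proof.
  intros Hc Hp.
  assert (Hd : forall x, is_derive (fun c => RInt F 0 (c + 2 * PI) - RInt F 0 c) x 0).
  { intros x. eapply is_derive_value.
    - apply is_derive_Rminus.
      + apply (is_derive_comp (fun y => RInt F 0 y) (fun c => c + 2 * PI)).
        now apply is_derive_RInt_cont.
        apply is_derive_Rplus.
        apply is_derive_Rid.
        apply is_derive_Rconst.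
      + now apply is_derive_RInt_cont.
    - rewrite Hp. unfold minus, plus, opp, scal, one, zero; simpl. unfold mult; simpl. ring. }
  assert (H : RInt F 0 (c + 2 * PI) - RInt F 0 c = RInt F 0 (0 + 2 * PI) - RInt F 0 0).
  { destruct (Rtotal_order 0 c) as [H | [H | H]].
    - symmetry. apply (eq_is_derive (fun c => RInt F 0 (c + 2 * PI) - RInt F 0 c)); auto.
    - now rewrite <- H.
    - apply (eq_is_derive (fun c => RInt F 0 (c + 2 * PI) - RInt F 0 c)); auto. }
  rewrite RInt_same, Rplus_0_l, Rminus_0_r in H. rewrite <- H.
  rewrite <- (RInt_RChasles F 0 c (c + 2 * PI)) by auto. symmetry. apply Rplus_minus_l.
Qed.

(** Encoded as a time-independent function so that the calculus of [Cx] also serves functions of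
    space alone. *)
Definition smooth1 (g : R -> R) : Prop := Cinf (fun _ x => g x).

Lemma smooth1_continuous (g : R -> R) (x : R) : smooth1 g -> continuous g x.
Proof. intros H. apply (cont2_x (fun _ => g) 0 x). now apply Cinf_cont. Qed.

Lemma smooth1_derive (g : R -> R) (x : R) : smooth1 g -> is_derive g x (Derive g x).
Proof. intros H. now apply (Cinf_derive (fun _ => g) 0 x). Qed.

Lemma smooth1_Derive (g : R -> R) : smooth1 g -> smooth1 (Derive g).
Proof. intros H. now apply (Cinf_Derive (fun _ => g)). Qed.

Lemma smooth1_slice (f : R -> R -> R) (t : R) : Cinf f -> smooth1 (f t).
Proof. intros H n. now apply Cx_freeze. Qed.

Definition test_function (g : R -> R) : Prop := periodic1 g /\ smooth1 g.

Lemma test_fun_iff (g : R -> R) : test_fun g <-> test_function g.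
Proof.
  split; intros [Hp H]; split; auto.
  - assert (Hk : forall n k, Cx n (fun _ x => Derive_n g k x)).
    { assert (Hc : forall k, cont2 (fun _ x => Derive_n g k x)).
      { intros k. apply (cont2_1x (Derive_n g k)). intros x.
        now apply (ex_derive_continuous (Derive_n g k)). }
      induction n as [ | n IH]; intros k; [apply Hc | split]; auto.
      exists (fun _ x => Derive_n g (S k) x). split; auto.
      intros _ x. simpl. now apply Derive_correct. }
    intros n. apply (Hk n O).
  - intros n x. eexists. apply (Cinf_derive (fun t x => Derive_n ((fun _ => g) t) n x) 0 x).
    now apply Cinf_Derive_n.
Qed.

Definition flow_setup (b psi phi : R -> R -> R) : Prop :=
  Cinf b /\ periodic2 b /\ is_flow b psi /\ is_inverse_flow psi phi.

(* The solution of [w_t + b w_x + b_x w / 2 = 0] with initial datum [G]. *)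
Definition transport (b psi phi : R -> R -> R) (G : R -> R) (t x : R) : R :=
  G (phi t x) * exp (- log_jac b psi t (phi t x) / 2).

Lemma Cinf_half_exp (c : R) (J : R -> R -> R) : Cinf J -> Cinf (fun t y => exp (c * J t y / 2)).
Proof.
  intros HJ n. apply Cx_exp. apply (Cx_ext n (fun t y => c / 2 * J t y)).
  - intros; field.
  - apply Cx_mult; auto using Cx_const.
Qed.

Lemma transport_Cinf (b psi phi : R -> R -> R) (G : R -> R) :
  flow_setup b psi phi -> smooth1 G -> Cinf (transport b psi phi G).
Proof.
  intros (Hb & Hp & Hf & Hi) HG n.
  assert (Hphi := inverse_flow_Cinf b psi phi Hb Hp Hf Hi n).
  apply Cx_mult.
  - apply (Cx_comp n (fun _ => G)); auto.
  - apply (Cx_comp n (fun t y => exp (- log_jac b psi t y / 2))); auto.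
    apply (Cx_ext n (fun t y => exp (-1 * log_jac b psi t y / 2))).
    + intros. f_equal. field.
    + apply Cinf_half_exp. now apply log_jac_Cinf.
Qed.

Lemma transport_periodic (b psi phi : R -> R -> R) (G : R -> R) (t : R) :
  flow_setup b psi phi -> periodic1 G -> periodic1 (transport b psi phi G t).
Proof.
  intros (Hb & Hp & Hf & Hi) HG x. unfold transport.
  rewrite (inverse_flow_shift b psi phi) by auto. rewrite HG.
  now rewrite (log_jac_periodic b psi) by auto.
Qed.

Lemma transport_0 (b psi phi : R -> R -> R) (G : R -> R) (x : R) :
  flow_setup b psi phi -> transport b psi phi G 0 x = G x.
Proof.
  intros (Hb & Hp & Hf & Hi). unfold transport.
  rewrite (inverse_flow_0 b psi phi) by auto. rewrite log_jac_0.
  replace (- 0 / 2) with 0 by field. rewrite exp_0. ring.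
Qed.

(** Write the solution as [K t (phi t x)]. Along an orbit [K] decays at rate [b_x / 2], which is the
    zero-order term; and since [phi_t = - b * phi_x], the motion of the base point contributes [- b]
    times the space derivative. *)
Lemma transport_is_derive_t (b psi phi : R -> R -> R) (G : R -> R) (t x : R) :
  flow_setup b psi phi -> smooth1 G ->
  is_derive (fun s => transport b psi phi G s x) t
    (- b t x * Derive (transport b psi phi G t) x
     - / 2 * Derive (b t) x * transport b psi phi G t x).
Proof.
  intros (Hb & Hp & Hf & Hi) HG.
  set (J := log_jac b psi).
  set (K := fun t y => G y * exp (- J t y / 2)).
  assert (HJ : Cinf J) by now apply log_jac_Cinf.
  assert (HK : Cinf K).
  { intros n. apply Cx_mult; auto. apply (Cx_ext n (fun t y => exp (-1 * J t y / 2))).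
    - intros. f_equal. field.
    - now apply Cinf_half_exp. }
  set (Kt := fun t y => - / 2 * Derive (b t) (psi t y) * K t y).
  assert (HKt : forall t y, is_derive (fun s => K s y) t (Kt t y)).
  { intros s y. unfold K, Kt.
    eapply is_derive_value.
    - apply (is_derive_scal (fun s => exp (- J s y / 2)) s (G y)).
      apply (is_derive_comp exp (fun s => - J s y / 2)). apply is_derive_exp.
      apply (is_derive_ext (fun s => - / 2 * J s y)). { intros r. simpl; field. }
      apply (is_derive_scal (fun s => J s y) s (- / 2)). now apply log_jac_is_derive_t.
    - unfold K, scal; simpl. unfold mult; simpl. ring. }
  assert (HKtc : cont2 Kt).
  { apply cont2_mult; [ | now apply Cinf_cont]. apply cont2_mult. apply cont2_const.
    apply (cont2_comp (fun t x => Derive (b t) x) (fun t _ => t) psi); auto using cont2_proj1.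
    apply Cinf_cont. now apply Cinf_Derive. now apply (flow_cont2 b). }
  assert (HDx : Derive (transport b psi phi G t) x
                = exp (- J t (phi t x)) * Derive (K t) (phi t x)).
  { apply is_derive_unique.
    apply (is_derive_comp (K t) (phi t)).
    - now apply Cinf_derive.
    - now apply inverse_flow_is_derive_x. }
  eapply is_derive_value.
  - apply (is_derive_along K Kt (fun t y => Derive (K t) y) (fun s => phi s x)); auto.
    + intros; now apply Cinf_derive.
    + now apply (inverse_flow_is_derive_t b psi phi).
  - rewrite HDx. unfold Kt. rewrite Hi.
    change (transport b psi phi G t x) with (K t (phi t x)). fold J. ring.
Qed.

(** Substitute [x = psi t y] over the period that starts at [psi t 0]: the Jacobian [exp J] times
    the factor [exp (- J / 2)] of the solution leaves [exp (J / 2)]. *)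
Lemma transport_pairing (b psi phi : R -> R -> R) (G g : R -> R) (t : R) :
  flow_setup b psi phi ->
  (forall x, continuous G x) -> periodic1 G -> (forall x, continuous g x) -> periodic1 g ->
  RInt (fun x => g x * transport b psi phi G t x) 0 (2 * PI)
  = RInt (fun y => g (psi t y) * (G y * exp (log_jac b psi t y / 2))) 0 (2 * PI).
Proof.
  intros HS HG HGp Hg Hgp. assert (HS' := HS). destruct HS as (Hb & Hp & Hf & Hi).
  set (F := fun x => g x * transport b psi phi G t x).
  assert (HJ := log_jac_Cinf b psi Hb Hp Hf).
  assert (HFc : forall x, continuous F x).
  { intros x. apply continuous_Rmult; auto.
    assert (Hphi : continuous (phi t) x) by (apply cont2_x; now apply (inverse_flow_cont2 b psi)).
    apply continuous_Rmult.
    - now apply (continuous_comp (phi t) G).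
    - apply (continuous_comp (phi t) (fun y => exp (- log_jac b psi t y / 2))); auto.
      apply (continuous_ext (fun y => exp (-1 * log_jac b psi t y / 2))).
      { intros. f_equal. field. }
      apply (cont2_x (fun t y => exp (-1 * log_jac b psi t y / 2))).
      apply Cinf_cont. now apply Cinf_half_exp. }
  assert (HFp : periodic1 F).
  { intros x. unfold F. rewrite Hgp. f_equal. now apply transport_periodic. }
  rewrite <- (RInt_period F (psi t 0)) by auto.
  rewrite <- (flow_shift b psi t 0) by auto. rewrite Rplus_0_l.
  rewrite <- (RInt_comp (V := R_CompleteNormedModule) F (psi t) (fun y => exp (log_jac b psi t y))).
  - apply RInt_eq. intros y. unfold scal; simpl; unfold mult; simpl.
    unfold F, transport. rewrite (inverse_flow_left b psi phi) by auto.
    set (j := log_jac b psi t y).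
    replace (exp j) with (exp (j / 2) * exp (j / 2)) by (rewrite <- exp_plus; f_equal; field).
    replace (- j / 2) with (- (j / 2)) by field. rewrite exp_Ropp. field.
    apply Rgt_not_eq, exp_pos.
  - auto.
  - intros y _. split. now apply flow_is_derive.
    apply (cont2_x (fun t y => exp (log_jac b psi t y))). apply Cinf_cont.
    intros n. now apply Cx_exp.
Qed.

(** In the variable [y] time enters only through [g (psi s y)] and the exponential, so one
    differentiates there under the integral and changes back, without integrating by parts. *)
Lemma transport_weak_solution (b psi phi : R -> R -> R) (g : R -> R) (t : R) :
  flow_setup b psi phi -> periodic1 g -> smooth1 g ->
  is_derive (fun s => RInt (fun x => g x * transport b psi phi (fun _ => 1) s x) 0 (2 * PI)) t
    (RInt (fun x => (b t x * Derive g x + / 2 * Derive (b t) x * g x)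
                    * transport b psi phi (fun _ => 1) t x) 0 (2 * PI)).
Proof.
  intros HS Hgp Hg. assert (HS' := HS). destruct HS as (Hb & Hp & Hf & Hi).
  assert (Hc1 : forall x, continuous (fun _ : R => 1) x) by (intros; apply continuous_const).
  assert (Hp1 : periodic1 (fun _ : R => 1)) by (intros x; auto).
  assert (Hgc := fun x => smooth1_continuous g x Hg).
  assert (Hpsi := flow_Cinf b psi Hb Hp Hf).
  assert (HJ := log_jac_Cinf b psi Hb Hp Hf).
  assert (Hb' := Cinf_Derive _ Hb).
  set (k := fun t x => b t x * Derive g x + / 2 * Derive (b t) x * g x).
  assert (Hk : Cinf k).
  { intros n. apply Cx_plus; apply Cx_mult; auto.
    - now apply (smooth1_Derive g).
    - apply Cx_mult; auto using Cx_const. }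
  apply (is_derive_ext (fun s => RInt (fun y => g (psi s y) * (1 * exp (log_jac b psi s y / 2))) 0 (2 * PI))).
  { intros s. symmetry. now apply transport_pairing. }
  eapply is_derive_value; [ | symmetry; apply (transport_pairing b psi phi (fun _ => 1) (k t) t HS'); auto]; cycle 1.
  { intros x. apply cont2_x. now apply Cinf_cont. }
  { intros x. unfold k. destruct (Hp t x) as [_ ->].
    destruct (periodic2_Derive b Hp t x) as [_ ->]. now rewrite Hgp, (Derive_periodic g Hgp). }
  assert (Hexp : Cinf (fun t y => exp (log_jac b psi t y / 2))).
  { intros n. apply (Cx_ext n (fun t y => exp (1 * log_jac b psi t y / 2))).
    - intros; f_equal; field.
    - now apply Cinf_half_exp. }
  apply (is_derive_RInt_parameter
    (fun y s => g (psi s y) * (1 * exp (log_jac b psi s y / 2)))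
    (fun y s => k s (psi s y) * (1 * exp (log_jac b psi s y / 2)))).
  - apply (cont2_swap (fun s y => g (psi s y) * (1 * exp (log_jac b psi s y / 2)))).
    apply Cinf_cont. intros n. apply Cx_mult. now apply (Cx_comp n (fun _ => g)).
    apply Cx_mult; auto using Cx_const.
  - apply (cont2_swap (fun s y => k s (psi s y) * (1 * exp (log_jac b psi s y / 2)))).
    apply Cinf_cont. intros n. apply Cx_mult. now apply (Cx_comp n k).
    apply Cx_mult; auto using Cx_const.
  - intros y s. eapply is_derive_value.
    + apply (is_derive_mult (fun s => g (psi s y)) (fun s => 1 * exp (log_jac b psi s y / 2))).
      * apply (is_derive_comp g (fun s => psi s y)). now apply smooth1_derive. apply Hf.
      * apply (is_derive_scal (fun s => exp (log_jac b psi s y / 2))).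
        apply (is_derive_comp exp (fun s => log_jac b psi s y / 2)). apply is_derive_exp.
        apply (is_derive_ext (fun s => / 2 * log_jac b psi s y)). { intros r. simpl; field. }
        apply (is_derive_scal (fun s => log_jac b psi s y) s (/ 2)). now apply log_jac_is_derive_t.
      * intros; apply Rmult_comm.
    + unfold k, plus, scal; simpl. unfold mult; simpl. ring.
Qed.

(** * Uniform boundedness on test functions *)

Lemma smooth1_lin (a b : R) (f g : R -> R) :
  smooth1 f -> smooth1 g -> smooth1 (fun x => a * f x + b * g x).
Proof.
  intros Hf Hg n. apply (Cx_plus n (fun _ x => a * f x) (fun _ x => b * g x)).
  - apply (Cx_mult n (fun _ _ => a) (fun _ => f)); auto using Cx_const.
  - apply (Cx_mult n (fun _ _ => b) (fun _ => g)); auto using Cx_const.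
Qed.

Lemma test_function_lin (a b : R) (f g : R -> R) :
  test_function f -> test_function g -> test_function (fun x => a * f x + b * g x).
Proof.
  intros [Hfp Hf] [Hgp Hg]. split.
  - intros x. now rewrite Hfp, Hgp.
  - now apply smooth1_lin.
Qed.

Lemma smooth1_Derive_n (f : R -> R) (k : nat) : smooth1 f -> smooth1 (Derive_n f k).
Proof. intros H. now apply (Cinf_Derive_n (fun _ => f) k). Qed.

Lemma Derive_n_lin (a b : R) (f g : R -> R) (k : nat) (x : R) :
  smooth1 f -> smooth1 g ->
  Derive_n (fun x => a * f x + b * g x) k x = a * Derive_n f k x + b * Derive_n g k x.
Proof.
  intros Hf Hg. revert x. induction k as [ | k IH]; intros x; [reflexivity | simpl].
  rewrite (Derive_ext _ _ x IH). apply is_derive_unique.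
  apply is_derive_Rplus.
  - apply (is_derive_scal (Derive_n f k) x a). now apply smooth1_derive, smooth1_Derive_n.
  - apply (is_derive_scal (Derive_n g k) x b). now apply smooth1_derive, smooth1_Derive_n.
Qed.

(** Each order of derivative converges uniformly, but only after finitely many terms; shifting the
    sequence by [k] before treating the order [k] discards them without changing the limit. *)
Lemma smooth_limit (s : nat -> R -> R) :
  (forall n, test_function (s n)) ->
  (forall n k x, (k <= n)%nat -> Rabs (Derive_n (s (S n)) k x - Derive_n (s n) k x) <= (/ 2) ^ n) ->
  test_function (fun x => real (Lim_seq (fun n => s n x))).
Proof.
  intros Hs Hd.
  set (g := fun k x => real (Lim_seq (fun n => Derive_n (s n) k x))).
  assert (Hsm : forall n k x, is_derive (Derive_n (s n) k) x (Derive_n (s n) (S k) x)).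
  { intros n k x. simpl. apply smooth1_derive, smooth1_Derive_n. apply Hs. }
  assert (Hlim : forall k x, forall n, (k <= n)%nat ->
    Rabs (g k x - Derive_n (s n) k x) <= 2 * (/ 2) ^ n).
  { intros k x n Hn.
    destruct (geometric_limit (fun n => Derive_n (s n) k x) 1 k) as [_ H]; [lra | | ].
    - intros j Hj. rewrite Rmult_1_l. now apply Hd.
    - rewrite <- (Rmult_1_r 2) at 1. now apply H. }
  assert (HU : forall k, CVU_dom (fun n => Derive_n (s (n + k)%nat) k) (fun _ => True)).
  { intros k eps.
    assert (Hpow : is_lim_seq (fun n => 2 * (/ 2) ^ n) 0).
    { replace (Finite 0) with (Rbar_mult 2 0) by (simpl; f_equal; ring).
      apply is_lim_seq_scal_l. apply is_lim_seq_geom. rewrite Rabs_right; lra. }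
    destruct (proj2 (is_lim_seq_spec _ _) Hpow eps) as [N HN].
    exists N. intros n Hn x _.
    rewrite (Lim_seq_incr_n (fun n => Derive_n (s n) k x) k). fold (g k x).
    rewrite Rabs_minus_sym. eapply Rle_lt_trans; [apply Hlim; lia | ].
    assert (HN1 : (N <= n + k)%nat) by lia. specialize (HN _ HN1).
    rewrite Rminus_0_r in HN. eapply Rle_lt_trans; [apply Rle_abs | exact HN]. }
  assert (Hg : forall k x, is_derive (g k) x (g (S k) x)).
  { intros k x.
    assert (H := CVU_Derive (fun n => Derive_n (s (n + k)%nat) k) (fun _ => True)).
    apply (is_derive_ext (fun y => real (Lim_seq (fun n => Derive_n (s (n + k)%nat) k y)))).
    { intros y. now rewrite (Lim_seq_incr_n (fun n => Derive_n (s n) k y) k). }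
    eapply is_derive_value.
    - apply H; auto.
      + apply open_true.
      + intros a b c; auto.
      + intros n y _. eexists. apply Hsm.
      + intros n y _. apply continuity_pt_filterlim.
        apply (is_derive_continuous (Derive_n (s (n + k)%nat) (S k)) y _ (Hsm _ (S k) y)).
      + intros eps. destruct (HU (S k) eps) as [N HN]. exists (S N). intros n Hn y _.
        destruct n as [ | n]; [lia | ].
        assert (HN1 : (N <= n)%nat) by lia. specialize (HN n HN1 y I).
        change (Rabs (Derive_n (s (S n + k)%nat) (S k) y
          - real (Lim_seq (fun n => Derive_n (s (n + k)%nat) (S k) y))) < eps).
        rewrite (Lim_seq_incr_n (fun n => Derive_n (s n) (S k) y) k).
        rewrite (Lim_seq_incr_n (fun n => Derive_n (s n) (S k) y) (S k)) in HN.
        now replace (S n + k)%nat with (n + S k)%nat by lia.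
    - change (real (Lim_seq (fun n => Derive_n (s (n + k)%nat) (S k) x)) = g (S k) x).
      now rewrite (Lim_seq_incr_n (fun n => Derive_n (s n) (S k) x) k). }
  split.
  - intros x. f_equal. apply Lim_seq_ext. intros n. apply Hs.
  - assert (Hk : forall n k, Cx n (fun _ x => g k x)).
    { assert (Hc : forall k, cont2 (fun _ x => g k x)).
      { intros k. apply (cont2_1x (g k)). intros x. now apply (is_derive_continuous (g k) x (g (S k) x)). }
      induction n as [ | n IH]; intros k; [apply Hc | split]; auto.
      exists (fun _ x => g (S k) x). split; auto. }
    intros n. apply (Hk n O).
Qed.

(* Gliding hump: if the conclusion failed, one could pick [i_n] and tiny [f_n] inductively so that
   [P i_n] is large on [f_n], while [P i_n] of the other terms of [sum f_n] stays under control. *)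
Lemma banach_steinhaus_test (I : Type) (P : I -> (R -> R) -> R) :
  (forall i a b f g, test_function f -> test_function g ->
     P i (fun x => a * f x + b * g x) = a * P i f + b * P i g) ->
  (forall i, exists C, forall f e, test_function f -> (forall x, Rabs (f x) <= e) -> Rabs (P i f) <= C * e) ->
  (forall f, test_function f -> exists M, forall i, Rabs (P i f) <= M) ->
  exists (n : nat) (M : R), forall i f, test_function f ->
    (forall k x, (k <= n)%nat -> Rabs (Derive_n f k x) <= 1) -> Rabs (P i f) <= M.
Proof.
  intros Hlin Hbd Hpt. apply NNPP; intros Hno.
  assert (Hneg : forall n M, exists i f, test_function f /\
    (forall k x, (k <= n)%nat -> Rabs (Derive_n f k x) <= 1) /\ M < Rabs (P i f)).
  { intros n M. apply NNPP; intros H. apply Hno. exists n, M. intros i f Hf Hk.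
    apply Rnot_lt_le; intros Hlt. apply H. exists i, f. auto. }
  assert (Ht0 : test_function (fun _ => 0)).
  { split. intros x; auto. intros n. apply Cx_const. }
  assert (Hbd' : forall i, exists C, 0 <= C /\ forall f e, test_function f -> (forall x, Rabs (f x) <= e) -> Rabs (P i f) <= C * e).
  { intros i. destruct (Hbd i) as [C HC]. exists (Rabs C). split. apply Rabs_pos.
    intros f e Hf He. eapply Rle_trans; [now apply (HC f e) | ].
    apply Rmult_le_compat_r. eapply Rle_trans; [apply Rabs_pos | apply (He 0)]. apply Rle_abs. }
  set (Cf := fun i => proj1_sig (constructive_indefinite_description _ (Hbd' i))).
  assert (HCf : forall i, 0 <= Cf i /\ forall f e, test_function f -> (forall x, Rabs (f x) <= e) -> Rabs (P i f) <= Cf i * e).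
  { intros i. exact (proj2_sig (constructive_indefinite_description _ (Hbd' i))). }
  (* The state is the index, the partial sum so far, and the sum of the continuity constants of the
     functionals already used. The last entry dictates how small the next hump must be. *)
  assert (Hstep : forall (q : nat * ((R -> R) * R)), exists p : I * (R -> R),
    test_function (fst (snd q)) -> 0 <= snd (snd q) ->
    test_function (snd p) /\
    (forall k x, (k <= fst q)%nat -> Rabs (Derive_n (snd p) k x) <= (/ 2) ^ (fst q) / (1 + snd (snd q))) /\
    (forall i, Rabs (P i (fst (snd q))) + INR (fst q) + 1 < Rabs (P (fst p) (snd p)))).
  { intros [j [s C]]; simpl. destruct (classic (test_function s /\ 0 <= C)) as [[Hs HC] | HN].
    - destruct (Hpt s Hs) as [A HA].
      set (c := (/ 2) ^ j / (1 + C)).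
      assert (Hc : 0 < c). { apply Rdiv_lt_0_compat. apply pow_lt; lra. lra. }
      destruct (Hneg j ((A + INR j + 1) / c)) as (i & f & Hf & Hk & Hlt).
      (* The summand [0 * 0] gives the rescaled hump the shape of a linear combination with the zero
         function. *)
      exists (i, fun x => c * f x + 0 * 0). intros _ _. simpl. split; [ | split].
      + now apply test_function_lin.
      + intros k x Hkj. rewrite (Derive_n_lin c 0 f (fun _ => 0)) by (apply Hf || apply Ht0).
        rewrite Rmult_0_l, Rplus_0_r, Rabs_mult, Rabs_right by lra.
        specialize (Hk k x Hkj). nra.
      + intros i'. rewrite (Hlin i c 0 f (fun _ => 0)) by auto.
        rewrite Rmult_0_l, Rplus_0_r, Rabs_mult, (Rabs_right c) by lra.
        specialize (HA i').
        apply Rmult_lt_compat_r with (r := c) in Hlt; auto.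
        unfold Rdiv in Hlt. rewrite Rmult_assoc, Rinv_l, Rmult_1_r in Hlt by lra. lra.
    - destruct (Hneg O 0) as (i & f & _). exists (i, f). intros; exfalso; auto. }
  set (step := fun q => proj1_sig (constructive_indefinite_description _ (Hstep q))).
  assert (HSt := fun q => proj2_sig (constructive_indefinite_description _ (Hstep q))).
  change (forall q : nat * ((R -> R) * R), test_function (fst (snd q)) -> 0 <= snd (snd q) ->
    test_function (snd (step q)) /\
    (forall k x, (k <= fst q)%nat -> Rabs (Derive_n (snd (step q)) k x) <= (/ 2) ^ (fst q) / (1 + snd (snd q))) /\
    (forall i, Rabs (P i (fst (snd q))) + INR (fst q) + 1 < Rabs (P (fst (step q)) (snd (step q))))) in HSt.
  clearbody step.
  set (st := fix st (n : nat) : (R -> R) * R :=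
    match n with
    | O => (fun _ => 0, 0)
    | S n => (fun x => 1 * fst (st n) x + 1 * snd (step (n, st n)) x,
              snd (st n) + Cf (fst (step (n, st n))))
    end).
  set (s := fun n => fst (st n)). set (C := fun n => snd (st n)).
  set (f := fun n => snd (step (n, st n))). set (ix := fun n => fst (step (n, st n))).
  assert (Hinv : forall n, test_function (s n) /\ 0 <= C n).
  { induction n as [ | n [IH1 IH2]].
    - split; [exact Ht0 | apply Rle_refl].
    - destruct (HSt (n, st n) IH1 IH2) as (H1 & _). split.
      + now apply (test_function_lin 1 1 (s n) (f n)).
      + change (0 <= C n + Cf (ix n)). destruct (HCf (ix n)). lra. }
  assert (Hf : forall n, test_function (f n) /\
    (forall k x, (k <= n)%nat -> Rabs (Derive_n (f n) k x) <= (/ 2) ^ n / (1 + C n)) /\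
    (forall i, Rabs (P i (s n)) + INR n + 1 < Rabs (P (ix n) (f n)))).
  { intros n. destruct (Hinv n) as [H1 H2]. exact (HSt (n, st n) H1 H2). }
  assert (HsS : forall n k x, Derive_n (s (S n)) k x - Derive_n (s n) k x = Derive_n (f n) k x).
  { intros n k x. change (s (S n)) with (fun x => 1 * s n x + 1 * f n x).
    rewrite Derive_n_lin. ring. apply Hinv. apply Hf. }
  assert (HCS : forall n, C (S n) = C n + Cf (ix n)) by reflexivity.
  assert (HCmono : forall n m, (n <= m)%nat -> C n <= C m).
  { intros n m H. induction H as [ | m H IH]; [lra | ]. rewrite HCS. destruct (HCf (ix m)). lra. }
  assert (Hsmall : forall m n k x, (m <= n)%nat -> (k <= n)%nat ->
    Rabs (Derive_n (s (S n)) k x - Derive_n (s n) k x) <= / (1 + C m) * (/ 2) ^ n).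
  { intros m n k x Hm Hk. rewrite HsS. destruct (Hf n) as (_ & H & _).
    eapply Rle_trans; [now apply H | ].
    unfold Rdiv. rewrite Rmult_comm. apply Rmult_le_compat_r. apply pow_le; lra.
    destruct (Hinv m). apply Rinv_le_contravar. lra. assert (H3 := HCmono m n Hm). lra. }
  set (phi := fun x => real (Lim_seq (fun n => s n x))).
  assert (Hphi : test_function phi).
  { apply smooth_limit. apply Hinv. intros n k x Hk.
    eapply Rle_trans; [apply (Hsmall O); auto; lia | ].
    change (C O) with 0. rewrite Rplus_0_r, Rinv_1. lra. }
  destruct (Hpt phi Hphi) as [M HM].
  destruct (INR_unbounded M) as [n Hn].
  (* The humps after step [n] sum to at most [1 / (1 + C (S n))], and [C (S n)] already contains the
     constant of [P (ix n)]; hence this functional sees at most 1 of the tail, and [|P (ix n) phi|]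
     exceeds [n]. *)
  assert (Htail : forall x, Rabs (phi x - s (S n) x) <= / (1 + C (S n))).
  { intros x.
    destruct (Hinv (S n)) as [_ HCn].
    destruct (geometric_limit (fun n => s n x) (/ (1 + C (S n))) (S n)) as [_ H].
    - apply Rlt_le, Rinv_0_lt_compat; lra.
    - intros j Hj. apply (Hsmall (S n) j O x); auto; lia.
    - eapply Rle_trans; [apply (H (S n)); auto | ].
      assert (H1 : 0 < / (1 + C (S n))) by (apply Rinv_0_lt_compat; lra).
      assert (H2 : 2 * (/ 2) ^ S n <= 1).
      { simpl. assert (H3 : (/ 2) ^ n <= 1 ^ n) by (apply pow_incr; lra). rewrite pow1 in H3. lra. }
      nra. }
  destruct (Hf n) as (Hfn & _ & Hbig). destruct (Hinv n) as [Hsn HCn].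
  destruct (Hinv (S n)) as [HsSn HCSn].
  assert (E : P (ix n) phi = P (ix n) (s n) + P (ix n) (f n) + P (ix n) (fun x => 1 * phi x + (-1) * s (S n) x)).
  { rewrite Hlin by auto. change (s (S n)) with (fun x => 1 * s n x + 1 * f n x).
    rewrite (Hlin _ 1 1 (s n) (f n)) by auto. ring. }
  assert (Hr : Rabs (P (ix n) (fun x => 1 * phi x + (-1) * s (S n) x)) <= 1).
  { destruct (HCf (ix n)) as [H1 H2]. eapply Rle_trans.
    - apply (H2 _ (/ (1 + C (S n)))).
      + now apply test_function_lin.
      + intros x. replace (1 * phi x + -1 * s (S n) x) with (phi x - s (S n) x) by ring. apply Htail.
    - rewrite HCS. apply Rmult_le_reg_r with (1 + (C n + Cf (ix n))); [lra | ].
      rewrite Rmult_assoc, Rinv_l by lra. lra. }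
  specialize (Hbig (ix n)). specialize (HM (ix n)). rewrite E in HM.
  assert (H4 := Rabs_triang_inv (P (ix n) (f n)) (- (P (ix n) (s n) + P (ix n) (fun x => 1 * phi x + (-1) * s (S n) x)))).
  rewrite Rabs_Ropp in H4.
  assert (H5 := Rabs_triang (P (ix n) (s n)) (P (ix n) (fun x => 1 * phi x + (-1) * s (S n) x))).
  replace (P (ix n) (f n) - - (P (ix n) (s n) + P (ix n) (fun x => 1 * phi x + (-1) * s (S n) x)))
    with (P (ix n) (s n) + P (ix n) (f n) + P (ix n) (fun x => 1 * phi x + (-1) * s (S n) x)) in H4 by ring.
  lra.
Qed.

(** * Uniqueness of weak solutions *)

Definition dual (v g : R -> R) : R := RInt (fun x => g x * v x) 0 (2 * PI).

Lemma dual_lin (v f g : R -> R) (a b : R) :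
  (forall x, continuous v x) -> (forall x, continuous f x) -> (forall x, continuous g x) ->
  dual v (fun x => a * f x + b * g x) = a * dual v f + b * dual v g.
Proof.
  intros Hv Hf Hg. unfold dual.
  assert (Hfv : ex_RInt (fun x => f x * v x) 0 (2 * PI)).
  { apply ex_RInt_cont. intros; now apply continuous_Rmult. }
  assert (Hgv : ex_RInt (fun x => g x * v x) 0 (2 * PI)).
  { apply ex_RInt_cont. intros; now apply continuous_Rmult. }
  rewrite <- (RInt_Rscal _ a), <- (RInt_Rscal _ b) by auto.
  rewrite <- RInt_Rplus.
  - apply RInt_eq. intros; ring.
  - now apply ex_RInt_Rscal.
  - now apply ex_RInt_Rscal.
Qed.

Lemma dual_ext (v f g : R -> R) : (forall x, f x = g x) -> dual v f = dual v g.
Proof. intros H. apply RInt_eq. intros x. now rewrite H. Qed.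

Lemma dual_bound (v : R -> R) : (forall x, continuous v x) ->
  exists C, forall f e, (forall x, continuous f x) -> (forall x, Rabs (f x) <= e) -> Rabs (dual v f) <= C * e.
Proof.
  intros Hv. assert (HP := PI_RGT_0).
  destruct (cont2_bounded_rectangle (fun _ => v) 0 0 0 (2 * PI)) as [M HM].
  { now apply (cont2_1x v). }
  exists (2 * PI * M). intros f e Hf He.
  replace (2 * PI * M * e) with (Rabs (2 * PI - 0) * (M * e)) by (rewrite Rminus_0_r, Rabs_right; lra).
  apply abs_RInt_le_const_abs.
  - apply ex_RInt_cont. intros; now apply continuous_Rmult.
  - intros x Hx. rewrite Rmin_left, Rmax_right in Hx by lra.
    rewrite Rabs_mult, Rmult_comm. apply Rmult_le_compat; auto using Rabs_pos.
    apply (HM 0 x); lra.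
Qed.

Lemma test_function_continuous (f : R -> R) (x : R) : test_function f -> continuous f x.
Proof. intros [_ H]. now apply smooth1_continuous. Qed.

Lemma Derive_n_periodic (f : R -> R) (k : nat) : periodic1 f -> periodic1 (Derive_n f k).
Proof. intros H. induction k; simpl; auto. now apply Derive_periodic in IHk. Qed.

Lemma periodic_slices_close (f : R -> R -> R) (t eta : R) :
  cont2 f -> (forall t, periodic1 (f t)) -> 0 < eta ->
  exists d, 0 < d /\ forall h, Rabs h < d -> forall x, Rabs (f (t + h) x - f t x) < eta.
Proof.
  intros Hf Hp Heta.
  destruct (uniform_continuity_2d f (t - 1) (t + 1) 0 (2 * PI)) with (eps := mkposreal eta Heta) as [d Hd].
  { intros; now apply cont2_continuity_2d_pt. }
  assert (Hdp := cond_pos d).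
  exists (Rmin d 1). split. apply Rmin_glb_lt; lra.
  intros h Hh x. destruct (reduce_mod_2PI x) as [k Hk].
  assert (Hh1 : Rabs h < d) by (eapply Rlt_le_trans; [exact Hh | apply Rmin_l]).
  assert (Hh2 : Rabs h < 1) by (eapply Rlt_le_trans; [exact Hh | apply Rmin_r]).
  apply Rabs_def2 in Hh2.
  rewrite <- (periodic1_Z (f (t + h)) x k), <- (periodic1_Z (f t) x k) by auto.
  apply Hd; try lra.
  - now replace (t + h - t) with h by ring.
  - rewrite Rminus_diag, Rabs_R0. exact Hdp.
Qed.

Lemma uniform_small_below (Q : nat -> R -> Prop) :
  (forall k, exists d, 0 < d /\ forall h, Rabs h < d -> Q k h) ->
  forall n, exists d, 0 < d /\ forall h, Rabs h < d -> forall k, (k <= n)%nat -> Q k h.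
Proof.
  intros H n. induction n as [ | n (d & Hd & IH)].
  - destruct (H O) as (d & Hd & HQ). exists d. split; auto.
    intros h Hh k Hk. replace k with O by lia. auto.
  - destruct (H (S n)) as (d' & Hd' & HQ). exists (Rmin d d'). split. now apply Rmin_glb_lt.
    intros h Hh k Hk. destruct (Nat.eq_dec k (S n)) as [-> | Hne].
    + apply HQ. eapply Rlt_le_trans; [exact Hh | apply Rmin_r].
    + apply IH; [ | lia]. eapply Rlt_le_trans; [exact Hh | apply Rmin_l].
Qed.

Lemma Derive_n_is_derive_t (w p : R -> R -> R) (k : nat) (t x : R) :
  Cinf w -> Cinf p -> (forall t x, is_derive (fun s => w s x) t (p t x)) ->
  is_derive (fun s => Derive_n (w s) k x) t (Derive_n (p t) k x).
Proof.
  intros Hw Hp Hd. revert t x. induction k as [ | k IH]; intros t x; [apply Hd | simpl].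
  assert (Hwk := Cinf_Derive_n w k Hw). assert (Hpk := Cinf_Derive_n p k Hp).
  apply (is_derive_swap (fun t x => Derive_n (w t) k x) (fun t x => Derive_n (p t) k x)
    (fun t x => Derive (Derive_n (w t) k) x) (fun t x => Derive (Derive_n (p t) k) x)); auto.
  - now apply Cinf_cont.
  - apply Cinf_cont. now apply (Cinf_Derive (fun t x => Derive_n (p t) k x)).
  - intros s y. now apply (Cinf_derive (fun t x => Derive_n (w t) k x)).
  - intros s y. now apply (Cinf_derive (fun t x => Derive_n (p t) k x)).
Qed.

(** Space and time derivatives commute, so the mean value theorem turns each quotient into a value
    of a space derivative of [p] at an intermediate time. Periodicity makes the estimate uniform in
    [x]. *)
Lemma difference_quotient_small (w p : R -> R -> R) (n : nat) (t eta : R) :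
  Cinf w -> Cinf p -> (forall t, periodic1 (p t)) ->
  (forall t x, is_derive (fun s => w s x) t (p t x)) -> 0 < eta ->
  exists d, 0 < d /\ forall h, Rabs h < d -> forall k, (k <= n)%nat -> h <> 0 -> forall x,
    Rabs (Derive_n (fun x => 1 * (/ h * w (t + h) x + - / h * w t x) + (-1) * p t x) k x) <= eta.
Proof.
  intros Hw Hp Hpp Hd Heta.
  apply (uniform_small_below (fun k h => h <> 0 -> forall x,
    Rabs (Derive_n (fun x => 1 * (/ h * w (t + h) x + - / h * w t x) + (-1) * p t x) k x) <= eta)).
  intros k.
  destruct (periodic_slices_close (fun t x => Derive_n (p t) k x) t eta) as (d & Hdp & Hdd); auto.
  { apply Cinf_cont. now apply Cinf_Derive_n. }
  { intros s. now apply Derive_n_periodic. }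
  exists d. split; auto. intros h Hh Hne x.
  rewrite Derive_n_lin.
  2:{ apply smooth1_lin; now apply smooth1_slice. }
  2:{ now apply smooth1_slice. }
  rewrite Derive_n_lin by now apply smooth1_slice.
  destruct (MVT_gen (fun s => Derive_n (w s) k x) t (t + h) (fun s => Derive_n (p s) k x)) as (c & Hc & E).
  { intros; now apply Derive_n_is_derive_t. }
  { intros s _. apply continuity_pt_filterlim.
    apply (is_derive_continuous (fun s => Derive_n (w s) k x) s (Derive_n (p s) k x)).
    now apply Derive_n_is_derive_t. }
  replace (1 * (/ h * Derive_n (w (t + h)) k x + - / h * Derive_n (w t) k x) + -1 * Derive_n (p t) k x)
    with (Derive_n (p (t + (c - t))) k x - Derive_n (p t) k x).
  - apply Rlt_le, Hdd. eapply Rle_lt_trans; [ | exact Hh].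
    revert Hc. unfold Rmin, Rmax, Rabs.
    destruct (Rle_dec t (t + h)); destruct (Rcase_abs (c - t)); destruct (Rcase_abs h); lra.
  - replace (t + (c - t)) with c by ring.
    replace (/ h * Derive_n (w (t + h)) k x + - / h * Derive_n (w t) k x)
      with (/ h * (Derive_n (w (t + h)) k x - Derive_n (w t) k x)) by ring.
    rewrite E. field. auto.
Qed.

(** What [is_solution] says about one real component. [D g t] stands for the time derivative of the
    pairing with a fixed [g], so the functional analysis below is independent of the equation. *)
Definition weak_curve (v : R -> R -> R) (D : (R -> R) -> R -> R) : Prop :=
  (forall t, 0 <= t -> forall x, continuous (v t) x) /\
  (forall g, test_function g ->
     filterlim (fun t => dual (v t) g) (at_right 0) (locally (dual (v 0) g)) /\
     forall t, 0 < t -> is_derive (fun s => dual (v s) g) t (D g t)).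

(** Freezing the argument at 0 extends to the whole line a function controlled only for nonnegative
    times, so that boundedness on compact sets applies to it. *)
Lemma continuous_clamp (h : R -> R) :
  filterlim h (at_right 0) (locally (h 0)) -> (forall t, 0 < t -> continuous h t) ->
  forall t, continuous (fun s => h (Rmax s 0)) t.
Proof.
  intros H0 Hp t. destruct (Rtotal_order t 0) as [Ht | [-> | Ht]].
  - apply (continuous_ext_loc _ (fun _ => h 0)); [ | apply continuous_const].
    assert (Hd : 0 < - t) by lra. exists (mkposreal _ Hd). intros y Hy.
    change (Rabs (y - t) < - t) in Hy. apply Rabs_def2 in Hy. rewrite Rmax_right by lra. auto.
  - apply filterlim_locally. intros eps. rewrite (Rmax_left 0 0) by lra.
    destruct (proj1 (filterlim_locally _ _) H0 eps) as [d Hd]. exists d. intros y Hy.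
    destruct (Rle_dec y 0) as [Hle | Hle].
    + rewrite Rmax_right by lra. apply ball_center.
    + rewrite Rmax_left by lra. apply Hd; auto. lra.
  - apply (continuous_ext_loc _ h); auto.
    exists (mkposreal _ Ht). intros y Hy. change (Rabs (y - t) < t) in Hy.
    apply Rabs_def2 in Hy. rewrite Rmax_left by lra. auto.
Qed.

(** The functionals are indexed by the times in [[0, T]]. Each one is bounded because [v t] is
    continuous, and the pointwise bound comes from continuity in time of each pairing. *)
Lemma weak_curve_uniform_bound (v : R -> R -> R) (D : (R -> R) -> R -> R) (T : R) :
  weak_curve v D ->
  exists (n : nat) (M : R), 0 < M /\ forall t e f, 0 <= t <= T -> test_function f -> 0 < e ->
    (forall k x, (k <= n)%nat -> Rabs (Derive_n f k x) <= e) -> Rabs (dual (v t) f) <= M * e.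
Proof.
  intros [Hc Hw].
  destruct (banach_steinhaus_test {t | 0 <= t <= T} (fun i f => dual (v (proj1_sig i)) f)) as (n & M & HM).
  - intros [t Ht] a b f g Hf Hg; simpl. apply dual_lin.
    + apply Hc; lra.
    + intros; now apply test_function_continuous.
    + intros; now apply test_function_continuous.
  - intros [t Ht]; simpl. destruct (dual_bound (v t)) as [C HC]. apply Hc; lra.
    exists C. intros f e Hf He. apply HC; auto. intros; now apply test_function_continuous.
  - intros f Hf. destruct (Hw f Hf) as [Hr Hd].
    assert (Hcl : forall t, continuous (fun s => dual (v (Rmax s 0)) f) t).
    { apply (continuous_clamp (fun s => dual (v s) f)); auto. intros t Ht.
      apply (is_derive_continuous (fun s => dual (v s) f) t (D f t)); auto. }
    destruct (cont2_bounded_rectangle (fun t _ => dual (v (Rmax t 0)) f) 0 T 0 0) as [M HM].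
    { now apply (cont2_1t (fun s => dual (v (Rmax s 0)) f)). }
    exists M. intros [t Ht]; simpl. specialize (HM t 0 Ht). rewrite Rmax_left in HM by lra. apply HM. lra.
  (* The maximum with 1 makes the constant positive, since later estimates divide by it; the bound
     on derivatives is rescaled from 1 to [e]. *)
  - exists n, (Rmax M 1). split. eapply Rlt_le_trans; [ | apply Rmax_r]; lra.
    intros t e f Ht Hf He Hk.
    assert (Ht0 : test_function (fun _ => 0)).
    { split. intros x; auto. intros j. apply Cx_const. }
    specialize (HM (exist _ t Ht) (fun x => / e * f x + 0 * 0)). simpl in HM.
    assert (Hie := Rinv_0_lt_compat e He).
    rewrite (dual_lin (v t) f (fun _ => 0)) in HM.
    2:{ apply Hc; lra. } 2:{ intros; now apply test_function_continuous. } 2:{ intros; apply continuous_const. }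
    replace (/ e * dual (v t) f + 0 * dual (v t) (fun _ => 0)) with (/ e * dual (v t) f) in HM by ring.
    rewrite (Rabs_mult (/ e)), (Rabs_right (/ e)) in HM by lra.
    apply Rmult_le_reg_l with (/ e); auto.
    replace (/ e * (Rmax M 1 * e)) with (Rmax M 1) by (field; lra).
    eapply Rle_trans; [apply HM | apply Rmax_l].
    + now apply test_function_lin.
    + intros k x Hkn. rewrite (Derive_n_lin (/ e) 0 f (fun _ => 0)) by (apply Hf || apply Ht0).
      rewrite Rmult_0_l, Rplus_0_r, Rabs_mult, Rabs_right by lra.
      specialize (Hk k x Hkn). apply Rmult_le_reg_l with e; auto.
      rewrite <- Rmult_assoc, Rinv_r by lra. lra.
Qed.

Lemma slice_test_function (w : R -> R -> R) (t : R) :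
  Cinf w -> (forall t, periodic1 (w t)) -> test_function (w t).
Proof. intros H Hp. split; auto. now apply smooth1_slice. Qed.

(** Product rule when both entries move. The difference quotient splits into the error of the
    quotient of [w] tested on [v (t + h)], small by the uniform bound; the variation of [v] against
    [p t], small by weak continuity; and the weak equation tested on [w t]. *)
Lemma weak_curve_is_derive (v : R -> R -> R) (D : (R -> R) -> R -> R) (w p : R -> R -> R) (t : R) :
  weak_curve v D -> Cinf w -> Cinf p -> (forall t, periodic1 (w t)) -> (forall t, periodic1 (p t)) ->
  (forall t x, is_derive (fun s => w s x) t (p t x)) -> 0 < t ->
  is_derive (fun s => dual (v s) (w s)) t (dual (v t) (p t) + D (w t) t).
Proof.
  intros Hv Hw Hp Hwp Hpp Hd Ht.
  destruct (weak_curve_uniform_bound v D (t + 1) Hv) as (n & M & HM & HB).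
  destruct Hv as [Hc Hwk].
  assert (Tw := fun s => slice_test_function w s Hw Hwp).
  assert (Tp := fun s => slice_test_function p s Hp Hpp).
  apply is_derive_Reals. intros eps Heps.
  destruct (difference_quotient_small w p n t (eps / (4 * M))) as (d1 & Hd1 & HQ); auto.
  { apply Rdiv_lt_0_compat; lra. }
  assert (Hcp : continuous (fun s => dual (v s) (p t)) t).
  { apply (is_derive_continuous (fun s => dual (v s) (p t)) t (D (p t) t)). now apply Hwk. }
  assert (He4 : 0 < eps / 4) by lra.
  destruct (proj1 (filterlim_locally _ _) Hcp (mkposreal _ He4)) as [d2 Hd2].
  assert (Hder := proj2 (Hwk (w t) (Tw t)) t Ht). apply is_derive_Reals in Hder.
  destruct (Hder (eps / 4) He4) as [d3 Hd3].
  assert (Hdp : 0 < Rmin (Rmin d1 d2) (Rmin d3 (Rmin t 1))).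
  { assert (H2 := cond_pos d2). assert (H3 := cond_pos d3). repeat apply Rmin_glb_lt; lra. }
  exists (mkposreal _ Hdp). intros h Hh Hhd. simpl in Hhd.
  assert (Hh1 : Rabs h < d1).
  { eapply Rlt_le_trans; [exact Hhd | ]. eapply Rle_trans; [apply Rmin_l | apply Rmin_l]. }
  assert (Hh2 : Rabs h < d2).
  { eapply Rlt_le_trans; [exact Hhd | ]. eapply Rle_trans; [apply Rmin_l | apply Rmin_r]. }
  assert (Hh3 : Rabs h < d3).
  { eapply Rlt_le_trans; [exact Hhd | ]. eapply Rle_trans; [apply Rmin_r | apply Rmin_l]. }
  assert (Hh4 : Rabs h < Rmin t 1).
  { eapply Rlt_le_trans; [exact Hhd | ]. eapply Rle_trans; [apply Rmin_r | apply Rmin_r]. }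
  assert (Hht : Rabs h < t) by (eapply Rlt_le_trans; [exact Hh4 | apply Rmin_l]).
  assert (Hht1 : Rabs h < 1) by (eapply Rlt_le_trans; [exact Hh4 | apply Rmin_r]).
  apply Rabs_def2 in Hht. apply Rabs_def2 in Hht1.
  set (r := fun x => 1 * (/ h * w (t + h) x + - / h * w t x) + (-1) * p t x).
  assert (Hr : Rabs (dual (v (t + h)) r) <= eps / 4).
  { replace (eps / 4) with (M * (eps / (4 * M))) by (field; lra). apply HB.
    - lra.
    - apply test_function_lin; auto. apply test_function_lin; auto.
    - apply Rdiv_lt_0_compat; lra.
    - intros k x Hk. now apply HQ. }
  assert (Hvc : forall x, continuous (v (t + h)) x) by (apply Hc; lra).
  assert (Hwc := fun s x => test_function_continuous (w s) x (Tw s)).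
  assert (Hpc := fun s x => test_function_continuous (p s) x (Tp s)).
  assert (Er : dual (v (t + h)) r = (dual (v (t + h)) (w (t + h)) - dual (v (t + h)) (w t)) / h
                                  - dual (v (t + h)) (p t)).
  { unfold r. rewrite dual_lin; auto.
    2:{ intros x. apply continuous_Rplus; apply continuous_Rmult; auto; apply continuous_const. }
    rewrite (dual_lin (v (t + h)) (w (t + h)) (w t)) by auto. field. auto. }
  assert (H2 : Rabs (dual (v (t + h)) (p t) - dual (v t) (p t)) < eps / 4).
  { apply (Hd2 (t + h)). change (Rabs (t + h - t) < d2). now replace (t + h - t) with h by ring. }
  specialize (Hd3 h Hh Hh3).
  replace ((dual (v (t + h)) (w (t + h)) - dual (v t) (w t)) / h - (dual (v t) (p t) + D (w t) t))
    with (dual (v (t + h)) r + (dual (v (t + h)) (p t) - dual (v t) (p t))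
          + ((dual (v (t + h)) (w t) - dual (v t) (w t)) / h - D (w t) t))
    by (rewrite Er; field; auto).
  eapply Rle_lt_trans; [apply Rabs_triang | ].
  eapply Rle_lt_trans; [apply Rplus_le_compat_r, Rabs_triang | ]. lra.
Qed.

Lemma weak_curve_right_continuous (v : R -> R -> R) (D : (R -> R) -> R -> R) (w : R -> R -> R) :
  weak_curve v D -> Cinf w -> (forall t, periodic1 (w t)) ->
  filterlim (fun s => dual (v s) (w s)) (at_right 0) (locally (dual (v 0) (w 0))).
Proof.
  intros Hv Hw Hwp.
  destruct (weak_curve_uniform_bound v D 1 Hv) as (n & M & HM & HB).
  destruct Hv as [Hc Hwk].
  assert (Tw := fun s => slice_test_function w s Hw Hwp).
  assert (Hwc := fun s x => test_function_continuous (w s) x (Tw s)).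
  apply filterlim_locally. intros eps. assert (Heps := cond_pos eps).
  assert (He2 : 0 < eps / 2) by lra.
  destruct (proj1 (filterlim_locally _ _) (proj1 (Hwk (w 0) (Tw 0))) (mkposreal _ He2)) as [d1 Hd1].
  assert (HeM : 0 < eps / (2 * M)) by (apply Rdiv_lt_0_compat; lra).
  destruct (uniform_small_below (fun k h => forall x,
    Rabs (Derive_n (fun x => 1 * w h x + (-1) * w 0 x) k x) <= eps / (2 * M))) with (n := n) as (d2 & Hd2 & HQ).
  { intros k.
    destruct (periodic_slices_close (fun t x => Derive_n (w t) k x) 0 (eps / (2 * M))) as (d & Hd & Hdd); auto.
    { apply Cinf_cont. now apply Cinf_Derive_n. }
    { intros s. now apply Derive_n_periodic. }
    exists d. split; auto. intros h Hh x.
    rewrite Derive_n_lin by now apply smooth1_slice.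
    specialize (Hdd h Hh x). rewrite Rplus_0_l in Hdd.
    replace (1 * Derive_n (w h) k x + -1 * Derive_n (w 0) k x)
      with (Derive_n (w h) k x - Derive_n (w 0) k x) by ring. lra. }
  assert (Hdp : 0 < Rmin d1 (Rmin d2 1)).
  { assert (H1 := cond_pos d1). repeat apply Rmin_glb_lt; lra. }
  exists (mkposreal _ Hdp). intros t Ht Htp. change (Rabs (t - 0) < Rmin d1 (Rmin d2 1)) in Ht.
  assert (Ht1 : Rabs (t - 0) < d1) by (eapply Rlt_le_trans; [exact Ht | apply Rmin_l]).
  assert (Ht2 : Rabs (t - 0) < d2).
  { eapply Rlt_le_trans; [exact Ht | ]. eapply Rle_trans; [apply Rmin_r | apply Rmin_l]. }
  assert (Ht3 : Rabs (t - 0) < 1).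
  { eapply Rlt_le_trans; [exact Ht | ]. eapply Rle_trans; [apply Rmin_r | apply Rmin_r]. }
  specialize (Hd1 t Ht1 Htp). change (Rabs (dual (v t) (w 0) - dual (v 0) (w 0)) < eps / 2) in Hd1.
  rewrite Rminus_0_r in Ht2, Ht3. apply Rabs_def2 in Ht3.
  change (Rabs (dual (v t) (w t) - dual (v 0) (w 0)) < eps).
  assert (Hr : Rabs (dual (v t) (fun x => 1 * w t x + (-1) * w 0 x)) <= eps / 2).
  { replace (eps / 2) with (M * (eps / (2 * M))) by (field; lra). apply HB; auto.
    - lra.
    - now apply test_function_lin. }
  rewrite dual_lin in Hr by (auto; apply Hc; lra).
  replace (dual (v t) (w t) - dual (v 0) (w 0))
    with ((1 * dual (v t) (w t) + -1 * dual (v t) (w 0)) + (dual (v t) (w 0) - dual (v 0) (w 0))) by ring.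
  eapply Rle_lt_trans; [apply Rabs_triang | ]. lra.
Qed.

Lemma pullback_test_function (b psi : R -> R -> R) (g : R -> R) (T : R) :
  Cinf b -> periodic2 b -> is_flow b psi -> test_function g ->
  test_function (fun y => g (psi T y) * exp (log_jac b psi T y / 2)).
Proof.
  intros Hb Hp Hf [Hgp Hg]. split.
  - intros y. rewrite (flow_shift b psi), (log_jac_periodic b psi) by auto. now rewrite Hgp.
  - intros n. apply Cx_mult.
    + apply (Cx_freeze n T (fun t y => g (psi t y))). apply (Cx_comp n (fun _ => g)); auto.
      now apply (flow_Cinf b).
    + apply (Cx_freeze n T (fun t y => exp (log_jac b psi t y / 2))).
      apply (Cx_ext n (fun t y => exp (1 * log_jac b psi t y / 2))).
      * intros; f_equal; field.
      * apply Cinf_half_exp. now apply log_jac_Cinf.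
Qed.

(* Duality: the pairing of a weak solution with a transported test function is constant. *)
Lemma weak_solution_pairing (b psi phi v : R -> R -> R) (g : R -> R) (T : R) :
  flow_setup b psi phi ->
  weak_curve v (fun g t => dual (v t) (fun x => b t x * Derive g x + / 2 * Derive (b t) x * g x)) ->
  test_function g -> 0 < T ->
  dual (v T) g = dual (v 0) (fun y => g (psi T y) * exp (log_jac b psi T y / 2)).
Proof.
  intros HS Hv Hg HT. assert (HS' := HS). destruct HS as (Hb & Hp & Hf & Hi).
  set (D := fun g t => dual (v t) (fun x => b t x * Derive g x + / 2 * Derive (b t) x * g x)) in Hv.
  (* The datum whose transport arrives at [g] at time [T]. *)
  set (G := fun y => g (psi T y) * exp (log_jac b psi T y / 2)).
  destruct (pullback_test_function b psi g T Hb Hp Hf Hg) as [HGp HG]. fold G in HGp, HG.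
  set (w := transport b psi phi G).
  set (p := fun t x => - b t x * Derive (w t) x - / 2 * Derive (b t) x * w t x).
  assert (Hw : Cinf w) by now apply transport_Cinf.
  assert (Hwp : forall t, periodic1 (w t)) by (intros; now apply transport_periodic).
  assert (Hpc : Cinf p).
  { intros n. apply Cx_minus; apply Cx_mult; auto.
    - now apply Cx_opp.
    - now apply Cinf_Derive.
    - apply Cx_mult; auto using Cx_const. now apply Cinf_Derive. }
  assert (Hpp : forall t, periodic1 (p t)).
  { intros t x. unfold p. destruct (Hp t x) as [_ ->].
    destruct (periodic2_Derive b Hp t x) as [_ ->]. now rewrite Hwp, (Derive_periodic (w t) (Hwp t)). }
  assert (Hwt : forall t x, is_derive (fun s => w s x) t (p t x)).
  { intros t x. now apply transport_is_derive_t. }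
  assert (Hw0 : forall x, w 0 x = G x) by (intros; now apply transport_0).
  assert (HwT : forall x, w T x = g x).
  { intros x. unfold w, transport, G. rewrite Hi.
    replace (- log_jac b psi T (phi T x) / 2) with (- (log_jac b psi T (phi T x) / 2)) by field.
    rewrite exp_Ropp. field. apply Rgt_not_eq, exp_pos. }
  assert (HF : forall t, 0 < t -> is_derive (fun s => dual (v s) (w s)) t 0).
  { intros t Ht. eapply is_derive_value.
    - now apply (weak_curve_is_derive v D w p).
    - unfold D.
      assert (Hvc : forall x, continuous (v t) x) by (apply Hv; lra).
      rewrite (dual_ext (v t) (fun x => b t x * _ + _) (fun x => -1 * p t x + 0 * p t x)).
      2:{ intros x. unfold p. ring. }
      assert (Hptc : forall x, continuous (p t) x) by (intros; apply cont2_x; now apply Cinf_cont).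
      rewrite dual_lin by auto. ring. }
  rewrite <- (dual_ext _ _ _ HwT), <- (dual_ext _ _ _ Hw0).
  (* The derivative vanishes for positive times only, so the pairing is constant there and its value
     at 0 is recovered as the limit from the right. *)
  apply (filterlim_locally_unique (F := at_right 0) (fun s => dual (v s) (w s))).
  - apply (filterlim_ext_loc (fun _ : R => dual (v T) (w T))).
    + exists (mkposreal T HT). intros t Ht Htp. change (Rabs (t - 0) < T) in Ht.
      rewrite Rminus_0_r in Ht. apply Rabs_def2 in Ht.
      symmetry. apply (eq_is_derive (fun s => dual (v s) (w s)) t T); [ | lra].
      intros s Hs. apply HF. lra.
    + apply filterlim_const.
  - now apply (weak_curve_right_continuous v D).
Qed.

(** * Fourier series *)

Fixpoint dirichlet (N : nat) (x : R) : R :=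
  match N with
  | O => 1
  | S n => dirichlet n x + 2 * cos (INR (S n) * x)
  end.

Lemma dirichlet_sin (N : nat) (x : R) : sin (x / 2) * dirichlet N x = sin ((INR N + / 2) * x).
Proof.
  induction N as [ | n IH].
  - simpl. rewrite Rmult_1_r. f_equal. field.
  - change (dirichlet (S n) x) with (dirichlet n x + 2 * cos (INR (S n) * x)).
    rewrite Rmult_plus_distr_l, IH, S_INR.
    replace ((INR n + / 2) * x) with ((INR n + 1) * x - x / 2) by field.
    replace ((INR n + 1 + / 2) * x) with ((INR n + 1) * x + x / 2) by field.
    rewrite sin_plus, sin_minus. ring.
Qed.

Lemma dirichlet_even (N : nat) (x : R) : dirichlet N (- x) = dirichlet N x.
Proof.
  induction N as [ | n IH]; [reflexivity | ].
  change (dirichlet n (- x) + 2 * cos (INR (S n) * - x) = dirichlet n x + 2 * cos (INR (S n) * x)).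
  rewrite IH. replace (INR (S n) * - x) with (- (INR (S n) * x)) by ring. now rewrite cos_neg.
Qed.

Lemma continuous_cos_lin (a x : R) : continuous (fun x => cos (a * x)) x.
Proof. apply (ex_derive_continuous (fun x => cos (a * x))). auto_derive; auto. Qed.

Lemma continuous_sin_lin (a x : R) : continuous (fun x => sin (a * x)) x.
Proof. apply (ex_derive_continuous (fun x => sin (a * x))). auto_derive; auto. Qed.

Lemma dirichlet_continuous (N : nat) (x : R) : continuous (dirichlet N) x.
Proof.
  induction N as [ | n IH].
  - apply continuous_const.
  - apply (continuous_Rplus _ (dirichlet n) (fun x => 2 * cos (INR (S n) * x))); auto.
    apply continuous_Rmult. apply continuous_const. apply continuous_cos_lin.
Qed.

Lemma cos_IZR_period (k : Z) (x : R) : cos (IZR k * (x + 2 * PI)) = cos (IZR k * x).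
Proof.
  rewrite <- (periodic1_Z cos (IZR k * x) k).
  - f_equal. ring.
  - intros y. rewrite <- (cos_period y 1). f_equal. simpl; ring.
Qed.

Lemma sin_IZR_period (k : Z) (x : R) : sin (IZR k * (x + 2 * PI)) = sin (IZR k * x).
Proof.
  rewrite <- (periodic1_Z sin (IZR k * x) k).
  - f_equal. ring.
  - intros y. rewrite <- (sin_period y 1). f_equal. simpl; ring.
Qed.

Lemma dirichlet_periodic (N : nat) : periodic1 (dirichlet N).
Proof.
  intros x. induction N as [ | n IH]; [reflexivity | ].
  change (dirichlet n (x + 2 * PI) + 2 * cos (INR (S n) * (x + 2 * PI))
          = dirichlet n x + 2 * cos (INR (S n) * x)).
  now rewrite IH, INR_IZR_INZ, cos_IZR_period.
Qed.

Lemma RInt_dirichlet (N : nat) : RInt (dirichlet N) (- PI) PI = 2 * PI.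
Proof.
  induction N as [ | n IH].
  - change (RInt (fun _ => 1) (- PI) PI = 2 * PI).
    rewrite !RInt_Rconst. ringR.
  - change (RInt (fun x => dirichlet n x + 2 * cos (INR (S n) * x)) (- PI) PI = 2 * PI).
    assert (Hc : forall x, continuous (fun x => 2 * cos (INR (S n) * x)) x).
    { intros x. apply continuous_Rmult. apply continuous_const. apply continuous_cos_lin. }
    rewrite RInt_Rplus by (apply ex_RInt_cont; auto using dirichlet_continuous).
    rewrite IH. assert (Hn : INR (S n) <> 0) by (apply not_0_INR; lia).
    assert (Hs : sin (INR (S n) * PI) = 0).
    { apply sin_eq_0_1. exists (Z.of_nat (S n)). now rewrite INR_IZR_INZ. }
    set (a := INR (S n)) in *. clearbody a.
    rewrite (RInt_FTC (fun x => 2 * (sin (a * x) / a))); auto.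
    + replace (a * - PI) with (- (a * PI)) by ring. rewrite sin_neg, Hs. fieldR. auto.
    + intros x. auto_derive; auto. field. auto.
Qed.

(** Hadamard's lemma: the quotient is the mean of the derivative of [f] over a segment, a formula
    with no singularity at [z = 0]. The bounds do not depend on [x], which later makes the
    convergence uniform. *)
Lemma hadamard_quotient (f : R -> R) (F1 F2 x : R) :
  smooth1 f -> (forall y, Rabs (Derive f y) <= F1) -> (forall y, Rabs (Derive (Derive f) y) <= F2) ->
  exists k dk : R -> R,
    (forall z, z * k z = f (x + z) - f x) /\ (forall z, is_derive k z (dk z)) /\
    (forall z, continuous dk z) /\ (forall z, Rabs (k z) <= F1) /\ (forall z, Rabs (dk z) <= F2) /\
    k 0 = Derive f x.
Proof.
  intros Hf H1 H2.
  assert (Hf' := smooth1_Derive f Hf). assert (Hf'' := smooth1_Derive _ Hf').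
  assert (Hc' := fun y => smooth1_continuous _ y Hf'). assert (Hc'' := fun y => smooth1_continuous _ y Hf'').
  assert (Hl : cont2 (fun r z => z * r + x)).
  { apply cont2_plus; [ | apply cont2_const]. apply cont2_mult. apply cont2_proj2. apply cont2_proj1. }
  assert (HF : cont2 (fun r z => Derive f (z * r + x))).
  { apply (cont2_comp (fun _ y => Derive f y) (fun r _ => r) (fun r z => z * r + x));
      auto using cont2_proj1. now apply (cont2_1x (Derive f)). }
  assert (HF' : cont2 (fun r z => r * Derive (Derive f) (z * r + x))).
  { apply cont2_mult. apply cont2_proj1.
    apply (cont2_comp (fun _ y => Derive (Derive f) y) (fun r _ => r) (fun r z => z * r + x));
      auto using cont2_proj1. now apply (cont2_1x (Derive (Derive f))). }
  assert (Hb : forall (g : R -> R) M, (forall r, continuous g r) -> (forall r, 0 <= r <= 1 -> Rabs (g r) <= M) ->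
            Rabs (RInt g 0 1) <= M).
  { intros g M Hg HM. replace M with (Rabs (1 - 0) * M) by (rewrite Rminus_0_r, Rabs_R1; ring).
    apply abs_RInt_le_const_abs. now apply ex_RInt_cont.
    intros r Hr. rewrite Rmin_left, Rmax_right in Hr by lra. auto. }
  exists (fun z => RInt (fun r => Derive f (z * r + x)) 0 1),
         (fun z => RInt (fun r => r * Derive (Derive f) (z * r + x)) 0 1).
  split; [ | split; [ | split; [ | split; [ | split]]]].
  - intros z. rewrite <- RInt_Rscal by (apply ex_RInt_cont; intros r; apply (cont2_t _ r z HF)).
    transitivity (RInt (Derive f) (z * 0 + x) (z * 1 + x)).
    + apply (RInt_comp_lin (V := R_CompleteNormedModule) (Derive f) z x 0 1). now apply ex_RInt_cont.
    + rewrite (RInt_FTC f); auto.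
      * f_equal; f_equal; ring.
      * intros; now apply smooth1_derive.
  - intros z. apply (is_derive_RInt_parameter (fun r z => Derive f (z * r + x))
      (fun r z => r * Derive (Derive f) (z * r + x))); auto.
    intros r y. apply (is_derive_comp (Derive f) (fun z => z * r + x)).
    + now apply smooth1_derive.
    + auto_derive; auto. ring.
  - intros z. apply (cont2_RInt_x (fun z r => r * Derive (Derive f) (z * r + x))).
    apply (cont2_swap _ HF').
  - intros z. apply Hb; auto. intros r; apply (cont2_t _ r z HF).
  - intros z. apply Hb.
    + intros r; apply (cont2_t _ r z HF').
    + intros r Hr. rewrite Rabs_mult, (Rabs_right r) by lra. specialize (H2 (z * r + x)).
      assert (H3 := Rabs_pos (Derive (Derive f) (z * r + x))). nra.
  - rewrite (RInt_eq _ (fun _ => Derive f x)) by (intros r; f_equal; ring).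
    rewrite !RInt_Rconst. ringR.
Qed.

Lemma smooth1_sin_lin (a : R) : smooth1 (fun x => sin (a * x)).
Proof.
  intros n. apply (Cx_comp n (fun _ x => sin x) (fun _ x => a * x)).
  - apply Cx_sin_cos.
  - apply Cx_mult; auto using Cx_const, Cx_id.
Qed.

Lemma smooth1_cos_lin (a : R) : smooth1 (fun x => cos (a * x)).
Proof.
  intros n. apply (Cx_comp n (fun _ x => cos x) (fun _ x => a * x)).
  - apply Cx_sin_cos.
  - apply Cx_mult; auto using Cx_const, Cx_id.
Qed.

(** Here [q] extends [sin (z / 2) / z] across 0; it stays away from 0 on the closed period, so one
    may divide by it. *)
Lemma half_sine_quotient :
  exists (q dq : R -> R) (Q : R), 0 < Q /\
    (forall z, z * q z = sin (z / 2)) /\ (forall z, is_derive q z (dq z)) /\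
    (forall z, continuous dq z) /\
    (forall z, - PI <= z <= PI -> / Q <= q z) /\ (forall z, Rabs (dq z) <= 1).
Proof.
  assert (HP := PI_RGT_0).
  set (f := fun x => sin (/ 2 * x)).
  assert (D1 : forall y, Derive f y = / 2 * cos (/ 2 * y)).
  { intros y. apply is_derive_unique. unfold f. auto_derive; auto. ring. }
  assert (D2 : forall y, Derive (Derive f) y = - / 4 * sin (/ 2 * y)).
  { intros y. rewrite (Derive_ext _ _ y D1). apply is_derive_unique. auto_derive; auto. field. }
  destruct (hadamard_quotient f 1 1 0) as (q & dq & Hq & Hd & Hc & _ & Hb & H0).
  - apply smooth1_sin_lin.
  - intros y. rewrite D1, Rabs_mult, (Rabs_right (/ 2)) by lra.
    assert (H := COS_bound (/ 2 * y)). assert (Rabs (cos (/ 2 * y)) <= 1) by (apply Rabs_le; lra). lra.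
  - intros y. rewrite D2, Rabs_mult, Rabs_Ropp, (Rabs_right (/ 4)) by lra.
    assert (H := SIN_bound (/ 2 * y)). assert (Rabs (sin (/ 2 * y)) <= 1) by (apply Rabs_le; lra). lra.
  - assert (Hpos : forall z, - PI <= z <= PI -> 0 < q z).
    { intros z Hz. specialize (Hq z). unfold f in Hq. rewrite Rplus_0_l, Rmult_0_r, sin_0 in Hq.
      destruct (Rtotal_order z 0) as [Hlt | [-> | Hgt]].
      - assert (Hs : 0 < sin (- (/ 2 * z))) by (apply sin_gt_0; lra). rewrite sin_neg in Hs. nra.
      - rewrite H0, D1, Rmult_0_r, cos_0. lra.
      - assert (Hs : 0 < sin (/ 2 * z)) by (apply sin_gt_0; lra). nra. }
    destruct (continuity_ab_min q (- PI) PI) as (zm & Hzm & Hzr).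
    + lra.
    + intros z _. apply continuity_pt_filterlim. now apply (is_derive_continuous q z (dq z)).
    + exists q, dq, (/ q zm). assert (H := Hpos zm Hzr).
      split; [ | split; [ | split; [ | split; [ | split]]]]; auto.
      * now apply Rinv_0_lt_compat.
      * intros z. rewrite Hq. unfold f. rewrite Rplus_0_l, Rmult_0_r, sin_0, Rminus_0_r. f_equal. field.
      * intros z Hz. rewrite Rinv_inv. now apply Hzm.
Qed.

(** One integration by parts gives the explicit rate [1 / lam]. *)
Lemma riemann_lebesgue (h dh : R -> R) (a b H lam : R) :
  a <= b -> 0 < lam ->
  (forall z, a <= z <= b -> is_derive h z (dh z)) -> (forall z, a <= z <= b -> continuous dh z) ->
  (forall z, a <= z <= b -> Rabs (h z) <= H /\ Rabs (dh z) <= H) ->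
  Rabs (RInt (fun z => h z * sin (lam * z)) a b) <= H * (2 + (b - a)) / lam.
Proof.
  intros Hab Hlam Hd Hc HH.
  assert (Hhc : forall z, a <= z <= b -> continuous h z).
  { intros z Hz. apply (is_derive_continuous h z (dh z)); auto. }
  set (F := fun z => - (h z * cos (lam * z)) / lam).
  assert (HI1 : is_RInt (fun z => h z * sin (lam * z) + - (dh z * cos (lam * z) / lam)) a b (F b - F a)).
  { apply (is_RInt_derive (V := R_CompleteNormedModule) F).
    - rewrite Rmin_left, Rmax_right by lra. intros z Hz. assert (Hz' := Hd z Hz). unfold F.
      auto_derive. { now exists (dh z). }
      apply is_derive_unique in Hz'. change (Derive (fun x => h x) z = dh z) in Hz'. rewrite Hz'.
      field. lra.
    - rewrite Rmin_left, Rmax_right by lra. intros z Hz.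
      apply continuous_Rplus.
      + apply continuous_Rmult; auto. apply continuous_sin_lin.
      + apply continuous_Ropp. apply continuous_Rmult; [ | apply continuous_const].
        apply continuous_Rmult; auto. apply continuous_cos_lin. }
  assert (HI2 : ex_RInt (fun z => dh z * cos (lam * z)) a b).
  { apply (ex_RInt_continuous (V := R_CompleteNormedModule)). rewrite Rmin_left, Rmax_right by lra.
    intros z Hz. apply continuous_Rmult; auto. apply continuous_cos_lin. }
  assert (HI3 : ex_RInt (fun z => h z * sin (lam * z)) a b).
  { apply (ex_RInt_continuous (V := R_CompleteNormedModule)). rewrite Rmin_left, Rmax_right by lra.
    intros z Hz. apply continuous_Rmult; auto. apply continuous_sin_lin. }
  apply (is_RInt_unique (V := R_CompleteNormedModule)) in HI1.
  assert (HE : RInt (fun z => h z * sin (lam * z)) a b = (F b - F a) + / lam * RInt (fun z => dh z * cos (lam * z)) a b).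
  { rewrite <- HI1. rewrite <- RInt_Rscal by auto.
    rewrite <- RInt_Rplus.
    - apply RInt_eq. intros z. field. lra.
    - eexists. apply (RInt_correct (V := R_CompleteNormedModule)).
      apply (ex_RInt_plus (V := R_NormedModule)); auto.
      apply (ex_RInt_opp (V := R_NormedModule)).
      apply (ex_RInt_ext (fun z => / lam * (dh z * cos (lam * z)))).
      { intros; unfold Rdiv; ringR. }
      now apply ex_RInt_Rscal.
    - now apply ex_RInt_Rscal. }
  assert (Hil : 0 < / lam) by now apply Rinv_0_lt_compat.
  assert (Hcos : forall z, Rabs (cos z) <= 1).
  { intros z. assert (Hz := COS_bound z). apply Rabs_le; lra. }
  assert (HFb : forall z, a <= z <= b -> Rabs (F z) <= H * / lam).
  { intros z Hz. unfold F, Rdiv. rewrite Rabs_mult, Rabs_Ropp, Rabs_mult, (Rabs_right (/ lam)) by lra.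
    apply Rmult_le_compat_r; [lra | ]. destruct (HH z Hz) as [H1 _]. specialize (Hcos (lam * z)).
    assert (H2 := Rabs_pos (h z)). assert (H3 := Rabs_pos (cos (lam * z))). nra. }
  assert (HI : Rabs (RInt (fun z => dh z * cos (lam * z)) a b) <= (b - a) * H).
  { apply abs_RInt_le_const; auto. intros z Hz. rewrite Rabs_mult.
    destruct (HH z Hz) as [_ H1]. specialize (Hcos (lam * z)).
    assert (H2 := Rabs_pos (dh z)). assert (H3 := Rabs_pos (cos (lam * z))). nra. }
  rewrite HE.
  eapply Rle_trans; [apply Rabs_triang | ].
  eapply Rle_trans; [apply Rplus_le_compat_r, Rabs_triang | ].
  rewrite Rabs_Ropp, (Rabs_mult (/ lam)), (Rabs_right (/ lam)) by lra.
  assert (H1 := HFb a ltac:(lra)). assert (H2 := HFb b ltac:(lra)).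
  unfold Rdiv. nra.
Qed.

Definition dirichlet_mean (f : R -> R) (N : nat) (x : R) : R :=
  / (2 * PI) * RInt (fun y => f y * dirichlet N (x - y)) 0 (2 * PI).

Lemma periodic1_continuous_bounded (f : R -> R) :
  (forall x, continuous f x) -> periodic1 f -> exists M, forall x, Rabs (f x) <= M.
Proof.
  intros Hf Hp. destruct (periodic2_bounded (fun _ => f)) as [M HM].
  - now apply (cont2_1x f).
  - intros t x. split; auto.
  - exists M. intros x. apply (HM 0 x).
Qed.

(** After centring, the error is the mean of [(f (x + z) - f x) * dirichlet N z], and
    [dirichlet_sin] turns this integrand into [k z / q z * sin ((N + 1/2) * z)] with a first factor
    that is C1 with bounds independent of [x] and [N]. *)
Lemma dirichlet_mean_rate (f : R -> R) :
  smooth1 f -> periodic1 f ->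
  exists C, forall N x, Rabs (dirichlet_mean f N x - f x) <= C / (INR N + / 2).
Proof.
  intros Hf Hp. assert (HP := PI_RGT_0).
  assert (Hf' := smooth1_Derive f Hf). assert (Hf'' := smooth1_Derive _ Hf').
  assert (Hp' := Derive_periodic f Hp). assert (Hp'' := Derive_periodic _ Hp').
  destruct (periodic1_continuous_bounded (Derive f)) as [F1 HF1]; auto.
  { intros; now apply smooth1_continuous. }
  destruct (periodic1_continuous_bounded (Derive (Derive f))) as [F2 HF2]; auto.
  { intros; now apply smooth1_continuous. }
  destruct half_sine_quotient as (q & dq & Q & HQ & Hq & Hqd & Hqc & Hqb & Hdqb).
  assert (HF10 : 0 <= F1) by (eapply Rle_trans; [apply Rabs_pos | apply (HF1 0)]).
  assert (HF20 : 0 <= F2) by (eapply Rle_trans; [apply Rabs_pos | apply (HF2 0)]).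
  (* A common bound for [k / q] and for its derivative [dk / q - (k / q) * (dq / q)], from
     [1 / q <= Q] and [|dq| <= 1]. *)
  set (H := F1 * Q + F2 * Q + F1 * (Q * Q)).
  exists (/ (2 * PI) * (H * (2 + (PI - - PI)))). intros N x.
  destruct (hadamard_quotient f F1 F2 x) as (k & dk & Hk & Hkd & Hkc & Hkb & Hdkb & _); auto.
  assert (Hfc := fun y => smooth1_continuous f y Hf).
  assert (Hsub : forall g : R -> R, (forall y, continuous g y) -> forall a y, continuous (fun y => g (a - y)) y).
  { intros g Hg a y. apply (continuous_comp (fun y => a - y) g); auto.
    apply continuous_Rminus. apply continuous_const. apply continuous_id. }
  assert (Hadd : forall g : R -> R, (forall y, continuous g y) -> forall a y, continuous (fun y => g (a + y)) y).
  { intros g Hg a y. apply (continuous_comp (fun y => a + y) g); auto.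
    apply continuous_Rplus. apply continuous_const. apply continuous_id. }
  assert (Hmean : RInt (fun y => f y * dirichlet N (x - y)) 0 (2 * PI)
                  = RInt (fun z => f (x + z) * dirichlet N z) (- PI) PI).
  { assert (HFc : forall y, continuous (fun y => f y * dirichlet N (x - y)) y).
    { intros y. apply continuous_Rmult; auto. apply Hsub. apply dirichlet_continuous. }
    rewrite <- (RInt_period (fun y => f y * dirichlet N (x - y)) (x - PI)); auto.
    2:{ intros y. rewrite Hp. f_equal. rewrite <- (dirichlet_periodic N (x - (y + 2 * PI))).
        f_equal. ring. }
    transitivity (RInt (fun y => f y * dirichlet N (x - y)) (1 * - PI + x) (1 * PI + x)).
    { f_equal; ring. }
    rewrite <- (RInt_comp_lin (V := R_CompleteNormedModule)) by now apply ex_RInt_cont.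
    apply RInt_eq. intros z. unfold scal; simpl; unfold mult; simpl.
    rewrite <- (dirichlet_even N z). rewrite Rmult_1_l.
    f_equal; f_equal; ring. }
  assert (Hconst : f x = / (2 * PI) * RInt (fun z => f x * dirichlet N z) (- PI) PI).
  { rewrite RInt_Rscal by (apply ex_RInt_cont; apply dirichlet_continuous).
    rewrite RInt_dirichlet. field. lra. }
  unfold dirichlet_mean. rewrite Hmean, Hconst at 1. clear Hconst.
  rewrite <- Rmult_minus_distr_l.
  rewrite <- RInt_Rminus.
  2:{ apply ex_RInt_cont. intros z. apply continuous_Rmult; auto. apply dirichlet_continuous. }
  2:{ apply ex_RInt_cont. intros z. apply continuous_Rmult. apply continuous_const. apply dirichlet_continuous. }
  assert (Hqpos : forall z, - PI <= z <= PI -> 0 < q z).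
  { intros z Hz. eapply Rlt_le_trans; [apply Rinv_0_lt_compat, HQ | now apply Hqb]. }
  rewrite (RInt_ext _ (fun z => k z / q z * sin ((INR N + / 2) * z))).
  2:{ rewrite Rmin_left, Rmax_right by lra. intros z Hz.
      rewrite <- dirichlet_sin, <- Hq.
      replace (f (x + z) * dirichlet N z - f x * dirichlet N z) with ((f (x + z) - f x) * dirichlet N z) by ring.
      rewrite <- Hk. fieldR. apply Rgt_not_eq, Hqpos; lra. }
  assert (HN := pos_INR N).
  rewrite Rabs_mult, (Rabs_right (/ (2 * PI))).
  2:{ apply Rle_ge, Rlt_le, Rinv_0_lt_compat; lra. }
  replace (/ (2 * PI) * (H * (2 + (PI - - PI))) / (INR N + / 2))
    with (/ (2 * PI) * (H * (2 + (PI - - PI)) / (INR N + / 2))) by (unfold Rdiv; ring).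
  apply Rmult_le_compat_l.
  { apply Rlt_le, Rinv_0_lt_compat; lra. }
  apply (riemann_lebesgue (fun z => k z / q z) (fun z => (dk z * q z - k z * dq z) / (q z * q z))); try lra.
  - intros z Hz. assert (Hqz := Hqpos z Hz).
    eapply is_derive_value.
    + apply (is_derive_div k q z (dk z) (dq z)); auto. lra.
    + field. lra.
  - intros z Hz. assert (Hqz := Hqpos z Hz).
    assert (Ck := is_derive_continuous k z _ (Hkd z)). assert (Cq := is_derive_continuous q z _ (Hqd z)).
    apply continuous_Rdiv.
    + apply continuous_Rminus; apply continuous_Rmult; auto.
    + apply continuous_Rmult; auto.
    + nra.
  - intros z Hz. assert (Hqz := Hqpos z Hz). assert (Hqz' := Hqb z Hz).
    assert (Hinv : 0 < / q z <= Q).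
    { split. now apply Rinv_0_lt_compat. rewrite <- (Rinv_inv Q). apply Rinv_le_contravar; auto.
      now apply Rinv_0_lt_compat. }
    assert (A1 := Hkb z). assert (A2 := Hdkb z). assert (A3 := Hdqb z).
    assert (B1 := Rabs_pos (k z)). assert (B2 := Rabs_pos (dk z)). assert (B3 := Rabs_pos (dq z)).
    assert (HFQ1 : 0 <= F1 * Q) by nra. assert (HFQ2 : 0 <= F2 * Q) by nra.
    assert (HFQ3 : 0 <= F1 * (Q * Q)) by nra.
    assert (P1 : Rabs (k z) * / q z <= F1 * Q) by (apply Rmult_le_compat; lra).
    split.
    + unfold Rdiv. rewrite Rabs_mult, (Rabs_right (/ q z)) by lra. unfold H. lra.
    + replace ((dk z * q z - k z * dq z) / (q z * q z)) with (dk z * / q z + - (k z * / q z * (dq z * / q z))) by (field; lra).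
      eapply Rle_trans; [apply Rabs_triang | ].
      rewrite Rabs_Ropp, !Rabs_mult, !(Rabs_right (/ q z)) by lra.
      assert (P2 : Rabs (dk z) * / q z <= F2 * Q) by (apply Rmult_le_compat; lra).
      assert (P3 : Rabs (dq z) * / q z <= 1 * Q) by (apply Rmult_le_compat; lra).
      assert (P4 : Rabs (k z) * / q z * (Rabs (dq z) * / q z) <= F1 * Q * (1 * Q)).
      { apply Rmult_le_compat; auto; apply Rmult_le_pos; lra. }
      unfold H. lra.
Qed.

(** * Complex-valued functions and Fourier coefficients by components *)

Lemma CRInt_pair (f g : R -> R) (a b : R) :
  ex_RInt f a b -> ex_RInt g a b -> CRInt (fun x => (f x, g x)) a b = (RInt f a b, RInt g a b).
Proof.
  intros Hf Hg. apply (is_RInt_unique (V := C_R_CompleteNormedModule)).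
  apply (is_RInt_fct_extend_pair (U := R_NormedModule) (V := R_NormedModule) (fun x => (f x, g x))).
  - now apply (RInt_correct (V := R_CompleteNormedModule)).
  - now apply (RInt_correct (V := R_CompleteNormedModule)).
Qed.

Lemma CRInt_ext (f g : R -> C) (a b : R) : (forall x, f x = g x) -> CRInt f a b = CRInt g a b.
Proof. intros H. f_equal. now apply functional_extensionality. Qed.

Lemma is_linear_RtoC : @is_linear R_AbsRing R_NormedModule C_R_NormedModule RtoC.
Proof.
  apply (is_linear_prod (fun x : R => x) (fun _ : R => 0)).
  - apply is_linear_id.
  - apply (is_linear_zero (U := R_NormedModule) (V := R_NormedModule)).
Qed.

Lemma is_derive_RtoC (h : R -> R) (t l : R) :
  is_derive h t l -> @is_derive R_AbsRing C_R_NormedModule (fun s => RtoC (h s)) t (RtoC l).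
Proof.
  intros H.
  apply (filterdiff_comp' (U := R_NormedModule) (V := R_NormedModule) (W := C_R_NormedModule)
           h RtoC t (fun y : R => y * l) RtoC) in H.
  2:{ apply filterdiff_linear. exact is_linear_RtoC. }
  apply (filterdiff_ext_lin _ _ _ H). intros y. apply (linear_scal _ is_linear_RtoC).
Qed.

Lemma is_derive_components (u : R -> C) (t : R) (l : C) :
  @is_derive R_AbsRing C_R_NormedModule u t l ->
  is_derive (fun s => fst (u s)) t (fst l) /\ is_derive (fun s => snd (u s)) t (snd l).
Proof.
  intros H. split.
  - apply (filterdiff_comp' (V := C_R_NormedModule) (W := R_NormedModule) u (fun z : C => fst z) t
      (fun y : R_AbsRing => @scal R_AbsRing C_R_NormedModule y l) (fun z : C => fst z)) in H.
    exact H. apply filterdiff_linear. apply is_linear_fst.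
  - apply (filterdiff_comp' (V := C_R_NormedModule) (W := R_NormedModule) u (fun z : C => snd z) t
      (fun y : R_AbsRing => @scal R_AbsRing C_R_NormedModule y l) (fun z : C => snd z)) in H.
    exact H. apply filterdiff_linear. apply is_linear_snd.
Qed.

Lemma continuous_components (u : R -> C) (x : R) :
  continuous u x -> continuous (fun y => fst (u y)) x /\ continuous (fun y => snd (u y)) x.
Proof.
  intros H. split.
  - apply (continuous_comp u (fun z : R * R => fst z)); auto. destruct (u x). apply continuous_fst.
  - apply (continuous_comp u (fun z : R * R => snd z)); auto. destruct (u x). apply continuous_snd.
Qed.

Lemma continuous_RtoC (f : R -> R) (x : R) : continuous f x -> continuous (fun y => RtoC (f y)) x.
Proof.
  intros H. apply (continuous_comp f RtoC); auto.
  apply (linear_cont (U := R_NormedModule) (V := C_R_NormedModule)). apply is_linear_RtoC.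
Qed.

Definition cosk (k : Z) (x : R) : R := cos (IZR k * x).
Definition sink (k : Z) (x : R) : R := sin (IZR k * x).

Lemma cosk_continuous (k : Z) (x : R) : continuous (cosk k) x.
Proof. apply continuous_cos_lin. Qed.

Lemma sink_continuous (k : Z) (x : R) : continuous (sink k) x.
Proof. apply continuous_sin_lin. Qed.

Lemma cosk_test (k : Z) : test_function (cosk k).
Proof.
  split.
  - intros x. apply cos_IZR_period.
  - apply smooth1_cos_lin.
Qed.

Lemma sink_test (k : Z) : test_function (sink k).
Proof.
  split.
  - intros x. apply sin_IZR_period.
  - apply smooth1_sin_lin.
Qed.

Lemma ex_RInt_dual (v g : R -> R) :
  (forall x, continuous v x) -> (forall x, continuous g x) -> ex_RInt (fun x => g x * v x) 0 (2 * PI).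
Proof. intros Hv Hg. apply ex_RInt_cont. intros; now apply continuous_Rmult. Qed.

Lemma fc_components (u : R -> C) (k : Z) :
  (forall x, continuous u x) ->
  let a := fun x => fst (u x) in let b := fun x => snd (u x) in
  fc u k = (/ (2 * PI) * (dual a (cosk k) + dual b (sink k)),
            / (2 * PI) * (dual b (cosk k) - dual a (sink k))).
Proof.
  intros Hu a b.
  assert (Ha : forall x, continuous a x) by (intros x; apply (continuous_components u x (Hu x))).
  assert (Hb : forall x, continuous b x) by (intros x; apply (continuous_components u x (Hu x))).
  assert (Hc := cosk_continuous k). assert (Hs := sink_continuous k).
  unfold fc.
  rewrite (CRInt_ext _ (fun x => (cosk k x * a x + sink k x * b x, cosk k x * b x - sink k x * a x))).
  - rewrite CRInt_pair.
    + rewrite RInt_Rplus, RInt_Rminus by now apply ex_RInt_dual.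
      unfold rscal, Cmult, RtoC; simpl. unfold dual. f_equal; ringR.
    + apply ex_RInt_cont. intros x. apply continuous_Rplus; apply continuous_Rmult; auto.
    + apply ex_RInt_cont. intros x. apply continuous_Rminus; apply continuous_Rmult; auto.
  - intros x. unfold expi, Cmult, cosk, sink, a, b; simpl. rewrite cos_neg, sin_neg.
    f_equal; ring.
Qed.

Lemma dual_zero (g : R -> R) : dual (fun _ => 0) g = 0.
Proof.
  unfold dual. rewrite (RInt_eq _ (fun _ => 0)) by (intros; ring).
  rewrite !RInt_Rconst. ringR.
Qed.

Lemma fc_RtoC (f : R -> R) (k : Z) : (forall x, continuous f x) ->
  fc (fun x => RtoC (f x)) k = (/ (2 * PI) * dual f (cosk k), - (/ (2 * PI) * dual f (sink k))).
Proof.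
  intros Hf. rewrite fc_components by (intros; now apply continuous_RtoC). simpl.
  change (fun x => f x) with f. rewrite !dual_zero. f_equal; ring.
Qed.

Lemma cosk_neg (k : Z) (x : R) : cosk (- k) x = cosk k x.
Proof. unfold cosk. rewrite opp_IZR, Ropp_mult_distr_l_reverse. apply cos_neg. Qed.

Lemma sink_neg (k : Z) (x : R) : sink (- k) x = - sink k x.
Proof. unfold sink. rewrite opp_IZR, Ropp_mult_distr_l_reverse. apply sin_neg. Qed.

Lemma dual_cosk_neg (v : R -> R) (k : Z) : dual v (cosk (- k)) = dual v (cosk k).
Proof. apply dual_ext. apply cosk_neg. Qed.

Lemma dual_sink_neg (v : R -> R) (k : Z) : (forall x, continuous v x) ->
  dual v (sink (- k)) = - dual v (sink k).
Proof.
  intros Hv. rewrite (dual_ext v _ (fun x => (-1) * sink k x + 0 * sink k x)).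
  - rewrite dual_lin by auto using sink_continuous. ring.
  - intros x. rewrite sink_neg. ring.
Qed.

(** One complex coefficient mixes the real and imaginary parts; the coefficients at [k] and [- k]
    together separate them. *)
Lemma fc_eq_dual (u w : R -> C) :
  (forall x, continuous u x) -> (forall x, continuous w x) -> (forall k, fc u k = fc w k) ->
  forall k, dual (fun x => fst (u x)) (cosk k) = dual (fun x => fst (w x)) (cosk k) /\
            dual (fun x => fst (u x)) (sink k) = dual (fun x => fst (w x)) (sink k) /\
            dual (fun x => snd (u x)) (cosk k) = dual (fun x => snd (w x)) (cosk k) /\
            dual (fun x => snd (u x)) (sink k) = dual (fun x => snd (w x)) (sink k).
Proof.
  intros Hu Hw H k. assert (HP := PI_RGT_0).
  assert (Hi : / (2 * PI) <> 0) by (apply Rinv_neq_0_compat; lra).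
  assert (H1 := H k). assert (H2 := H (- k)%Z).
  rewrite !fc_components in H1, H2 by auto.
  rewrite !dual_cosk_neg in H2.
  rewrite !dual_sink_neg in H2 by (intros; now apply continuous_components).
  injection H1 as A1 A2. injection H2 as B1 B2.
  apply Rmult_eq_reg_l in A1, A2, B1, B2; auto. lra.
Qed.

Lemma dual_swap (f g : R -> R) : dual f g = dual g f.
Proof. apply RInt_eq. intros; ring. Qed.

Lemma dirichlet_mean_0 (f : R -> R) (x : R) : dirichlet_mean f 0 x = / (2 * PI) * dual f (cosk 0).
Proof.
  unfold dirichlet_mean, dual. f_equal. apply RInt_eq. intros y. unfold cosk. simpl.
  rewrite Rmult_0_l, cos_0. ring.
Qed.

Lemma dirichlet_mean_S (f : R -> R) (n : nat) (x : R) : (forall x, continuous f x) ->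
  let k := Z.of_nat (S n) in
  dirichlet_mean f (S n) x = dirichlet_mean f n x
    + 2 * (/ (2 * PI) * (cosk k x * dual f (cosk k) + sink k x * dual f (sink k))).
Proof.
  intros Hf k. unfold dirichlet_mean.
  assert (Hd : forall y, continuous (fun y => f y * dirichlet n (x - y)) y).
  { intros y. apply continuous_Rmult; auto. apply (continuous_comp (fun y => x - y) (dirichlet n)).
    - apply continuous_Rminus. apply continuous_const. apply continuous_id.
    - apply dirichlet_continuous. }
  assert (Hc := cosk_continuous k). assert (Hs := sink_continuous k).
  rewrite (RInt_eq _ (fun y => f y * dirichlet n (x - y)
      + (2 * cosk k x * (cosk k y * f y) + 2 * sink k x * (sink k y * f y)))).
  - rewrite RInt_Rplus.
    2:{ now apply ex_RInt_cont. }
    2:{ apply ex_RInt_cont. intros y. apply continuous_Rplus; apply continuous_Rmult;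
        try apply continuous_const; apply continuous_Rmult; auto. }
    rewrite RInt_Rplus.
    2:{ apply ex_RInt_Rscal. now apply ex_RInt_dual. }
    2:{ apply ex_RInt_Rscal. now apply ex_RInt_dual. }
    rewrite !RInt_Rscal by now apply ex_RInt_dual. unfold dual. ringR.
  - intros y. change (dirichlet (S n) (x - y)) with (dirichlet n (x - y) + 2 * cos (INR (S n) * (x - y))).
    unfold cosk, sink, k. rewrite <- INR_IZR_INZ.
    replace (INR (S n) * (x - y)) with (INR (S n) * x - INR (S n) * y) by ring.
    rewrite cos_minus. ring.
Qed.

Lemma dirichlet_mean_continuous (f : R -> R) (N : nat) : (forall x, continuous f x) ->
  forall x, continuous (dirichlet_mean f N) x.
Proof.
  intros Hf x. induction N as [ | n IH].
  - apply (continuous_ext (fun _ => / (2 * PI) * dual f (cosk 0))).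
    + intros; symmetry; apply dirichlet_mean_0.
    + apply continuous_const.
  - eapply continuous_ext.
    + intros y. symmetry. now apply dirichlet_mean_S.
    + apply continuous_Rplus; auto. apply continuous_Rmult. apply continuous_const.
      apply continuous_Rmult. apply continuous_const.
      apply continuous_Rplus; apply continuous_Rmult; try apply continuous_const.
      apply cosk_continuous. apply sink_continuous.
Qed.

(** As [v] is merely continuous, the Fourier sums are taken of the smooth function [G]: they
    converge to it uniformly, and [v] annihilates each of them. *)
Lemma fourier_uniqueness (v G : R -> R) :
  (forall x, continuous v x) -> (forall k, dual v (cosk k) = 0) -> (forall k, dual v (sink k) = 0) ->
  test_function G -> dual v G = 0.
Proof.
  intros Hv Hc Hs [HGp HG].
  assert (HGc := fun x => smooth1_continuous G x HG).
  assert (Hmean : forall N, dual v (dirichlet_mean G N) = 0).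
  { induction N as [ | n IH].
    - rewrite (dual_ext v _ (fun x => (/ (2 * PI) * dual G (cosk 0)) * cosk 0 x + 0 * cosk 0 x)).
      + rewrite dual_lin by auto using cosk_continuous. rewrite Hc. ring.
      + intros x. rewrite dirichlet_mean_0. unfold cosk at 3 4. rewrite Rmult_0_l, cos_0. ring.
    - set (k := Z.of_nat (S n)).
      rewrite (dual_ext v _ (fun x => 1 * dirichlet_mean G n x + 1 *
        ((2 * (/ (2 * PI) * dual G (cosk k))) * cosk k x + (2 * (/ (2 * PI) * dual G (sink k))) * sink k x))).
      + rewrite dual_lin; auto using dirichlet_mean_continuous.
        * rewrite IH, dual_lin by auto using cosk_continuous, sink_continuous.
          rewrite Hc, Hs. ring.
        * intros x. apply continuous_Rplus; apply continuous_Rmult; try apply continuous_const.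
          apply cosk_continuous. apply sink_continuous.
      + intros x. rewrite dirichlet_mean_S by auto. fold k. ring. }
  destruct (dirichlet_mean_rate G HG HGp) as [C HC].
  destruct (dual_bound v Hv) as [B HB].
  assert (Hall : forall N, Rabs (dual v G) <= B * (C / (INR N + / 2))).
  { intros N.
    replace (dual v G) with (dual v (fun x => (-1) * dirichlet_mean G N x + 1 * G x)).
    - apply HB.
      + intros x. apply continuous_Rplus; apply continuous_Rmult; auto using dirichlet_mean_continuous;
          apply continuous_const.
      + intros x. replace (-1 * dirichlet_mean G N x + 1 * G x) with (- (dirichlet_mean G N x - G x)) by ring.
        rewrite Rabs_Ropp. apply HC.
    - rewrite dual_lin; auto using dirichlet_mean_continuous. rewrite Hmean. ring. }
  destruct (Req_dec (dual v G) 0) as [ | Hne]; auto. exfalso.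
  apply Rabs_pos_lt in Hne. set (d := Rabs (dual v G)) in *.
  destruct (INR_unbounded (B * C / d)) as [N HN].
  specialize (Hall N). assert (H0 := pos_INR N).
  assert (H1 : B * C < INR N * d).
  { apply Rmult_lt_reg_r with (/ d). now apply Rinv_0_lt_compat.
    replace (INR N * d * / d) with (INR N) by (field; lra). exact HN. }
  assert (H2 : d * (INR N + / 2) <= B * C).
  { apply Rmult_le_reg_r with (/ (INR N + / 2)). apply Rinv_0_lt_compat; lra.
    rewrite Rmult_assoc, Rinv_r, Rmult_1_r by lra. unfold Rdiv in Hall. lra. }
  nra.
Qed.

Lemma sumZ_0 (f : Z -> C) : sumZ f 0 = f 0%Z.
Proof. unfold sumZ. simpl. apply sum_O. Qed.

Lemma sumZ_S (f : Z -> C) (N : nat) :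
  sumZ f (S N) = Cplus (f (- Z.of_nat (S N))%Z) (Cplus (sumZ f N) (f (Z.of_nat (S N)))).
Proof.
  unfold sumZ. replace (2 * S N)%nat with (S (S (2 * N))) by lia.
  unfold sum_n. rewrite (sum_Sn_m (G := C_AbelianGroup)) by lia.
  rewrite <- (sum_n_m_S (G := C_AbelianGroup) _ O (S (2 * N))).
  rewrite (sum_n_Sm (G := C_AbelianGroup)) by lia.
  assert (Hc : forall a a' b b' : C, a = a' -> b = b' -> Cplus a b = Cplus a' b') by now intros a a' b b' -> ->.
  apply Hc; [f_equal; lia | apply Hc; [ | f_equal; lia]].
  apply (sum_n_m_ext (G := C_AbelianGroup)). intros n. f_equal. lia.
Qed.

Definition fourier_term (f : R -> R) (x : R) (k : Z) : C :=
  Cmult (fc (fun y => RtoC (f y)) k) (expi (IZR k * x)).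

Lemma fourier_term_value (f : R -> R) (x : R) (k : Z) : (forall x, continuous f x) ->
  fourier_term f x k =
    (/ (2 * PI) * (cosk k x * dual f (cosk k) + sink k x * dual f (sink k)),
     / (2 * PI) * (sink k x * dual f (cosk k) - cosk k x * dual f (sink k))).
Proof.
  intros Hf. unfold fourier_term. rewrite fc_RtoC by auto.
  unfold Cmult, expi; simpl. fold (cosk k x) (sink k x). f_equal; ring.
Qed.

Lemma sumZ_fourier (f : R -> R) (N : nat) (x : R) : (forall x, continuous f x) ->
  sumZ (fourier_term f x) N = (dirichlet_mean f N x, 0).
Proof.
  intros Hf. induction N as [ | n IH].
  - rewrite sumZ_0, fourier_term_value, dirichlet_mean_0 by auto.
    assert (Hs : dual f (sink 0) = 0).
    { rewrite <- (dual_zero f), dual_swap. apply RInt_eq. intros y. unfold sink.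
      rewrite Rmult_0_l, sin_0. ring. }
    rewrite Hs. unfold cosk at 1 4, sink at 1 2. rewrite !Rmult_0_l, cos_0, sin_0. f_equal; ring.
  - rewrite sumZ_S, IH, !fourier_term_value, dirichlet_mean_S by auto.
    rewrite dual_cosk_neg, dual_sink_neg, cosk_neg, sink_neg by auto.
    unfold Cplus; simpl. f_equal; ring.
Qed.

(** * Sobolev norms *)

Lemma Hs_weight_nonneg (s : R) (k : Z) (u : R -> C) : 0 <= Hs_weight s k u.
Proof. apply Rmult_le_pos. apply Rlt_le, exp_pos. apply pow2_ge_0. Qed.

Lemma Hs_weight_ext (s : R) (u w : R -> C) : (forall k, fc u k = fc w k) ->
  forall k, Hs_weight s k u = Hs_weight s k w.
Proof. intros H k. unfold Hs_weight. now rewrite H. Qed.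

Lemma Hs_norm_ext (s : R) (u w : R -> C) : (forall k, fc u k = fc w k) -> Hs_norm s u = Hs_norm s w.
Proof.
  intros H. unfold Hs_norm.
  rewrite (Series_ext _ _ (fun n => Hs_weight_ext s u w H (Z.of_nat n))).
  now rewrite (Series_ext _ _ (fun n => Hs_weight_ext s u w H (- Z.of_nat (S n)))).
Qed.

Lemma sum_le_Series (a : nat -> R) (N : nat) :
  (forall n, 0 <= a n) -> ex_series a -> sum_n a N <= Series a.
Proof.
  intros Ha He. apply Series_correct in He.
  apply (is_lim_seq_incr_compare (sum_n a) (Series a)).
  - exact He.
  - intros n. rewrite sum_Sn. unfold plus; simpl. specialize (Ha (S n)). lra.
Qed.

(** Symmetric partial sums, growing at both ends in step with [sumZ]. *)
Fixpoint Hs_partial (s : R) (u : R -> C) (N : nat) : R :=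
  match N with
  | O => Hs_weight s 0 u
  | S n => Hs_partial s u n + Hs_weight s (Z.of_nat (S n)) u + Hs_weight s (- Z.of_nat (S n)) u
  end.

Lemma Hs_partial_le (s : R) (u : R -> C) (N : nat) : inHs s u -> Hs_partial s u N <= Hs_norm s u ^ 2.
Proof.
  intros [H1 H2].
  set (a := fun n : nat => Hs_weight s (Z.of_nat n) u) in *.
  set (b := fun n : nat => Hs_weight s (- Z.of_nat (S n)) u) in *.
  assert (Ha : forall n, 0 <= a n) by (intros; apply Hs_weight_nonneg).
  assert (Hb : forall n, 0 <= b n) by (intros; apply Hs_weight_nonneg).
  (* The series [b] starts at frequency -1, so the symmetric sum contains one term of [b] fewer than
     [sum_n b N]. *)
  assert (Hp : Hs_partial s u N = sum_n a N + (sum_n b N - b N)).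
  { induction N as [ | n IH].
    - simpl. rewrite !sum_O. unfold a. simpl. ring.
    - change (Hs_partial s u n + a (S n) + b n = sum_n a (S n) + (sum_n b (S n) - b (S n))).
      rewrite IH, !sum_Sn. unfold plus; simpl. ring. }
  assert (S1 := sum_le_Series a N Ha H1). assert (S2 := sum_le_Series b N Hb H2).
  assert (P0 : 0 <= Hs_partial s u N).
  { clear -s. induction N as [ | n IH]; [apply Hs_weight_nonneg | ].
    assert (W1 := Hs_weight_nonneg s (Z.of_nat (S n)) u).
    assert (W2 := Hs_weight_nonneg s (- Z.of_nat (S n)) u).
    change (0 <= Hs_partial s u n + Hs_weight s (Z.of_nat (S n)) u + Hs_weight s (- Z.of_nat (S n)) u). lra. }
  specialize (Hb N). unfold Hs_norm. rewrite pow2_sqrt.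
  - fold a b. lra.
  - fold a b. lra.
Qed.

(** Weighted AM-GM replaces the Cauchy-Schwarz inequality. Since [s > 1], the weight dominates
    [1 + k ^ 2], and the summable part [1 / (1 + k ^ 2)] no longer depends on [s]. *)
Lemma amgm_weight (s l c : R) (k : Z) : 1 < s -> 0 < l -> 0 <= c ->
  2 * c <= l * / (1 + IZR k ^ 2) + Rpower (1 + IZR k ^ 2) s * c ^ 2 / l.
Proof.
  intros Hs Hl Hc. set (p := 1 + IZR k ^ 2).
  assert (Hp : 1 <= p). { unfold p. assert (H := pow2_ge_0 (IZR k)). lra. }
  assert (Hps : p <= Rpower p s).
  { rewrite <- (Rpower_1 p) at 1 by lra. apply Rle_Rpower; lra. }
  apply Rle_trans with (l * / p + p * c ^ 2 / l).
  - assert (H : 0 <= (l - p * c) ^ 2 / (l * p)).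
    { apply Rmult_le_pos. apply pow2_ge_0. apply Rlt_le, Rinv_0_lt_compat. nra. }
    replace ((l - p * c) ^ 2 / (l * p)) with (l * / p + p * c ^ 2 / l - 2 * c) in H by (field; lra). lra.
  - apply Rplus_le_compat_l. apply Rmult_le_compat_r. apply Rlt_le, Rinv_0_lt_compat; lra.
    apply Rmult_le_compat_r; auto. apply pow2_ge_0.
Qed.

Lemma Cmod_expi (x : R) : Cmod (expi x) = 1.
Proof.
  unfold Cmod, expi; simpl.
  replace (cos x * (cos x * 1) + sin x * (sin x * 1)) with ((sin x)² + (cos x)²) by (unfold Rsqr; ring).
  rewrite sin2_cos2. apply sqrt_1.
Qed.

(** The sum of [1 / (1 + k ^ 2)] over the integers is at most 5, so optimising the free parameter
    [l] yields [|f x| ^ 2 <= 5 * ||f||_s ^ 2], and [sqrt 5 < 3]. The same constant serves every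
    [s]. *)
Lemma sobolev_sup (f : R -> R) (s x : R) :
  smooth1 f -> periodic1 f -> 1 < s -> inHs s (fun y => RtoC (f y)) ->
  Rabs (f x) <= 3 * Hs_norm s (fun y => RtoC (f y)).
Proof.
  intros Hf Hp Hs Hin.
  assert (Hfc := fun y => smooth1_continuous f y Hf).
  set (u := fun y => RtoC (f y)) in *.
  assert (Hmean : forall l N, 0 < l ->
    (* [5 - 4 / (N + 1)] is a telescoping majorant of the sum of [1 / (1 + k ^ 2)] over [|k| <= N],
       with equality at [N = 0]. *)
    2 * Cmod (sumZ (fourier_term f x) N) <= l * (5 - 4 / (INR N + 1)) + Hs_partial s u N / l).
  { intros l N Hl.
    assert (Hterm : forall k, 2 * Cmod (fourier_term f x k) <= l * / (1 + IZR k ^ 2) + Hs_weight s k u / l).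
    { intros k. unfold fourier_term. rewrite Cmod_mult, Cmod_expi, Rmult_1_r.
      apply amgm_weight; auto. apply Cmod_ge_0. }
    induction N as [ | n IH].
    - rewrite sumZ_0. eapply Rle_trans; [apply Hterm | ]. simpl. apply Req_le. field. lra.
    - rewrite sumZ_S.
      assert (T1 := Hterm (Z.of_nat (S n))). assert (T2 := Hterm (- Z.of_nat (S n))%Z).
      assert (M1 := Cmod_triangle (fourier_term f x (- Z.of_nat (S n)))
        (Cplus (sumZ (fourier_term f x) n) (fourier_term f x (Z.of_nat (S n))))).
      assert (M2 := Cmod_triangle (sumZ (fourier_term f x) n) (fourier_term f x (Z.of_nat (S n)))).
      change (Hs_partial s u (S n)) with (Hs_partial s u n + Hs_weight s (Z.of_nat (S n)) u
        + Hs_weight s (- Z.of_nat (S n)) u).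
      rewrite opp_IZR in T2. rewrite <- INR_IZR_INZ in T1, T2.
      replace ((- INR (S n)) ^ 2) with (INR (S n) ^ 2) in T2 by ring.
      set (r := INR (S n)) in *. assert (Hr : 1 <= r). { unfold r. rewrite S_INR. assert (H := pos_INR n). lra. }
      replace (INR n + 1) with r in IH by (unfold r; now rewrite S_INR).
      assert (Hk : 2 * / (1 + r ^ 2) <= 4 / r - 4 / (r + 1)).
      { assert (H : 0 <= (4 / r - 4 / (r + 1)) - 2 * / (1 + r ^ 2)); [ | lra].
        replace ((4 / r - 4 / (r + 1)) - 2 * / (1 + r ^ 2))
          with ((4 * (1 + r ^ 2) - 2 * (r * (r + 1))) / (r * (r + 1) * (1 + r ^ 2))) by (field; split; [ | split]; nra).
        apply Rmult_le_pos; [nra | ]. apply Rlt_le, Rinv_0_lt_compat. nra. }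
      apply Rmult_le_compat_l with (r := l) in Hk; [ | lra].
      unfold Rdiv in *. rewrite !Rmult_plus_distr_r. lra. }
  assert (Hlim : forall l, 0 < l -> 2 * Rabs (f x) <= 5 * l + Hs_norm s u ^ 2 / l).
  { intros l Hl. destruct (dirichlet_mean_rate f Hf Hp) as [C HC].
    apply le_epsilon. intros e He.
    destruct (INR_unbounded (2 * C / e)) as [N HN].
    specialize (HC N x). assert (H0 := pos_INR N).
    assert (H1 : Rabs (f x) <= Cmod (sumZ (fourier_term f x) N) + C / (INR N + / 2)).
    { replace (f x) with (dirichlet_mean f N x - (dirichlet_mean f N x - f x)) by ring.
      eapply Rle_trans; [apply Rabs_triang | ]. rewrite Rabs_Ropp. apply Rplus_le_compat; auto.
      rewrite sumZ_fourier by auto.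
      eapply Rle_trans; [ | apply Rmax_Cmod]. apply Rmax_l. }
    assert (H2 : 2 * (C / (INR N + / 2)) <= e).
    { apply Rmult_le_reg_r with (INR N + / 2); [lra | ].
      replace (2 * (C / (INR N + / 2)) * (INR N + / 2)) with (2 * C) by (field; lra).
      assert (H3 : 2 * C < INR N * e).
      { apply Rmult_lt_reg_r with (/ e). now apply Rinv_0_lt_compat.
        replace (INR N * e * / e) with (INR N) by (field; lra). exact HN. }
      nra. }
    specialize (Hmean l N Hl). assert (H4 := Hs_partial_le s u N Hin).
    assert (H5 : Hs_partial s u N / l <= Hs_norm s u ^ 2 / l).
    { apply Rmult_le_compat_r; auto. apply Rlt_le, Rinv_0_lt_compat; lra. }
    assert (H6 : l * (5 - 4 / (INR N + 1)) <= 5 * l).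
    { assert (0 < 4 / (INR N + 1)) by (apply Rdiv_lt_0_compat; lra). nra. }
    lra. }
  assert (HH : 0 <= Hs_norm s u) by apply sqrt_pos.
  destruct (Req_dec (f x) 0) as [-> | Hne].
  - rewrite Rabs_R0. lra.
  - apply Rabs_pos_lt in Hne. set (M := Rabs (f x)) in *.
    (* With [l = M / 5] the term [5 * l] takes up half of the left-hand side [2 * M]. *)
    assert (Hl : 0 < M / 5) by lra. specialize (Hlim _ Hl).
    replace (Hs_norm s u ^ 2 / (M / 5)) with (5 * Hs_norm s u ^ 2 / M) in Hlim by (field; lra).
    assert (H1 : M * M <= 5 * Hs_norm s u ^ 2).
    { apply Rmult_le_reg_r with (/ M). now apply Rinv_0_lt_compat.
      replace (M * M * / M) with M by (field; lra). unfold Rdiv in Hlim. lra. }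
    nra.
Qed.

(** * Decay of Fourier coefficients and membership in the Sobolev spaces *)

Lemma dual_laplacian (f e de : R -> R) (k : R) :
  test_function f -> periodic1 e -> periodic1 de ->
  (forall x, is_derive e x (de x)) -> (forall x, is_derive de x (- k ^ 2 * e x)) ->
  dual (fun x => f x - Derive (Derive f) x) e = (1 + k ^ 2) * dual f e.
Proof.
  intros [Hfp Hf] Hep Hdep He Hde.
  assert (Hf1 := smooth1_Derive f Hf). assert (Hf2 := smooth1_Derive _ Hf1).
  assert (C0 := fun x => smooth1_continuous f x Hf). assert (C1 := fun x => smooth1_continuous _ x Hf1).
  assert (C2 := fun x => smooth1_continuous _ x Hf2).
  assert (Ce := fun x => is_derive_continuous e x _ (He x)).
  assert (HI : RInt (fun x => Derive (Derive f) x * e x + k ^ 2 * (f x * e x)) 0 (2 * PI) = 0).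
  { rewrite (RInt_FTC (fun x => Derive f x * e x - f x * de x)).
    - rewrite <- (Rplus_0_l (2 * PI)). rewrite Hfp, Hep, Hdep, (Derive_periodic f Hfp). ringR.
    - intros x. eapply is_derive_value.
      + apply is_derive_Rminus.
        * apply (is_derive_mult (Derive f) e); [ | apply He | intros; apply Rmult_comm].
          now apply smooth1_derive.
        * apply (is_derive_mult f de); [ | apply Hde | intros; apply Rmult_comm].
          now apply smooth1_derive.
      + unfold minus, plus, opp, mult; simpl. ring.
    - intros x. apply continuous_Rplus; [now apply continuous_Rmult | ].
      apply continuous_Rmult; [apply continuous_const | now apply continuous_Rmult]. }
  rewrite dual_swap. unfold dual.
  assert (E1 : ex_RInt (fun x => f x * e x) 0 (2 * PI)) by now apply ex_RInt_dual.
  assert (E2 : ex_RInt (fun x => Derive (Derive f) x * e x) 0 (2 * PI)) by now apply ex_RInt_dual.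
  rewrite (RInt_eq _ (fun x => f x * e x - Derive (Derive f) x * e x)) by (intros; ring).
  rewrite RInt_Rminus by auto.
  rewrite (RInt_eq (fun x => e x * f x) (fun x => f x * e x)) by (intros; ring).
  rewrite RInt_Rplus, RInt_Rscal in HI; auto.
  - lra.
  - now apply ex_RInt_Rscal.
Qed.

Lemma dual_trig_laplacian (f : R -> R) (k : Z) : test_function f ->
  dual (fun x => f x - Derive (Derive f) x) (cosk k) = (1 + IZR k ^ 2) * dual f (cosk k) /\
  dual (fun x => f x - Derive (Derive f) x) (sink k) = (1 + IZR k ^ 2) * dual f (sink k).
Proof.
  intros Hf.
  assert (Hc : forall x, is_derive (cosk k) x (- IZR k * sink k x)).
  { intros x. unfold cosk, sink. auto_derive; auto. ring. }
  assert (Hs : forall x, is_derive (sink k) x (IZR k * cosk k x)).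
  { intros x. unfold cosk, sink. auto_derive; auto. ring. }
  assert (Pc := proj1 (cosk_test k)). assert (Ps := proj1 (sink_test k)).
  split.
  - apply (dual_laplacian f (cosk k) (fun x => - IZR k * sink k x)); auto.
    + intros x. now rewrite Ps.
    + intros x. eapply is_derive_value. apply (is_derive_scal (sink k)). apply Hs. ring.
  - apply (dual_laplacian f (sink k) (fun x => IZR k * cosk k x)); auto.
    + intros x. now rewrite Pc.
    + intros x. eapply is_derive_value. apply (is_derive_scal (cosk k)). apply Hc. ring.
Qed.

Lemma test_function_laplacian (f : R -> R) : test_function f -> test_function (fun x => f x - Derive (Derive f) x).
Proof.
  intros [Hp Hf]. split.
  - intros x. now rewrite Hp, (Derive_periodic _ (Derive_periodic f Hp)).
  - intros n. apply (Cx_minus n (fun _ => f) (fun _ => Derive (Derive f))); auto.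
    now apply smooth1_Derive, smooth1_Derive.
Qed.

(** Applying [1 - d^2/dx^2], which is symmetric on periodic functions, multiplies a coefficient by
    exactly the Sobolev weight [1 + k ^ 2]; the frequency 0 needs no separate treatment. *)
Lemma dual_trig_decay (j : nat) : forall f : R -> R, test_function f ->
  exists C, forall k : Z, (1 + IZR k ^ 2) ^ j * Rabs (dual f (cosk k)) <= C /\
                          (1 + IZR k ^ 2) ^ j * Rabs (dual f (sink k)) <= C.
Proof.
  induction j as [ | j IH]; intros f Hf.
  - destruct (dual_bound f) as [B HB]. { intros; now apply test_function_continuous. }
    exists (B * 1). intros k. simpl. rewrite !Rmult_1_l. split; apply HB.
    + apply cosk_continuous.
    + intros x. unfold cosk. assert (H := COS_bound (IZR k * x)). apply Rabs_le; lra.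
    + apply sink_continuous.
    + intros x. unfold sink. assert (H := SIN_bound (IZR k * x)). apply Rabs_le; lra.
  - destruct (IH _ (test_function_laplacian f Hf)) as [C HC]. exists C. intros k.
    destruct (HC k) as [H1 H2]. destruct (dual_trig_laplacian f k Hf) as [E1 E2].
    rewrite E1 in H1. rewrite E2 in H2.
    assert (Hp : 0 <= 1 + IZR k ^ 2). { assert (H := pow2_ge_0 (IZR k)). lra. }
    rewrite Rabs_mult, (Rabs_right (1 + IZR k ^ 2)) in H1, H2 by lra.
    set (q := 1 + IZR k ^ 2) in *. simpl.
    split; [eapply Rle_trans; [ | exact H1] | eapply Rle_trans; [ | exact H2]]; apply Req_le; ring.
Qed.

Lemma ex_series_inv_sq (a : nat -> R) (C : R) :
  (forall n, 0 <= a n <= C / (INR n + 1) ^ 2) -> ex_series a.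
Proof.
  intros Ha.
  assert (HC : 0 <= C). { destruct (Ha O) as [H1 H2]. simpl in H2. replace (C / ((0 + 1) * ((0 + 1) * 1))) with C in H2 by field. lra. }
  assert (Hb : forall N, sum_n a N <= 2 * C - C / (INR N + 1)).
  { induction N as [ | n IH].
    - rewrite sum_O. destruct (Ha O) as [_ H]. simpl in *.
      replace (C / ((0 + 1) * ((0 + 1) * 1))) with C in H by field.
      replace (C / (0 + 1)) with C by field. lra.
    - rewrite sum_Sn. change (sum_n a n + a (S n) <= 2 * C - C / (INR (S n) + 1)).
      destruct (Ha (S n)) as [_ H]. rewrite S_INR in *. assert (H0 := pos_INR n).
      set (r := INR n) in *.
      assert (Hk : C / (r + 1 + 1) ^ 2 <= C / (r + 1) - C / (r + 1 + 1)).
      { assert (Hd : 0 <= C / (r + 1) - C / (r + 1 + 1) - C / (r + 1 + 1) ^ 2); [ | lra].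
        replace (C / (r + 1) - C / (r + 1 + 1) - C / (r + 1 + 1) ^ 2)
          with (C * / ((r + 1) * (r + 1 + 1) ^ 2)) by (field; lra).
        apply Rmult_le_pos; auto. apply Rlt_le, Rinv_0_lt_compat. apply Rmult_lt_0_compat; [lra | ].
        apply pow_lt; lra. }
      lra. }
  assert (He : ex_finite_lim_seq (sum_n a)).
  { apply (ex_finite_lim_seq_incr (sum_n a) (2 * C)).
    - intros n. rewrite sum_Sn. destruct (Ha (S n)) as [H _]. unfold plus; simpl. lra.
    - intros n. eapply Rle_trans; [apply Hb | ].
      assert (0 <= C / (INR n + 1)).
      { apply Rmult_le_pos; auto. apply Rlt_le, Rinv_0_lt_compat. assert (H := pos_INR n). lra. }
      lra. }
  destruct He as [l Hl]. exists l. exact Hl.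
Qed.

Lemma inHs_smooth (f : R -> R) (s : R) : test_function f -> inHs s (fun x => RtoC (f x)).
Proof.
  intros Hf. assert (HP := PI_RGT_0).
  assert (Hfc : forall x, continuous f x) by (intros; now apply test_function_continuous).
  (* With [j > s + 1], [p ^ j] dominates [Rpower p s * p], so each weighted square is at most a
     constant over [1 + k ^ 2]. *)
  destruct (INR_unbounded (s + 1)) as [j Hj].
  destruct (dual_trig_decay j f Hf) as [C HC].
  assert (HC0 : 0 <= C).
  { destruct (HC 0%Z) as [H _]. eapply Rle_trans; [ | exact H]. apply Rmult_le_pos.
    apply pow_le. simpl; lra. apply Rabs_pos. }
  set (B := (/ (2 * PI)) ^ 2 * (2 * C ^ 2)).
  assert (HB : forall k, Hs_weight s k (fun x => RtoC (f x)) <= B / (1 + IZR k ^ 2)).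
  { intros k. unfold Hs_weight. rewrite fc_RtoC by auto.
    set (p := 1 + IZR k ^ 2). assert (Hp : 1 <= p). { unfold p. assert (H := pow2_ge_0 (IZR k)). lra. }
    destruct (HC k) as [H1 H2]. fold p in H1, H2.
    assert (Hcm : forall a b : R, Cmod (a, b) ^ 2 = a ^ 2 + b ^ 2).
    { intros a b. unfold Cmod. rewrite pow2_sqrt. reflexivity. apply Rplus_le_le_0_compat; apply pow2_ge_0. }
    rewrite Hcm. set (A := dual f (cosk k)) in *. set (D := dual f (sink k)) in *.
    assert (Hpj : 0 < p ^ j) by (apply pow_lt; lra).
    assert (Hsq : forall y, p ^ j * Rabs y <= C -> (p ^ j * p ^ j) * y ^ 2 <= C ^ 2).
    { intros y Hy. replace ((p ^ j * p ^ j) * y ^ 2) with ((p ^ j * Rabs y) ^ 2).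
      - apply pow_incr. split; auto. apply Rmult_le_pos; [lra | apply Rabs_pos].
      - rewrite Rpow_mult_distr, pow2_abs. ring. }
    assert (S1 := Hsq A H1). assert (S2 := Hsq D H2).
    assert (Hrp : Rpower p s * p <= p ^ j * p ^ j).
    { rewrite <- (Rpower_1 p) at 2 by lra. rewrite <- Rpower_plus.
      apply Rle_trans with (p ^ j * 1).
      - rewrite Rmult_1_r, <- Rpower_pow by lra. apply Rle_Rpower; lra.
      - apply Rmult_le_compat_l; [lra | ]. now apply pow_R1_Rle. }
    apply Rmult_le_reg_r with p; [lra | ].
    replace (B / p * p) with B by (field; lra).
    replace (Rpower p s * ((/ (2 * PI) * A) ^ 2 + (- (/ (2 * PI) * D)) ^ 2) * p)
      with ((/ (2 * PI)) ^ 2 * ((Rpower p s * p) * (A ^ 2 + D ^ 2))) by ring.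
    unfold B. apply Rmult_le_compat_l. apply pow2_ge_0.
    apply Rle_trans with (p ^ j * p ^ j * (A ^ 2 + D ^ 2)); [ | lra].
    apply Rmult_le_compat_r; auto. apply Rplus_le_le_0_compat; apply pow2_ge_0. }
  assert (HB0 : 0 <= B). { unfold B. apply Rmult_le_pos. apply pow2_ge_0. assert (H := pow2_ge_0 C). lra. }
  (* This rests on [(n + 1) ^ 2 <= 2 * (1 + n ^ 2)]. The real [r] covers both half-series, whose
     frequencies are [n] and [- (n + 1)]. *)
  assert (Hle : forall r n, (INR n) ^ 2 <= r ^ 2 -> B / (1 + r ^ 2) <= 2 * B / (INR n + 1) ^ 2).
  { intros r n Hr. assert (H0 := pos_INR n).
    assert (Hd : 0 <= 2 * B / (INR n + 1) ^ 2 - B / (1 + r ^ 2)); [ | lra].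
    replace (2 * B / (INR n + 1) ^ 2 - B / (1 + r ^ 2))
      with (B * (2 * (1 + r ^ 2) - (INR n + 1) ^ 2) * / ((INR n + 1) ^ 2 * (1 + r ^ 2))) by (field; split; nra).
    apply Rmult_le_pos. apply Rmult_le_pos; auto. assert (H1 := pow2_ge_0 (INR n - 1)). lra. apply Rlt_le, Rinv_0_lt_compat.
    apply Rmult_lt_0_compat. apply pow_lt; lra. nra. }
  split; apply (ex_series_inv_sq _ (2 * B)); intros n; (split; [apply Hs_weight_nonneg | ]);
    (eapply Rle_trans; [apply HB | ]); apply Hle.
  - rewrite <- INR_IZR_INZ. lra.
  - rewrite opp_IZR, <- INR_IZR_INZ, S_INR. assert (H0 := pos_INR n). nra.
Qed.

Lemma fc_one (k : Z) : fc (fun _ => RtoC 1) k = if Z.eq_dec k 0 then RtoC 1 else RtoC 0.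
Proof.
  assert (HP := PI_RGT_0).
  rewrite (fc_RtoC (fun _ => 1)) by (intros; apply continuous_const).
  assert (Hper : forall g : R -> R, periodic1 g -> g (2 * PI) = g 0).
  { intros g Hg. rewrite <- (Rplus_0_l (2 * PI)). apply Hg. }
  destruct (Z.eq_dec k 0) as [-> | Hk].
  - unfold dual, cosk, sink.
    rewrite (RInt_eq _ (fun _ => 1)) by (intros; rewrite Rmult_0_l, cos_0; ring).
    rewrite (RInt_eq (fun x => sin _ * 1) (fun _ => 0)) by (intros; rewrite Rmult_0_l, sin_0; ring).
    rewrite !RInt_Rconst.
    unfold RtoC. f_equal; field; lra.
  - assert (HZ : IZR k <> 0) by now apply IZR_neq.
    assert (H1 : dual (fun _ => 1) (cosk k) = 0).
    { unfold dual. rewrite (RInt_FTC (fun x => sink k x / IZR k)).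
      - rewrite (Hper (sink k)) by apply sink_test. ringR.
      - intros x. unfold sink, cosk. auto_derive; auto. field. auto.
      - intros x. apply continuous_Rmult. apply cosk_continuous. apply continuous_const. }
    assert (H2 : dual (fun _ => 1) (sink k) = 0).
    { unfold dual. rewrite (RInt_FTC (fun x => - cosk k x / IZR k)).
      - rewrite (Hper (cosk k)) by apply cosk_test. ringR.
      - intros x. unfold sink, cosk. auto_derive; auto. field. auto.
      - intros x. apply continuous_Rmult. apply sink_continuous. apply continuous_const. }
    rewrite H1, H2. unfold RtoC. f_equal; ring.
Qed.

Lemma Hs_norm_one (s : R) : Hs_norm s (fun _ => RtoC 1) = 1.
Proof.
  assert (Hz : forall k, k <> 0%Z -> Hs_weight s k (fun _ => RtoC 1) = 0).
  { intros k Hk. unfold Hs_weight. rewrite fc_one. destruct (Z.eq_dec k 0); [easy | ].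
    rewrite Cmod_0. simpl. ring. }
  assert (S0 : Series (fun _ : nat => 0) = 0).
  { rewrite (Series_ext _ (fun _ => 0 * 0)) by (intros; ring). rewrite Series_scal_l. ring. }
  assert (Hin : inHs s (fun _ => RtoC 1)).
  { apply (inHs_smooth (fun _ => 1)). split. intros x; auto. intros n; apply Cx_const. }
  unfold Hs_norm.
  rewrite (Series_incr_1 _ (proj1 Hin)).
  rewrite (Series_ext (fun k => Hs_weight s (Z.of_nat (S k)) _) (fun _ => 0)) by (intros; apply Hz; lia).
  rewrite (Series_ext (fun k => Hs_weight s (- Z.of_nat (S k)) _) (fun _ => 0)) by (intros; apply Hz; lia).
  assert (H1 : Hs_weight s (Z.of_nat 0) (fun _ => RtoC 1) = 1).
  { unfold Hs_weight. change (Z.of_nat 0) with 0%Z. rewrite fc_one.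
    destruct (Z.eq_dec 0 0) as [_ | []]; [ | reflexivity]. rewrite Cmod_1.
    replace (1 + 0 ^ 2) with 1 by ring.
    unfold Rpower. rewrite ln_1, Rmult_0_r, exp_0. ring. }
  rewrite S0, H1, !Rplus_0_r. apply sqrt_1.
Qed.

(** * Averaging near an attracting zero *)

Lemma smooth_T2_Cinf (V : R -> R -> R) : smooth_T2 V -> Cinf V.
Proof.
  intros [_ HV].
  assert (H : forall n k, Cx n (Diter (repeat false k) V)).
  { induction n as [ | n IH]; intros k.
    - intros t x. apply (HV (repeat false k) t x).
    - split.
      + intros t x. apply (HV (repeat false k) t x).
      + exists (Diter (repeat false (S k)) V). split; auto.
        intros t x. apply Derive_correct. apply (HV (repeat false k) t x). }
  intros n. apply (H n O).
Qed.

Lemma derive_neg_local (g : R -> R) (x l : R) : is_derive g x l -> l < 0 ->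
  exists d, 0 < d /\ forall h, 0 < h < d -> g (x + h) < g x /\ g x < g (x - h).
Proof.
  intros Hg Hl. apply is_derive_Reals in Hg.
  assert (He : 0 < - l / 2) by lra.
  destruct (Hg _ He) as [d Hd]. exists d. split. apply cond_pos.
  intros h Hh.
  assert (Hq : forall k, k <> 0 -> Rabs k < d -> (g (x + k) - g x) / k < l / 2).
  { intros k Hk Hkd. specialize (Hd k Hk Hkd). apply Rabs_def2 in Hd. lra. }
  split.
  - assert (H := Hq h). rewrite Rabs_right in H by lra. specialize (H ltac:(lra) ltac:(lra)).
    assert (E : g (x + h) - g x = (g (x + h) - g x) / h * h) by (field; lra). nra.
  - assert (H := Hq (- h)). rewrite Rabs_left in H by lra. specialize (H ltac:(lra) ltac:(lra)).
    assert (E : g (x + - h) - g x = (g (x + - h) - g x) / - h * - h) by (field; lra).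
    unfold Rminus at 1. nra.
Qed.

(** Take the supremum of the times up to which [g] has stayed negative. A negative derivative there
    would make [g] positive just before. *)
Lemma first_crossing (g dg : R -> R) (a b : R) :
  (forall x, is_derive g x (dg x)) -> a < b -> g a < 0 -> 0 <= g b ->
  exists s, a < s <= b /\ g s = 0 /\ 0 <= dg s.
Proof.
  intros Hg Hab Ha Hb.
  assert (Hcont : forall x e, 0 < e -> exists d, 0 < d /\ forall y, Rabs (y - x) < d -> Rabs (g y - g x) < e).
  { intros x e He.
    destruct (proj1 (filterlim_locally _ _) (is_derive_continuous g x _ (Hg x)) (mkposreal e He)) as [d Hd].
    exists d. split. apply cond_pos. intros y Hy. apply (Hd y Hy). }
  set (E := fun t => a <= t <= b /\ forall y, a <= y <= t -> g y < 0).
  destruct (completeness E) as [s [Hub Hlub]].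
  { exists b. intros t [Ht _]. lra. }
  { exists a. split. lra. intros y Hy. now replace y with a by lra. }
  assert (Has : a <= s). { apply Hub. split. lra. intros y Hy. now replace y with a by lra. }
  assert (Hsb : s <= b). { apply Hlub. intros t [Ht _]. lra. }
  assert (Hbefore : forall y, a <= y < s -> g y < 0).
  { intros y Hy. apply NNPP; intros Hn.
    assert (Hle : s <= y); [ | lra].
    apply Hlub. intros t [Ht Htn]. apply Rnot_lt_le; intros Hlt. apply Hn, Htn. lra. }
  assert (Hs0 : g s = 0).
  { destruct (Rtotal_order (g s) 0) as [Hlt | [ | Hgt]]; auto; exfalso.
    - destruct (Hcont s (- g s)) as (d & Hd & Hdd); [lra | ].
      assert (Hsb' : s < b). { destruct (Req_dec s b) as [-> | ]; lra. }
      set (t := Rmin (s + d / 2) b).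
      assert (Ht : s < t). { apply Rmin_glb_lt; lra. }
      assert (Ht1 : t <= s + d / 2) by apply Rmin_l. assert (Ht2 : t <= b) by apply Rmin_r.
      assert (Hle : t <= s); [ | lra].
      apply Hub. split. lra. intros y Hy.
      destruct (Rlt_le_dec y s) as [Hys | Hys]; [apply Hbefore; lra | ].
      assert (H := Hdd y ltac:(apply Rabs_def1; lra)). apply Rabs_def2 in H. lra.
    - destruct (Hcont s (g s)) as (d & Hd & Hdd); [lra | ].
      assert (Has' : a < s). { destruct (Req_dec a s) as [<- | ]; lra. }
      set (y := Rmax a (s - d / 2)).
      assert (Hy1 : a <= y) by apply Rmax_l. assert (Hy2 : s - d / 2 <= y) by apply Rmax_r.
      assert (Hy3 : y < s). { apply Rmax_lub_lt; lra. }
      assert (H := Hdd y ltac:(apply Rabs_def1; lra)). apply Rabs_def2 in H.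
      assert (H2 := Hbefore y ltac:(lra)). lra. }
  assert (Has' : a < s). { destruct (Req_dec a s) as [<- | ]; lra. }
  exists s. split; [lra | split; auto].
  apply Rnot_lt_le; intros Hneg.
  destruct (derive_neg_local g s (dg s) (Hg s) Hneg) as (d & Hd & Hdd).
  set (h := Rmin (d / 2) (s - a)).
  assert (Hh : 0 < h) by (apply Rmin_glb_lt; lra).
  assert (Hh1 : h <= d / 2) by apply Rmin_l. assert (Hh2 : h <= s - a) by apply Rmin_r.
  destruct (Hdd h ltac:(lra)) as [_ H]. assert (H2 := Hbefore (s - h) ltac:(lra)). lra.
Qed.

(** If [A] decreases through [x0], it is negative just to the right and vanishes again one period
    later; the first return to 0 has nonnegative, hence by nondegeneracy positive, derivative. *)
Lemma attracting_zero (A : R -> R) :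
  smooth1 A -> periodic1 A -> (exists x, A x = 0) -> (forall x, A x = 0 -> Derive A x <> 0) ->
  exists x, A x = 0 /\ 0 < Derive A x.
Proof.
  intros HA Hp [x0 H0] Hnd. assert (HP := PI_RGT_0).
  assert (Hd := fun x => smooth1_derive A x HA).
  destruct (Rtotal_order (Derive A x0) 0) as [Hlt | [Heq | Hgt]].
  - destruct (derive_neg_local A x0 _ (Hd x0) Hlt) as (d & Hdp & Hdd).
    set (h := Rmin (d / 2) PI).
    assert (Hh : 0 < h) by (apply Rmin_glb_lt; lra).
    assert (Hh1 : h <= d / 2) by apply Rmin_l. assert (Hh2 : h <= PI) by apply Rmin_r.
    destruct (first_crossing A (Derive A) (x0 + h) (x0 + 2 * PI)) as (s & _ & Hs & Hs'); auto.
    + lra.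
    + rewrite <- H0. apply Hdd. lra.
    + rewrite Hp, H0. lra.
    + exists s. split; auto. specialize (Hnd s Hs). lra.
  - now apply Hnd in H0.
  - now exists x0.
Qed.

Definition time_average (f : R -> R -> R) (z : R) : R := / (2 * PI) * RInt (fun s => f s z) 0 (2 * PI).

Lemma time_average_smooth (f : R -> R -> R) : Cinf f -> smooth1 (time_average f).
Proof.
  intros Hf n. apply (Cx_mult n (fun _ _ => / (2 * PI)) (fun _ z => RInt (fun s => f s z) 0 (2 * PI))).
  - apply Cx_const.
  - apply (Cx_freeze n (2 * PI) (fun t z => RInt (fun s => f s z) 0 t)). now apply Cx_primitive.
Qed.

Lemma time_average_periodic (f : R -> R -> R) : periodic2 f -> periodic1 (time_average f).
Proof. intros Hp z. unfold time_average. f_equal. apply RInt_eq. intros s. apply Hp. Qed.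

(* The corrector [W] of the near-identity change of variables [zeta = z + eps W(t,z)], which
   turns [z' = - eps f(t,z)] into [zeta' = - eps A(z) + O(eps^2)]. *)
Definition corrector (f : R -> R -> R) (t z : R) : R :=
  RInt (fun s => f s z - time_average f z) 0 t.

Lemma corrector_Cinf (f : R -> R -> R) : Cinf f -> Cinf (corrector f).
Proof.
  intros Hf n. apply (Cx_primitive n (fun s z => f s z - time_average f z)).
  apply Cx_minus; auto. now apply time_average_smooth.
Qed.

Lemma corrector_is_derive_t (f : R -> R -> R) (t z : R) : Cinf f ->
  is_derive (fun s => corrector f s z) t (f t z - time_average f z).
Proof.
  intros Hf. apply (is_derive_RInt_cont (fun s => f s z - time_average f z)).
  intros s. apply continuous_Rminus; [ | apply continuous_const].
  apply cont2_t. now apply Cinf_cont.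
Qed.

(** Time periodicity holds because the mean has been subtracted; it is what bounds the corrector for
    all times. *)
Lemma corrector_periodic (f : R -> R -> R) : Cinf f -> periodic2 f -> periodic2 (corrector f).
Proof.
  intros Hf Hp t z. assert (HP := PI_RGT_0).
  assert (Hc : forall s, continuous (fun s => f s z) s) by (intros; apply cont2_t; now apply Cinf_cont).
  assert (Hcc : forall s, continuous (fun s => f s z - time_average f z) s).
  { intros s. apply continuous_Rminus; auto. apply continuous_const. }
  split.
  - assert (HI : RInt (fun s => f s z - time_average f z) 0 (2 * PI) = 0).
    { rewrite RInt_Rminus; [ | now apply ex_RInt_cont | apply ex_RInt_const].
      rewrite !RInt_Rconst.
      unfold time_average. fieldR. lra. }
    unfold corrector. rewrite <- (RInt_RChasles _ 0 t (t + 2 * PI)) by auto.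
    rewrite (RInt_period _ t), HI; auto.
    + apply Rplus_0_r.
    + intros s. f_equal. apply Hp.
  - apply RInt_eq. intros s. f_equal. apply Hp. apply time_average_periodic. exact Hp.
Qed.

(** Positive derivative means attracting because of the sign in [z' = - eps * f]. The corrector acts
    twice: added to [z] it shows that the orbit never leaves a neighbourhood of [x0], and its space
    derivative then averages [f_z] along the orbit. All constants are fixed before [eps]. *)
Lemma averaging (f : R -> R -> R) (x0 : R) :
  Cinf f -> periodic2 f -> time_average f x0 = 0 -> 0 < Derive (time_average f) x0 ->
  exists e0 c B, 0 < e0 /\ 0 < c /\ 0 <= B /\
    forall eps z, 0 < eps < e0 -> z 0 = x0 -> (forall t, is_derive z t (- eps * f t (z t))) ->
    forall t, 0 <= t -> c * t - B <= RInt (fun s => Derive (f s) (z s)) 0 t.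
Proof.
  intros Hf Hp HA0 Ha.
  set (A := time_average f) in *. set (a := Derive A x0) in *.
  assert (HAs : smooth1 A) by now apply time_average_smooth.
  set (W := corrector f).
  assert (HW : Cinf W) by now apply corrector_Cinf.
  assert (HWp : periodic2 W) by now apply corrector_periodic.
  assert (HW1 := Cinf_Derive W HW). assert (HW1p := periodic2_Derive W HWp).
  assert (HW2 := Cinf_Derive _ HW1). assert (HW2p := periodic2_Derive _ HW1p).
  destruct (periodic2_bounded W (Cinf_cont _ HW) HWp) as [B0 HB0].
  destruct (periodic2_bounded _ (Cinf_cont _ HW1) HW1p) as [B1 HB1]. cbv beta in HB1.
  destruct (periodic2_bounded _ (Cinf_cont _ HW2) HW2p) as [B2 HB2]. cbv beta in HB2.
  destruct (periodic2_bounded f (Cinf_cont _ Hf) Hp) as [B3 HB3].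
  assert (N0 : 0 <= B0) by (eapply Rle_trans; [apply Rabs_pos | apply (HB0 0 0)]).
  assert (N1 : 0 <= B1) by (eapply Rle_trans; [apply Rabs_pos | apply (HB1 0 0)]).
  assert (N2 : 0 <= B2) by (eapply Rle_trans; [apply Rabs_pos | apply (HB2 0 0)]).
  assert (N3 : 0 <= B3) by (eapply Rle_trans; [apply Rabs_pos | apply (HB3 0 0)]).
  set (B := B0 + B1 + B2 + B3 + 1).
  assert (HBp : 1 <= B) by (unfold B; lra).
  assert (Hr : exists r, 0 < r /\ forall z, Rabs (z - x0) < r -> a / 2 <= Derive A z).
  { assert (Hc := smooth1_continuous _ x0 (smooth1_Derive A HAs)).
    assert (He : 0 < a / 2) by lra.
    destruct (proj1 (filterlim_locally _ _) Hc (mkposreal _ He)) as [d Hd].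
    exists d. split. apply cond_pos. intros z Hz. specialize (Hd z Hz).
    change (Rabs (Derive A z - a) < a / 2) in Hd. apply Rabs_def2 in Hd. lra. }
  destruct Hr as (r & Hr & HAr).
  (* Near [x0] the slope of [A] is at least [a / 2], so [A z] has the sign of [z - x0] and at least
     [a / 2] times its size. *)
  assert (Hmono : forall y z, - r < y - x0 -> y <= z -> z - x0 < r ->
    A y - a / 2 * (y - x0) <= A z - a / 2 * (z - x0)).
  { intros y z Hy Hyz Hz.
    apply (derive_nonneg_le (fun y => A y - a / 2 * (y - x0)) (fun y => Derive A y - a / 2)); auto.
    - intros y'. assert (Hy' := smooth1_derive A y' HAs).
      apply is_derive_Rminus; auto.
      eapply is_derive_value; [apply (is_derive_scal (fun y => y - x0)) | ].
      + apply is_derive_Rminus.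
        apply is_derive_Rid. apply is_derive_Rconst.
      + unfold minus, plus, opp, one, zero; simpl. ring.
    - intros y' Hy'. assert (a / 2 <= Derive A y'); [ | lra]. apply HAr. apply Rabs_def1; lra. }
  assert (HAlow : forall z, Rabs (z - x0) < r -> 0 <= z - x0 -> a / 2 * (z - x0) <= A z).
  { intros z Hz Hz0. apply Rabs_def2 in Hz.
    assert (H := Hmono x0 z ltac:(lra) ltac:(lra) ltac:(lra)). rewrite HA0 in H. lra. }
  assert (HAup : forall z, Rabs (z - x0) < r -> z - x0 <= 0 -> A z <= a / 2 * (z - x0)).
  { intros z Hz Hz0. apply Rabs_def2 in Hz.
    assert (H := Hmono z x0 ltac:(lra) ltac:(lra) ltac:(lra)). rewrite HA0 in H. lra. }
  (* The first bound keeps [eps * W] below [r / 8]; the second makes the averaged drift beat the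
     corrector error on the boundary of the trap; the third keeps [A' >= a / 2] above [a / 4] once
     that error is subtracted. *)
  set (e0 := Rmin (r / (8 * B)) (Rmin (a * r / (8 * (B * B))) (a / (4 * (B * B))))).
  assert (HBB : 0 < B * B) by nra.
  assert (He0 : 0 < e0).
  { repeat apply Rmin_glb_lt; apply Rdiv_lt_0_compat; nra. }
  exists e0, (a / 4), B. split; [auto | split; [lra | split; [lra | ]]].
  intros eps z [Heps Heps0] Hz0 Hz.
  assert (E1 : eps * B <= r / 8).
  { assert (H : eps <= r / (8 * B)) by (eapply Rle_trans; [apply Rlt_le, Heps0 | apply Rmin_l]).
    apply Rmult_le_compat_r with (r := B) in H; [ | lra].
    replace (r / (8 * B) * B) with (r / 8) in H by (field; lra). exact H. }
  assert (E2 : eps * (B * B) <= a * r / 8).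
  { assert (H : eps <= a * r / (8 * (B * B))).
    { eapply Rle_trans; [apply Rlt_le, Heps0 | ]. eapply Rle_trans; [apply Rmin_r | apply Rmin_l]. }
    apply Rmult_le_compat_r with (r := B * B) in H; [ | lra].
    replace (a * r / (8 * (B * B)) * (B * B)) with (a * r / 8) in H by (field; lra). exact H. }
  assert (E3 : eps * (B * B) <= a / 4).
  { assert (H : eps <= a / (4 * (B * B))).
    { eapply Rle_trans; [apply Rlt_le, Heps0 | ]. eapply Rle_trans; [apply Rmin_r | apply Rmin_r]. }
    apply Rmult_le_compat_r with (r := B * B) in H; [ | lra].
    replace (a / (4 * (B * B)) * (B * B)) with (a / 4) in H by (field; lra). exact H. }
  assert (Hprod : forall p q b1, Rabs p <= b1 -> 0 <= b1 <= B -> Rabs q <= B3 -> Rabs (eps * (p * q)) <= eps * (B * B)).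
  { intros p q b1 Hp1 Hb1 Hq. rewrite !Rabs_mult, (Rabs_right eps) by lra.
    apply Rmult_le_compat_l; [lra | ]. apply Rmult_le_compat; try apply Rabs_pos; unfold B in *; lra. }
  set (d := fun t => z t + eps * W t (z t) - x0).
  set (dd := fun t => - eps * (A (z t) + eps * (Derive (W t) (z t) * f t (z t)))).
  assert (Hd : forall t, is_derive d t (dd t)).
  { intros t. unfold d. eapply is_derive_value.
    - apply is_derive_Rminus.
      + apply is_derive_Rplus.
        * apply Hz.
        * apply (is_derive_scal (fun t => W t (z t))).
          apply (is_derive_along W (fun t z => f t z - A z) (fun t z => Derive (W t) z) z).
          { apply cont2_plus. now apply Cinf_cont. apply (Cinf_cont (fun _ z => - A z)).
            intros n. apply Cx_opp. apply HAs. }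
          { intros; now apply corrector_is_derive_t. }
          { intros; now apply Cinf_derive. }
          { apply Hz. }
      + apply is_derive_Rconst.
    - unfold dd, minus, plus, opp, zero; simpl. ring. }
  assert (Hnear : forall t, Rabs (d t) <= r / 2 -> Rabs (z t - x0) < r /\ d t - r / 8 <= z t - x0 <= d t + r / 8).
  { intros t Ht. assert (H : Rabs (eps * W t (z t)) <= r / 8).
    { rewrite Rabs_mult, (Rabs_right eps) by lra. assert (HB := HB0 t (z t)).
      eapply Rle_trans; [ | exact E1]. apply Rmult_le_compat_l; unfold B; lra. }
    apply Rabs_le_between in H. apply Rabs_le_between in Ht. unfold d in *.
    split; [apply Rabs_def1 | ]; lra. }
  assert (Hd0 : d 0 = 0).
  { unfold d, W, corrector. rewrite RInt_same, Hz0. ringR. }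
  assert (Htrap : forall t, 0 <= t -> Rabs (d t) <= r / 2).
  { assert (Hup : forall t, 0 <= t -> d t * d t < r / 2 * (r / 2)).
    { intros t Ht. apply Rnot_le_lt; intros Hle.
      destruct (first_crossing (fun t => d t * d t - r / 2 * (r / 2)) (fun t => 2 * (d t * dd t)) 0 t)
        as (s & Hs & Hs0 & Hs').
      - intros s. eapply is_derive_value.
        + apply is_derive_Rminus.
          * apply (is_derive_mult d d); [apply Hd | apply Hd | intros; apply Rmult_comm].
          * apply is_derive_Rconst.
        + unfold minus, plus, opp, mult, zero; simpl. ring.
      - destruct Ht as [ | <-]; auto. rewrite Hd0 in Hle. nra.
      - rewrite Hd0. nra.
      - lra.
      - assert (Hcase : d s = r / 2 \/ d s = - (r / 2)).
        { assert (H : (d s - r / 2) * (d s + r / 2) = 0) by lra.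
          apply Rmult_integral in H. lra. }
        assert (Habs : Rabs (d s) <= r / 2) by (apply Rabs_le; lra).
        destruct (Hnear s Habs) as [Hn1 Hn2].
        assert (Hq := Hprod _ _ B1 (HB1 s (z s)) ltac:(unfold B; lra) (HB3 s (z s))).
        apply Rabs_le_between in Hq. unfold dd in Hs'.
        set (X := eps * (Derive (W s) (z s) * f s (z s))) in *.
        destruct Hcase as [Hc | Hc].
        + assert (H := HAlow (z s) Hn1 ltac:(lra)).
          assert (HX : 0 < A (z s) + X) by nra. rewrite Hc in Hs'.
          assert (0 < eps * (A (z s) + X)) by nra. nra.
        + assert (H := HAup (z s) Hn1 ltac:(lra)).
          assert (HX : A (z s) + X < 0) by nra. rewrite Hc in Hs'.
          assert (eps * (A (z s) + X) < 0) by nra. nra. }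
    intros t Ht. specialize (Hup t Ht). apply Rabs_le. nra. }
  intros t Ht.
  assert (HW1t : forall t z, is_derive (fun s => Derive (W s) z) t (Derive (f t) z - Derive A z)).
  { intros s y. apply (is_derive_swap W (fun t z => f t z - A z) (fun t z => Derive (W t) z)
      (fun t z => Derive (f t) z - Derive A z)).
    - apply cont2_plus. now apply Cinf_cont. apply (Cinf_cont (fun _ z => - A z)).
      intros n. apply Cx_opp. apply HAs.
    - apply cont2_plus. apply Cinf_cont. now apply Cinf_Derive.
      apply (Cinf_cont (fun _ z => - Derive A z)). intros n. apply Cx_opp.
      now apply (smooth1_Derive A).
    - intros; now apply corrector_is_derive_t.
    - intros; now apply Cinf_derive.
    - intros r' y'. apply is_derive_Rminus.
      now apply Cinf_derive. now apply smooth1_derive. }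
  assert (Hzc : forall s, continuous z s) by (intros s; apply (is_derive_continuous z s _ (Hz s))).
  assert (Hfzc : forall s, continuous (fun s => Derive (f s) (z s)) s).
  { intros s. apply (cont2_continuous_comp _ (fun s y => Derive (f s) y) (fun s => s) z); auto.
    apply Cinf_cont. now apply Cinf_Derive. apply continuous_id. }
  (* Subtracting [W_z] replaces the oscillating [f_z] by [A z]'s derivative plus [eps * W_zz * f],
     at least [a / 4] in the trap. As [W_z] vanishes at time 0 and is bounded by [B], it costs only
     the constant [B]. *)
  assert (HPhi := derive_nonneg_le
    (fun t => RInt (fun s => Derive (f s) (z s)) 0 t - Derive (W t) (z t) - a / 4 * t)
    (fun t => Derive A (z t) + eps * (Derive (fun y => Derive (W t) y) (z t) * f t (z t)) - a / 4) 0 t Ht).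
  cbv beta in HPhi. rewrite RInt_same, Hz0 in HPhi.
  assert (HD0 : Derive (W 0) x0 = 0).
  { rewrite (Derive_ext (W 0) (fun _ => 0)). apply Derive_const. intros y. apply RInt_same. }
  rewrite HD0 in HPhi.
  assert (HWt := HB1 t (z t)). apply Rabs_le_between in HWt.
  assert (Hgoal : 0 - 0 - a / 4 * 0 <= RInt (fun s => Derive (f s) (z s)) 0 t - Derive (W t) (z t) - a / 4 * t).
  { apply HPhi.
    - intros s. eapply is_derive_value.
      + apply is_derive_Rminus.
        * apply is_derive_Rminus.
          { now apply (is_derive_RInt_cont (fun s => Derive (f s) (z s))). }
          { apply (is_derive_along (fun t z => Derive (W t) z) (fun t z => Derive (f t) z - Derive A z)
              (fun t z => Derive (fun y => Derive (W t) y) z) z); auto.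
            - apply cont2_plus. apply Cinf_cont. now apply Cinf_Derive.
              apply (Cinf_cont (fun _ z => - Derive A z)). intros n. apply Cx_opp.
              now apply (smooth1_Derive A).
            - intros t' y'. apply (Cinf_derive (fun t z => Derive (W t) z)); auto. }
        * apply (is_derive_scal (fun s => s)). apply is_derive_Rid.
      + unfold minus, plus, opp, one, zero; simpl. ring.
    - intros s Hs. destruct (Hnear s (Htrap s (proj1 Hs))) as [Hn _].
      assert (H1 := HAr _ Hn).
      assert (Hq := Hprod _ _ B2 (HB2 s (z s)) ltac:(unfold B; lra) (HB3 s (z s))).
      apply Rabs_le_between in Hq. lra. }
  unfold B. lra.
Qed.

(** * The transport equation *)

Definition comoving (V : R -> R -> R) (m : nat) (t z : R) : R := V t (z - INR m * t).

Lemma comoving_Cinf (V : R -> R -> R) (m : nat) : Cinf V -> Cinf (comoving V m).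
Proof.
  intros HV n. apply (Cx_comp n V (fun t z => z - INR m * t)); auto.
  apply Cx_minus. apply Cx_id. apply (Cx_fun_t (fun t => INR m * t)).
  intros t. apply continuous_Rmult. apply continuous_const. apply continuous_id.
Qed.

(** Time periodicity uses that [m] is an integer: during [2 * PI] the frame travels [m] whole
    periods. *)
Lemma comoving_periodic (V : R -> R -> R) (m : nat) : periodic2 V -> periodic2 (comoving V m).
Proof.
  intros Hp t z. unfold comoving. split.
  - rewrite (proj1 (Hp t _)).
    rewrite <- (periodic1_Z (V t) _ (Z.of_nat m)) by (intros y; apply Hp).
    rewrite <- INR_IZR_INZ. f_equal. ring.
  - rewrite <- (proj2 (Hp t (z - INR m * t))). f_equal. ring.
Qed.

Lemma Derive_comoving (V : R -> R -> R) (m : nat) (t z : R) :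
  Derive (comoving V m t) z = Derive (V t) (z - INR m * t).
Proof. apply (Derive_n_comp_trans (V t) 1 z (- (INR m * t))). Qed.

(** For fixed [t], substituting [z = x + m t] moves the motion from [g] into [V]; exchanging the
    integrals then lets the time integral act on [V] alone. *)
Lemma double_integral_comoving (V : R -> R -> R) (m : nat) (g : R -> R) :
  Cinf V -> periodic2 V -> (forall x, continuous g x) -> periodic1 g ->
  RInt (fun t => RInt (fun x => V t x * g (x + INR m * t)) 0 (2 * PI)) 0 (2 * PI)
  = 2 * PI * dual (time_average (comoving V m)) g.
Proof.
  intros HV Hp Hg Hgp. assert (HP := PI_RGT_0).
  assert (Hf := comoving_Cinf V m HV).
  rewrite (RInt_eq _ (fun t => RInt (fun z => comoving V m t z * g z) 0 (2 * PI))).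
  - rewrite (RInt_RInt_swap (fun t z => comoving V m t z * g z)).
    2:{ apply cont2_mult. now apply Cinf_cont. now apply (cont2_1x g). }
    unfold dual. rewrite <- RInt_Rscal.
    + apply RInt_eq. intros z.
      rewrite (RInt_eq _ (fun t => g z * comoving V m t z)) by (intros; ring).
      rewrite RInt_Rscal by (apply ex_RInt_cont; intros; apply cont2_t; now apply Cinf_cont).
      unfold time_average. fieldR. lra.
    + apply ex_RInt_dual; auto. intros x. apply smooth1_continuous. now apply time_average_smooth.
  - intros t.
    set (F := fun x => V t x * g (x + INR m * t)).
    assert (HF : forall x, continuous F x).
    { intros x. apply continuous_Rmult.
      - apply cont2_x. now apply Cinf_cont.
      - apply (continuous_comp (fun x => x + INR m * t) g); auto.
        apply continuous_Rplus. apply continuous_id. apply continuous_const. }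
    assert (HFp : periodic1 F).
    { intros x. unfold F. rewrite (proj2 (Hp t x)). f_equal. rewrite <- (Hgp (x + INR m * t)). f_equal. ring. }
    rewrite <- (RInt_period F (- (INR m * t))) by auto.
    transitivity (RInt F (1 * 0 + - (INR m * t)) (1 * (2 * PI) + - (INR m * t))).
    { f_equal; ring. }
    rewrite <- (RInt_comp_lin (V := R_CompleteNormedModule)) by now apply ex_RInt_cont.
    apply RInt_eq. intros z. unfold scal; simpl; unfold mult; simpl.
    unfold F, comoving. rewrite !Rmult_1_l. f_equal; f_equal; ring.
Qed.

(** On the resonant line the phase [k * x + m * k * t] is a function of [x + m * t], so the double
    coefficient is a single one of the time average in the moving frame. *)
Lemma fourier2_resonant (V : R -> R -> R) (m : nat) (k : Z) :
  Cinf V -> periodic2 V ->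
  fourier2 V k (Z.of_nat m * k) = fc (fun x => RtoC (time_average (comoving V m) x)) k.
Proof.
  intros HV Hp. assert (HP := PI_RGT_0).
  set (A := time_average (comoving V m)).
  assert (HA : smooth1 A) by (apply time_average_smooth; now apply comoving_Cinf).
  rewrite fc_RtoC by (intros; now apply smooth1_continuous).
  assert (Hs : forall (g : R -> R), (forall x, continuous g x) ->
    cont2 (fun t x => V t x * g (x + INR m * t))).
  { intros g Hg. apply cont2_mult. now apply Cinf_cont.
    apply (cont2_comp (fun _ y => g y) (fun t _ => t) (fun t x => x + INR m * t)).
    - now apply (cont2_1x g).
    - apply cont2_proj1.
    - apply cont2_plus. apply cont2_proj2. apply cont2_mult. apply cont2_const. apply cont2_proj1. }
  assert (Hc := Hs (cosk k) (cosk_continuous k)). assert (Hn := Hs (sink k) (sink_continuous k)).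
  unfold fourier2.
  rewrite (CRInt_ext _ (fun t =>
    (RInt (fun x => V t x * cosk k (x + INR m * t)) 0 (2 * PI),
     -1 * RInt (fun x => V t x * sink k (x + INR m * t)) 0 (2 * PI)))).
  - rewrite CRInt_pair.
    + rewrite RInt_Rscal by (apply ex_RInt_cont; intros; now apply (cont2_RInt_x _ 0 (2 * PI) Hn)).
      rewrite !double_integral_comoving; auto using cosk_continuous, sink_continuous.
      * fold A. unfold rscal, Cmult, RtoC; simpl. f_equal; field; lra.
      * apply sink_test.
      * apply cosk_test.
    + apply ex_RInt_cont. now apply (cont2_RInt_x _ 0 (2 * PI) Hc).
    + apply ex_RInt_Rscal. apply ex_RInt_cont.
      now apply (cont2_RInt_x _ 0 (2 * PI) Hn).
  - intros t.
    rewrite (CRInt_ext _ (fun x => (V t x * cosk k (x + INR m * t), -1 * (V t x * sink k (x + INR m * t))))).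
    + rewrite CRInt_pair.
      * f_equal. apply RInt_Rscal. apply ex_RInt_cont. intros x. apply (cont2_x _ t x Hn).
      * apply ex_RInt_cont. intros x. apply (cont2_x _ t x Hc).
      * apply ex_RInt_Rscal. apply ex_RInt_cont. intros x. apply (cont2_x _ t x Hn).
    + intros x. unfold rscal, expi, Cmult, RtoC, cosk, sink; simpl.
      rewrite cos_neg, sin_neg, mult_IZR, <- INR_IZR_INZ.
      replace (IZR k * x + INR m * IZR k * t) with (IZR k * (x + INR m * t)) by ring.
      f_equal; ring.
Qed.

(** The limits in [resavg] exist because its partial sums are Dirichlet means of a smooth periodic
    function, whose imaginary parts cancel between [k] and [- k]. *)
Lemma resavg_eq (V : R -> R -> R) (m : nat) (x : R) :
  Cinf V -> periodic2 V -> resavg V m x = RtoC (time_average (comoving V m) x).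
Proof.
  intros HV Hp. set (A := time_average (comoving V m)).
  assert (HA : smooth1 A) by (apply time_average_smooth; now apply comoving_Cinf).
  assert (HAp : periodic1 A) by (apply time_average_periodic; now apply comoving_periodic).
  assert (HS : forall N, sumZ (resavg_term V m x) N = (dirichlet_mean A N x, 0)).
  { intros N. rewrite <- sumZ_fourier by (intros; now apply smooth1_continuous).
    f_equal. apply functional_extensionality. intros k. unfold resavg_term, fourier_term.
    now rewrite fourier2_resonant. }
  unfold resavg.
  rewrite (Lim_seq_ext _ (fun N => dirichlet_mean A N x)) by (intros N; now rewrite HS).
  rewrite (Lim_seq_ext (fun N => snd _) (fun _ => 0)) by (intros N; now rewrite HS).
  rewrite Lim_seq_const.
  destruct (dirichlet_mean_rate A HA HAp) as [C HC].
  assert (HL : is_lim_seq (fun N => dirichlet_mean A N x) (A x)).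
  { apply is_lim_seq_spec. intros eps. assert (He := cond_pos eps).
    destruct (INR_unbounded (C / eps)) as [N HN]. exists N. intros n Hn.
    eapply Rle_lt_trans; [apply HC | ].
    assert (H0 := pos_INR N). assert (H1 := le_INR _ _ Hn).
    assert (H2 : C < INR N * eps).
    { apply Rmult_lt_reg_r with (/ eps). now apply Rinv_0_lt_compat.
      replace (INR N * eps * / eps) with (INR N) by (field; lra). exact HN. }
    apply Rmult_lt_reg_r with (INR n + / 2); [lra | ].
    replace (C / (INR n + / 2) * (INR n + / 2)) with C by (field; lra). nra. }
  rewrite (is_lim_seq_unique _ _ HL). reflexivity.
Qed.

Lemma unstable_zero (V : R -> R -> R) (m : nat) :
  Cinf V -> periodic2 V -> resonantly_unstable V m ->
  exists x, time_average (comoving V m) x = 0 /\ 0 < Derive (time_average (comoving V m)) x.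
Proof.
  intros HV Hp [[x0 H0] Hnd]. set (A := time_average (comoving V m)).
  apply attracting_zero.
  - apply time_average_smooth. now apply comoving_Cinf.
  - apply time_average_periodic. now apply comoving_periodic.
  - exists x0. rewrite resavg_eq in H0 by auto. now injection H0.
  - intros x Hx HD. apply (Hnd x).
    + rewrite resavg_eq by auto. fold A. now rewrite Hx.
    + unfold resavg_deriv.
      rewrite (Derive_ext _ A) by (intros y; now rewrite resavg_eq).
      rewrite (Derive_ext (fun y => snd _) (fun _ => 0)) by (intros y; now rewrite resavg_eq).
      now rewrite HD, Derive_const.
Qed.

Lemma pairing_components (w : R -> C) (g : R -> R) :
  (forall x, continuous w x) -> (forall x, continuous g x) ->
  pairing w g = (dual (fun x => fst (w x)) g, dual (fun x => snd (w x)) g).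
Proof.
  intros Hw Hg. unfold pairing.
  rewrite (CRInt_ext _ (fun x => (g x * fst (w x), g x * snd (w x)))).
  - apply CRInt_pair; apply ex_RInt_dual; auto; intros x.
    + exact (proj1 (continuous_components w x (Hw x))).
    + exact (proj2 (continuous_components w x (Hw x))).
  - intros x. unfold rscal, Cmult, RtoC; simpl. f_equal; ring.
Qed.

Definition drift (m : nat) (eps : R) (V : R -> R -> R) (t x : R) : R := - (INR m + eps * V t x).

Lemma drift_Cinf (m : nat) (eps : R) (V : R -> R -> R) : Cinf V -> Cinf (drift m eps V).
Proof.
  intros HV n. apply Cx_opp, Cx_plus; [apply Cx_const | ]. apply Cx_mult; auto using Cx_const.
Qed.

Lemma drift_periodic (m : nat) (eps : R) (V : R -> R -> R) : periodic2 V -> periodic2 (drift m eps V).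
Proof. intros Hp t x. unfold drift. destruct (Hp t x) as [-> ->]. auto. Qed.

Lemma Derive_drift (m : nat) (eps : R) (V : R -> R -> R) (t x : R) : Cinf V ->
  Derive (drift m eps V t) x = - (eps * Derive (V t) x).
Proof.
  intros HV. apply is_derive_unique. unfold drift. assert (H := Cinf_derive V t x HV).
  eapply is_derive_value.
  - apply is_derive_Ropp.
    apply is_derive_Rplus.
    + apply is_derive_Rconst.
    + apply (is_derive_scal (V t)). exact H.
  - unfold plus, opp, zero; simpl. ring.
Qed.

(** The operator is formally skew-symmetric: moved onto the test function it changes only its sign,
    which is why transported test functions solve the same equation. *)
Lemma weak_operator_eq (m : nat) (eps : R) (V : R -> R -> R) (g : R -> R) (t x : R) :
  Cinf V -> smooth1 g ->
  - Derive (fun y => (INR m + eps * V t y) * g y) x + eps / 2 * Derive (fun y => V t y) x * g x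
  = drift m eps V t x * Derive g x + / 2 * Derive (drift m eps V t) x * g x.
Proof.
  intros HV Hg. rewrite Derive_drift by auto. change (Derive (fun y => V t y) x) with (Derive (V t) x).
  assert (HD : Derive (fun y => (INR m + eps * V t y) * g y) x
               = eps * Derive (V t) x * g x + (INR m + eps * V t x) * Derive g x).
  { apply is_derive_unique. eapply is_derive_value.
    - apply (is_derive_mult (fun y => INR m + eps * V t y) g); [ | now apply smooth1_derive | intros; apply Rmult_comm].
      apply is_derive_Rplus.
      + apply is_derive_Rconst.
      + apply (is_derive_scal (V t)). now apply Cinf_derive.
    - unfold plus, mult, zero; simpl. ring. }
  rewrite HD. unfold drift. field.
Qed.

Lemma weak_operator_continuous (b : R -> R -> R) (g : R -> R) (t x : R) :
  Cinf b -> smooth1 g -> continuous (fun x => b t x * Derive g x + / 2 * Derive (b t) x * g x) x.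
Proof.
  intros Hb Hg. assert (Hg' := smooth1_Derive g Hg).
  apply continuous_Rplus; apply continuous_Rmult; try now apply smooth1_continuous.
  - apply cont2_x. now apply Cinf_cont.
  - apply continuous_Rmult. apply continuous_const.
    apply (cont2_x (fun t x => Derive (b t) x)). apply Cinf_cont. now apply Cinf_Derive.
Qed.

Lemma pairing_ext (w : R -> C) (f g : R -> R) : (forall x, f x = g x) -> pairing w f = pairing w g.
Proof. intros H. replace g with f; auto. now apply functional_extensionality. Qed.

Lemma transport_is_solution (m : nat) (eps s : R) (V psi phi : R -> R -> R) :
  Cinf V -> flow_setup (drift m eps V) psi phi ->
  is_solution s m eps V (fun _ => RtoC 1)
    (fun t x => RtoC (transport (drift m eps V) psi phi (fun _ => 1) t x)).
Proof.
  intros HV HS. set (b := drift m eps V) in *. set (w := transport b psi phi (fun _ => 1)).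
  assert (Hb : Cinf b) by now apply drift_Cinf.
  assert (H1s : smooth1 (fun _ => 1)) by (intros n; apply Cx_const).
  assert (H1p : periodic1 (fun _ : R => 1)) by (intros x; auto).
  assert (Hw : Cinf w) by now apply transport_Cinf.
  assert (Hwp : forall t, periodic1 (w t)) by (intros; now apply transport_periodic).
  assert (Hwt := fun t => slice_test_function w t Hw Hwp).
  assert (Hwc : forall t x, continuous (w t) x) by (intros; now apply test_function_continuous).
  assert (Hpair : forall t g, (forall x, continuous g x) ->
            pairing (fun x => RtoC (w t x)) g = RtoC (dual (w t) g)).
  { intros t g Hg. rewrite pairing_components by (auto; intros; now apply continuous_RtoC).
    simpl. rewrite dual_zero. reflexivity. }
  assert (Hder : forall g t, test_fun g ->
    @is_derive R_AbsRing C_R_NormedModule (fun tau => pairing (fun x => RtoC (w tau x)) g) t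
      (pairing (fun x => RtoC (w t x)) (fun x => - Derive (fun y => (INR m + eps * V t y) * g y) x
            + eps / 2 * Derive (fun y => V t y) x * g x))).
  { intros g t Hg. apply test_fun_iff in Hg. destruct Hg as [Hgp Hg].
    assert (Hgc := fun x => smooth1_continuous g x Hg).
    apply (is_derive_ext (fun tau => RtoC (dual (w tau) g))).
    { intros tau. symmetry. now apply Hpair. }
    rewrite (pairing_ext _ _ _ (fun x => weak_operator_eq m eps V g t x HV Hg)).
    rewrite Hpair by (intros; now apply weak_operator_continuous).
    apply is_derive_RtoC. now apply transport_weak_solution. }
  split; [ | split].
  - intros t _. split; [ | split].
    + intros x. now rewrite Hwp.
    + intros x. now apply continuous_RtoC.
    + now apply inHs_smooth.
  - intros k. f_equal. apply functional_extensionality. intros x. f_equal. now apply transport_0.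
  - intros g Hg. split; [ | now intros; apply Hder].
    (* The flow exists for all real times, so the pairing is differentiable at 0 too, and
       right-continuity is a restriction of this. *)
    assert (Hc : continuous (fun tau => pairing (fun x => RtoC (w tau x)) g) 0).
    { apply (ex_derive_continuous (K := R_AbsRing) (V := C_R_NormedModule)).
      eexists. now apply Hder. }
    intros P HP. specialize (Hc P HP). revert Hc. unfold filtermap, at_right, within.
    apply filter_imp. auto.
Qed.

Lemma solution_weak_curve (m : nat) (eps s : R) (V : R -> R -> R) (u0 : R -> C) (u : R -> R -> C) :
  Cinf V -> is_solution s m eps V u0 u ->
  let D := fun v g t => dual (v t) (fun x => drift m eps V t x * Derive g x
                                  + / 2 * Derive (drift m eps V t) x * g x) in
  weak_curve (fun t x => fst (u t x)) (D (fun t x => fst (u t x))) /\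
  weak_curve (fun t x => snd (u t x)) (D (fun t x => snd (u t x))).
Proof.
  intros HV (Hreg & _ & Heq) D.
  assert (Hb := drift_Cinf m eps V HV).
  assert (Hu : forall t, 0 <= t -> forall x, continuous (u t) x) by (intros t Ht; apply (Hreg t Ht)).
  assert (Hp : forall t g, 0 <= t -> (forall x, continuous g x) ->
    pairing (u t) g = (dual (fun x => fst (u t x)) g, dual (fun x => snd (u t x)) g)).
  { intros t g Ht Hg. apply pairing_components; auto. }
  assert (Hlim : forall g, test_function g -> forall pr : C -> R, (forall z, continuous pr z) ->
    filterlim (fun t => pr (pairing (u t) g)) (at_right 0) (locally (pr (pairing (u 0) g)))).
  { intros g Hg pr Hpr. apply test_fun_iff in Hg. destruct (Heq g Hg) as [Hr _].
    eapply filterlim_comp. exact Hr. apply Hpr. }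
  assert (Hder : forall g t, test_function g -> 0 < t ->
    is_derive (fun s => dual (fun x => fst (u s x)) g) t (D (fun t x => fst (u t x)) g t) /\
    is_derive (fun s => dual (fun x => snd (u s x)) g) t (D (fun t x => snd (u t x)) g t)).
  { intros g t Hg Ht. assert (Hg' := Hg). destruct Hg' as [Hgp Hgs].
    assert (Hgc := fun x => smooth1_continuous g x Hgs).
    apply test_fun_iff in Hg. destruct (Heq g Hg) as [_ Hd]. specialize (Hd t Ht).
    rewrite (pairing_ext _ _ _ (fun x => weak_operator_eq m eps V g t x HV Hgs)) in Hd.
    rewrite Hp in Hd by (try lra; intros; now apply weak_operator_continuous).
    apply is_derive_components in Hd. destruct Hd as [Hd1 Hd2].
    (* The component formula for the pairing is known only at nonnegative times, hence equality near
       [t > 0] rather than everywhere. *)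
    assert (Hloc : locally t (fun s => 0 <= s)).
    { exists (mkposreal t Ht). intros y Hy. change (Rabs (y - t) < t) in Hy. apply Rabs_def2 in Hy. lra. }
    split.
    - apply (is_derive_ext_loc (fun s => fst (pairing (u s) g))); auto.
      revert Hloc. apply filter_imp. intros y Hy. now rewrite Hp.
    - apply (is_derive_ext_loc (fun s => snd (pairing (u s) g))); auto.
      revert Hloc. apply filter_imp. intros y Hy. now rewrite Hp. }
  assert (Hright : forall (h k : R -> R), (forall t, 0 <= t -> h t = k t) ->
    filterlim h (at_right 0) (locally (h 0)) -> filterlim k (at_right 0) (locally (k 0))).
  { intros h k Hhk Hh. rewrite <- (Hhk 0) by lra. revert Hh. apply filterlim_ext_loc.
    exists (mkposreal 1 Rlt_0_1). intros y _ Hy. apply Hhk. lra. }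
  split; split.
  - intros t Ht x. exact (proj1 (continuous_components (u t) x (Hu t Ht x))).
  - intros g Hg. split; [ | intros t Ht; exact (proj1 (Hder g t Hg Ht))].
    apply (Hright (fun t => fst (pairing (u t) g))).
    + intros t Ht. rewrite Hp; auto. intros; now apply test_function_continuous.
    + apply (Hlim g Hg (fun z => fst z)). intros [z1 z2]. apply continuous_fst.
  - intros t Ht x. exact (proj2 (continuous_components (u t) x (Hu t Ht x))).
  - intros g Hg. split; [ | intros t Ht; exact (proj2 (Hder g t Hg Ht))].
    apply (Hright (fun t => snd (pairing (u t) g))).
    + intros t Ht. rewrite Hp; auto. intros; now apply test_function_continuous.
    + apply (Hlim g Hg (fun z => snd z)). intros [z1 z2]. apply continuous_snd.
Qed.

(** Equality of Fourier coefficients is the right notion of uniqueness here, since [Hs_norm] depends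
    on a function only through them. *)
Lemma solution_fc_unique (m : nat) (eps s : R) (V : R -> R -> R) (u0 : R -> C) (u w : R -> R -> C) (T : R) :
  Cinf V -> periodic2 V -> 0 < T ->
  is_solution s m eps V u0 u -> is_solution s m eps V u0 w -> forall k, fc (u T) k = fc (w T) k.
Proof.
  intros HV Hp HT Hu Hw k.
  set (b := drift m eps V).
  assert (Hb : Cinf b) by now apply drift_Cinf. assert (Hbp : periodic2 b) by now apply drift_periodic.
  destruct (flow_exists b Hb Hbp) as [psi Hpsi].
  destruct (inverse_flow_exists b psi Hb Hbp Hpsi) as [phi Hphi].
  assert (HS : flow_setup b psi phi) by (unfold flow_setup; auto).
  destruct (solution_weak_curve m eps s V u0 u HV Hu) as [Hu1 Hu2].
  destruct (solution_weak_curve m eps s V u0 w HV Hw) as [Hw1 Hw2].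
  fold b in Hu1, Hu2, Hw1, Hw2.
  assert (Huc : forall t, 0 <= t -> forall x, continuous (u t) x) by (intros t Ht; apply (proj1 Hu t Ht)).
  assert (Hwc : forall t, 0 <= t -> forall x, continuous (w t) x) by (intros t Ht; apply (proj1 Hw t Ht)).
  assert (Hfc0 : forall k, fc (u 0) k = fc (w 0) k).
  { intros j. rewrite (proj1 (proj2 Hu)). symmetry. apply (proj1 (proj2 Hw)). }
  assert (Hd0 := fc_eq_dual (u 0) (w 0) (Huc 0 (Rle_refl 0)) (Hwc 0 (Rle_refl 0)) Hfc0).
  (* The initial values are known to agree only in their coefficients, whereas duality tests them on
     a pulled-back function; Fourier uniqueness bridges the two. *)
  assert (Hinit : forall v v' : R -> R, (forall x, continuous v x) -> (forall x, continuous v' x) ->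
    (forall j, dual v (cosk j) = dual v' (cosk j)) -> (forall j, dual v (sink j) = dual v' (sink j)) ->
    forall G, test_function G -> dual v G = dual v' G).
  { intros v v' Hv Hv' Hc Hs G HG.
    assert (Hdiff : forall g, (forall x, continuous g x) -> dual (fun x => v x - v' x) g = dual v g - dual v' g).
    { intros g Hg. unfold dual. rewrite <- RInt_Rminus by now apply ex_RInt_dual.
      apply RInt_eq. intros; ring. }
    assert (H := fourier_uniqueness (fun x => v x - v' x) G).
    rewrite Hdiff in H by (intros; now apply test_function_continuous).
    apply Rminus_diag_uniq, H; auto.
    - intros x. now apply continuous_Rminus.
    - intros j. rewrite Hdiff, Hc by apply cosk_continuous. ring.
    - intros j. rewrite Hdiff, Hs by apply sink_continuous. ring. }
  assert (HT0 : 0 <= T) by lra.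
  assert (E1 : forall g, test_function g -> dual (fun x => fst (u T x)) g = dual (fun x => fst (w T x)) g).
  { intros g Hg. rewrite (weak_solution_pairing b psi phi _ g T HS Hu1 Hg HT).
    rewrite (weak_solution_pairing b psi phi _ g T HS Hw1 Hg HT).
    apply Hinit; [ | | | | now apply pullback_test_function].
    - intros x. exact (proj1 (continuous_components (u 0) x (Huc 0 (Rle_refl 0) x))).
    - intros x. exact (proj1 (continuous_components (w 0) x (Hwc 0 (Rle_refl 0) x))).
    - intros j. exact (proj1 (Hd0 j)).
    - intros j. exact (proj1 (proj2 (Hd0 j))). }
  assert (E2 : forall g, test_function g -> dual (fun x => snd (u T x)) g = dual (fun x => snd (w T x)) g).
  { intros g Hg. rewrite (weak_solution_pairing b psi phi _ g T HS Hu2 Hg HT).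
    rewrite (weak_solution_pairing b psi phi _ g T HS Hw2 Hg HT).
    apply Hinit; [ | | | | now apply pullback_test_function].
    - intros x. exact (proj2 (continuous_components (u 0) x (Huc 0 (Rle_refl 0) x))).
    - intros x. exact (proj2 (continuous_components (w 0) x (Hwc 0 (Rle_refl 0) x))).
    - intros j. exact (proj1 (proj2 (proj2 (Hd0 j)))).
    - intros j. exact (proj2 (proj2 (proj2 (Hd0 j)))). }
  rewrite !fc_components by auto.
  now rewrite !(E1 (cosk k)), !(E1 (sink k)), !(E2 (cosk k)), !(E2 (sink k)) by (apply cosk_test || apply sink_test).
Qed.

Lemma log_jac_along_attractor (m : nat) (V : R -> R -> R) :
  Cinf V -> periodic2 V -> resonantly_unstable V m ->
  exists e0 c B x0, 0 < e0 /\ 0 < c /\ 0 <= B /\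
    forall eps psi, 0 < eps < e0 -> is_flow (drift m eps V) psi ->
    forall t, 0 <= t -> log_jac (drift m eps V) psi t x0 <= - eps * (c * t - B).
Proof.
  intros HV Hp Hun.
  destruct (unstable_zero V m HV Hp Hun) as (x0 & H0 & H1).
  assert (Hf := comoving_Cinf V m HV). assert (Hfp := comoving_periodic V m Hp).
  destruct (averaging (comoving V m) x0 Hf Hfp H0 H1) as (e0 & c & B & He0 & Hc & HB & Hav).
  exists e0, c, B, x0. split; [ | split; [ | split]]; auto.
  intros eps psi Heps Hpsi t Ht.
  assert (Hb := drift_Cinf m eps V HV). assert (Hbp := drift_periodic m eps V Hp).
  specialize (Hav eps (fun t => psi t x0 + INR m * t) Heps). cbv beta in Hav.
  assert (Hz : forall t, psi t x0 + INR m * t - INR m * t = psi t x0) by (intros; ring).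
  assert (Hint : RInt (fun s => Derive (comoving V m s) (psi s x0 + INR m * s)) 0 t
                 = RInt (fun s => Derive (V s) (psi s x0)) 0 t).
  { apply RInt_eq. intros s. now rewrite Derive_comoving, Hz. }
  unfold log_jac. rewrite (RInt_eq _ (fun s => - eps * Derive (V s) (psi s x0))).
  - rewrite RInt_Rscal.
    + rewrite <- Hint. apply Rmult_le_compat_neg_l; [lra | ].
      apply Hav; auto.
      * rewrite (proj1 Hpsi). ring.
      * intros s. eapply is_derive_value.
        { apply is_derive_Rplus.
          - apply Hpsi.
          - apply (is_derive_scal (fun s => s)). apply is_derive_Rid. }
        unfold comoving. rewrite Hz. unfold drift, plus, one; simpl. ring.
    + apply ex_RInt_cont. intros s.
      apply (cont2_continuous_comp _ (fun s x => Derive (V s) x) (fun s => s) (fun s => psi s x0)).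
      * apply Cinf_cont. now apply Cinf_Derive.
      * apply continuous_id.
      * apply cont2_t. now apply (flow_cont2 (drift m eps V)).
  - intros s. rewrite Derive_drift by auto. ring.
Qed.

Theorem theorem1 (m : nat) (V : R -> R -> R) :
  (0 < m)%nat ->
  smooth_T2 V ->
  resonantly_unstable V m ->
  exists epsV delta1 delta2 : R,
    0 < epsV /\ 0 < delta1 /\ 0 < delta2 /\
    forall eps s : R, 0 < eps -> eps < epsV -> 1 < s ->
      exists u0 : R -> C,
        periodic1 u0 /\ (forall x, continuous u0 x) /\ inHs s u0 /\
        (exists k, fc u0 k <> 0%C) /\
        (exists u, is_solution s m eps V u0 u) /\
        (forall u, is_solution s m eps V u0 u ->
           forall t, 0 < t ->
             Hs_norm s (u t) >= delta1 * exp (eps * delta2 * t) * Hs_norm s u0).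
Proof.
  intros _ HVs Hun.
  assert (HV := smooth_T2_Cinf V HVs). destruct HVs as [Hp _].
  destruct (log_jac_along_attractor m V HV Hp Hun) as (e0 & c & B & x0 & He0 & Hc & HB & Hjac).
  (* Both halves come from the square root of the Jacobian, and the 3 from [sobolev_sup]. The
     condition [eps < 1] bounds [exp (- eps * B / 2)] below by [exp (- B / 2)]. *)
  exists (Rmin e0 1), (exp (- B / 2) / 3), (c / 2).
  assert (Hexp := exp_pos (- B / 2)).
  split; [apply Rmin_glb_lt; lra | split; [lra | split; [lra | ]]].
  intros eps s Heps Heps1 Hs.
  assert (Hlt0 : eps < e0) by (eapply Rlt_le_trans; [exact Heps1 | apply Rmin_l]).
  assert (Hlt1 : eps < 1) by (eapply Rlt_le_trans; [exact Heps1 | apply Rmin_r]).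
  set (b := drift m eps V).
  assert (Hb : Cinf b) by now apply drift_Cinf. assert (Hbp : periodic2 b) by now apply drift_periodic.
  destruct (flow_exists b Hb Hbp) as [psi Hpsi].
  destruct (inverse_flow_exists b psi Hb Hbp Hpsi) as [phi Hphi].
  assert (HS : flow_setup b psi phi) by (unfold flow_setup; auto).
  assert (H1t : test_function (fun _ => 1)) by (split; [intros x; auto | intros n; apply Cx_const]).
  assert (Hsol := transport_is_solution m eps s V psi phi HV HS). fold b in Hsol.
  exists (fun _ => RtoC 1). split; [ | split; [ | split; [ | split; [ | split]]]].
  - intros x. auto.
  - intros x. apply continuous_const.
  - now apply (inHs_smooth (fun _ => 1)).
  - exists 0%Z. rewrite fc_one. simpl. intros E. injection E. lra.
  - eexists. exact Hsol.
  - intros u Hu t Ht. rewrite Hs_norm_one, Rmult_1_r.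
    rewrite (Hs_norm_ext s _ _ (solution_fc_unique m eps s V _ u _ t HV Hp Ht Hu Hsol)).
    set (w := transport b psi phi (fun _ => 1)).
    assert (Hw : test_function (w t)).
    { apply slice_test_function.
      - apply transport_Cinf; auto. apply H1t.
      - intros; apply transport_periodic; auto. apply H1t. }
    (* The sup norm is tested at the current position of the attracted orbit, where the Jacobian is
       exponentially small. *)
    assert (Hsup := sobolev_sup (w t) s (psi t x0) (proj2 Hw) (proj1 Hw) Hs (inHs_smooth (w t) s Hw)).
    assert (Hval : exp (- B / 2) * exp (eps * (c / 2) * t) <= w t (psi t x0)).
    { unfold w, transport. rewrite (inverse_flow_left b psi phi), Rmult_1_l, <- exp_plus by auto.
      apply exp_le_compat.
      assert (H := Hjac eps psi (conj Heps Hlt0) Hpsi t (Rlt_le _ _ Ht)). fold b in H.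
      assert (eps * B <= 1 * B) by (apply Rmult_le_compat_r; lra). lra. }
    assert (Hpos : 0 < exp (- B / 2) * exp (eps * (c / 2) * t)) by (apply Rmult_lt_0_compat; apply exp_pos).
    rewrite Rabs_right in Hsup by lra.
    change (fun x => RtoC (transport b psi phi (fun _ => 1) t x)) with (fun y => RtoC (w t y)).
    lra.
Qed.
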